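(* The class of tree-cographs is tractable, that is: (QA) a tree-cograph is asymmetric if and only if it is quantum asymmetric; (QI) two quantum isomorphic tree-cographs are isomorphic; (SA) a tree-cograph has quantum symmetry if and only if it satisfies Schmidt's criterion.
   Context: Graphs are finite, simple and undirected, with at least one vertex. The class of tree-cographs is the smallest class of graphs containing all trees and stable under finite disjoint unions and complement. A graph is asymmetric if its automorphism group is trivial. A magic unitary with coefficients in a nonzero unital $C^*$-algebra $X$ is a square matrix whose entries are self-adjoint projections of $X$ with every row and column summing to $1_X$. $G$ and $H$ (with equally many vertices) are quantum isomorphic if there is a magic unitary $U$, with coefficients in some nonzero unital $C^*$-algebra, rows indexed by $V(H)$ and columns by $V(G)$, with $U\,\mathrm{Adj}(G)=\mathrm{Adj}(H)\,U$ ($\mathrm{Adj}$ = adjacency matrix). $\mathcal O(\mathrm{Qu}(G))$ is the universal unital complex $*$-algebra generated by $u_{xy}$ ($x,y\in V(G)$) with relations $u_{xy}^*=u_{xy}=u_{xy}^2$, $\sum_y u_{xy}=1=\sum_y u_{yx}$, $u_{xy}u_{xz}=0=u_{yx}u_{zx}$ for $y\ne z$, and $u\,\mathrm{Adj}(G)=\mathrm{Adj}(G)\,u$; $C(\mathrm{Qu}(G))$ is its universal enveloping $C^*$-algebra. $G$ is quantum asymmetric if $\mathcal O(\mathrm{Qu}(G))=\mathbb C$. $G$ has quantum symmetry if $C(\mathrm{Qu}(G))$ is not commutative. $G$ satisfies Schmidt's criterion if it has two nontrivial automorphisms with disjoint supports, where $\mathrm{Supp}(f)=\{x\in V(G)\mid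 f(x)\neq x\}$. *)

(* Defs.v *)
From HB Require Import structures.
From mathcomp Require Import all_boot all_order all_algebra all_fingroup.
From mathcomp Require Import generic_quotient complex.
From mathcomp Require Import boolp reals.

Set Implicit Arguments.
Unset Strict Implicit.
Unset Printing Implicit Defensive.

Import Order.TTheory GRing.Theory Num.Theory.

Local Open Scope ring_scope.
Local Open Scope quotient_scope.

Reserved Notation "a ^s" (at level 1, format "a ^s").

Record sgraph := SGraph {
  vertex :> finType;
  adj : rel vertex;
  adj_sym : symmetric adj;
  adj_irrefl : irreflexive adj;
  vertex_gt0 : (0 < #|vertex|)%N
}.

Definition isomorphic (G H : sgraph) : Prop :=
  exists f : G -> H, bijective f /\ forall x y, adj (f x) (f y) = adj x y.

Definition graph_aut (G : sgraph) : {set {perm G}} :=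
  [set f : {perm G} | [forall x, forall y, adj (f x) (f y) == adj x y]].

Definition asymmetric (G : sgraph) : Prop := graph_aut G = [set 1%g].

Definition supp (G : sgraph) (f : {perm G}) : {set G} := [set x | f x != x].

Definition schmidt_criterion (G : sgraph) : Prop :=
  exists f g : {perm G},
    [/\ f \in graph_aut G, g \in graph_aut G, f != 1%g, g != 1%g
      & [disjoint supp f & supp g]].

(* Cycles have at least three vertices: [ucycleb] alone also accepts the empty
   sequence and [:: x; y] for an edge xy. *)
Definition is_tree (G : sgraph) : Prop :=
  (forall x y : G, connect (@adj G) x y) /\
  (forall c : seq G, (2 < size c)%N -> ~~ ucycleb (@adj G) c).

Section Complement.
Variable G : sgraph.

Definition compl_adj : rel G := fun x y => (x != y) && ~~ adj x y.

Lemma compl_adj_sym : symmetric compl_adj.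
Proof. by move=> x y; rewrite /compl_adj eq_sym adj_sym. Qed.

Lemma compl_adj_irrefl : irreflexive compl_adj.
Proof. by move=> x; rewrite /compl_adj eqxx. Qed.

Definition complement : sgraph :=
  SGraph compl_adj_sym compl_adj_irrefl (vertex_gt0 G).

End Complement.

Section DisjointUnion.
Variables (I : finType) (I_gt0 : (0 < #|I|)%N) (F : I -> sgraph).

Let V : finType := {i : I & F i}.

Definition dunion_adj : rel V :=
  fun u v => (tag u == tag v) && adj (tagged u) (tagged_as u v).

Lemma dunion_adj_sym : symmetric dunion_adj.
Proof.
move=> [i x] [j y]; rewrite /dunion_adj /=; case: (eqVneq i j) => //= ij.
by move: ij y => <- y; rewrite !tagged_asE adj_sym.
Qed.

Lemma dunion_adj_irrefl : irreflexive dunion_adj.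
Proof. by move=> [i x]; rewrite /dunion_adj tagged_asE /= adj_irrefl andbF. Qed.

Lemma dunion_gt0 : (0 < #|V|)%N.
Proof.
have /card_gt0P [i _] := I_gt0.
have /card_gt0P [x _] := vertex_gt0 (F i).
by apply/card_gt0P; exists (Tagged F x).
Qed.

Definition disjoint_union : sgraph :=
  SGraph dunion_adj_sym dunion_adj_irrefl dunion_gt0.

End DisjointUnion.

(* Classes of graphs are closed under isomorphism, whence [tc_iso]. *)
Inductive tree_cograph : sgraph -> Prop :=
| tc_tree G : is_tree G -> tree_cograph G
| tc_dunion (I : finType) (I_gt0 : (0 < #|I|)%N) (F : I -> sgraph) :
    (forall i, tree_cograph (F i)) -> tree_cograph (disjoint_union I_gt0 F)
| tc_compl G : tree_cograph G -> tree_cograph (complement G)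
| tc_iso G H : isomorphic G H -> tree_cograph G -> tree_cograph H.

(* [GRing.Algebra] is unital, associative and nonzero (1 != 0). *)
HB.mixin Record isStarAlgebra (R : realType) A of GRing.Algebra R[i] A := {
  star : A -> A;
  starK : forall a, star (star a) = a;
  starD : forall a b, star (a + b) = star a + star b;
  starZ : forall (c : R[i]) a, star (c *: a) = c^* *: star a;
  starM : forall a b, star (a * b) = star b * star a
}.

#[short(type="starAlgType")]
HB.structure Definition StarAlgebra (R : realType) :=
  {A of isStarAlgebra R A & GRing.Algebra R[i] A}.

Notation "a ^s" := (star a) : ring_scope.

(* The norm is a field of its own: inheriting [CompleteNormedModule R[i]] would
   require a common structure for noncommutative rings and normed modules, which
   the hierarchy of algebraic structures does not have. *)
HB.mixin Record isCStarAlgebra (R : realType) A of StarAlgebra R A := {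
  cnorm : A -> R;
  cnormD : forall a b, cnorm (a + b) <= cnorm a + cnorm b;
  cnormZ : forall (c : R[i]) a, cnorm (c *: a) = ComplexField.Normc.normc c * cnorm a;
  cnorm0_eq0 : forall a, cnorm a = 0 -> a = 0;
  cnormM : forall a b, cnorm (a * b) <= cnorm a * cnorm b;
  cnorm_star : forall a, cnorm (star a * a) = cnorm a ^+ 2;
  cnorm_complete : forall u : nat -> A,
    (forall e : R, 0 < e -> exists N : nat, forall m n : nat,
       (N <= m)%N -> (N <= n)%N -> cnorm (u m - u n) < e) ->
    exists l : A, forall e : R, 0 < e -> exists N : nat, forall n : nat,
       (N <= n)%N -> cnorm (u n - l) < e
}.

#[short(type="cstarAlgType")]
HB.structure Definition CStarAlgebra (R : realType) :=
  {A of isCStarAlgebra R A & StarAlgebra R A}.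

Definition star_preserving (R : realType) (A B : starAlgType R) (f : A -> B) :
  Prop := forall a, f a^s = (f a)^s.

Definition projection (R : realType) (A : starAlgType R) (p : A) : Prop :=
  p^s = p /\ p * p = p.

Definition adj_entry (A : pzRingType) (G : sgraph) (x y : G) : A :=
  (adj x y)%:R.
Arguments adj_entry A {G} x y.

Definition magic_unitary (R : realType) (X : cstarAlgType R) (I J : finType)
    (U : I -> J -> X) : Prop :=
  [/\ #|I| = #|J|,
      forall i j, projection (U i j),
      forall i, \sum_j U i j = 1
    & forall j, \sum_i U i j = 1].

Definition intertwines (A : pzRingType) (G H : sgraph) (U : H -> G -> A) :
    Prop :=
  forall (y : H) (x : G),
    \sum_(z : G) U y z * adj_entry A z x = \sum_(w : H) adj_entry A y w * U w x.

Definition quantum_isomorphic (R : realType) (G H : sgraph) : Prop :=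
  exists (X : cstarAlgType R) (U : H -> G -> X),
    magic_unitary U /\ intertwines U.

Definition qu_relations (R : realType) (A : starAlgType R) (G : sgraph)
    (u : G -> G -> A) : Prop :=
  [/\ forall x y, projection (u x y),
      forall x, \sum_y u x y = 1 /\ \sum_y u y x = 1,
      forall x y z, y != z -> u x y * u x z = 0 /\ u y x * u z x = 0
    & intertwines u].

(* O(Qu(G)) is the set of formal *-polynomials in the generators, modulo the
   congruence [qeq] generated by the axioms of unital complex *-algebras and
   the defining relations. *)
Inductive qterm (R : realType) (G : sgraph) : Type :=
| QGen of G & G
| QZero
| QOne
| QAdd of qterm R G & qterm R G
| QMul of qterm R G & qterm R G
| QScale of R[i] & qterm R G
| QStar of qterm R G.

Arguments QGen {R G}.
Arguments QZero {R G}.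
Arguments QOne {R G}.

Inductive qeq (R : realType) (G : sgraph) : qterm R G -> qterm R G -> Prop :=
| qeq_refl a : qeq a a
| qeq_sym a b : qeq a b -> qeq b a
| qeq_trans a b c : qeq a b -> qeq b c -> qeq a c
| qeq_add a a' b b' : qeq a a' -> qeq b b' -> qeq (QAdd a b) (QAdd a' b')
| qeq_mul a a' b b' : qeq a a' -> qeq b b' -> qeq (QMul a b) (QMul a' b')
| qeq_scale k a a' : qeq a a' -> qeq (QScale k a) (QScale k a')
| qeq_star a a' : qeq a a' -> qeq (QStar a) (QStar a')
| qeq_addA a b c : qeq (QAdd a (QAdd b c)) (QAdd (QAdd a b) c)
| qeq_addC a b : qeq (QAdd a b) (QAdd b a)
| qeq_add0 a : qeq (QAdd QZero a) a
| qeq_addN a : qeq (QAdd (QScale (-1) a) a) QZero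
| qeq_scaleA k l a : qeq (QScale k (QScale l a)) (QScale (k * l) a)
| qeq_scale1 a : qeq (QScale 1 a) a
| qeq_scaleDr k a b :
    qeq (QScale k (QAdd a b)) (QAdd (QScale k a) (QScale k b))
| qeq_scaleDl k l a :
    qeq (QScale (k + l) a) (QAdd (QScale k a) (QScale l a))
| qeq_mulA a b c : qeq (QMul a (QMul b c)) (QMul (QMul a b) c)
| qeq_mul1l a : qeq (QMul QOne a) a
| qeq_mul1r a : qeq (QMul a QOne) a
| qeq_mulDl a b c : qeq (QMul (QAdd a b) c) (QAdd (QMul a c) (QMul b c))
| qeq_mulDr a b c : qeq (QMul a (QAdd b c)) (QAdd (QMul a b) (QMul a c))
| qeq_scaleAl k a b : qeq (QScale k (QMul a b)) (QMul (QScale k a) b)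
| qeq_scaleAr k a b : qeq (QScale k (QMul a b)) (QMul a (QScale k b))
| qeq_starK a : qeq (QStar (QStar a)) a
| qeq_starD a b : qeq (QStar (QAdd a b)) (QAdd (QStar a) (QStar b))
| qeq_starZ k a : qeq (QStar (QScale k a)) (QScale k^* (QStar a))
| qeq_starM a b : qeq (QStar (QMul a b)) (QMul (QStar b) (QStar a))
| qeq_gen_star x y : qeq (QStar (QGen x y)) (QGen x y)
| qeq_gen_idem x y : qeq (QMul (QGen x y) (QGen x y)) (QGen x y)
| qeq_gen_row x : qeq (\big[@QAdd R G/QZero]_(y : G) QGen x y) QOne
| qeq_gen_col x : qeq (\big[@QAdd R G/QZero]_(y : G) QGen y x) QOne
| qeq_gen_orow x y z : y != z -> qeq (QMul (QGen x y) (QGen x z)) QZero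
| qeq_gen_ocol x y z : y != z -> qeq (QMul (QGen y x) (QGen z x)) QZero
| qeq_gen_adj x y :
    qeq (\big[@QAdd R G/QZero]_(z : G) QScale (adj_entry R[i] z y) (QGen x z))
        (\big[@QAdd R G/QZero]_(z : G) QScale (adj_entry R[i] x z) (QGen z y)).

Lemma adj_scaler (R : realType) (A : starAlgType R) (G : sgraph) (x y : G)
    (a : A) : adj_entry R[i] x y *: a = a * adj_entry A x y.
Proof. by rewrite /adj_entry scaler_nat mulr_natr. Qed.

Lemma adj_scalel (R : realType) (A : starAlgType R) (G : sgraph) (x y : G)
    (a : A) : adj_entry R[i] x y *: a = adj_entry A x y * a.
Proof. by rewrite /adj_entry scaler_nat mulr_natl. Qed.

Section Eval.
Variables (R : realType) (G : sgraph) (A : starAlgType R) (v : G -> G -> A).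

Fixpoint qeval (t : qterm R G) : A :=
  match t with
  | QGen x y => v x y
  | QZero => 0
  | QOne => 1
  | QAdd a b => qeval a + qeval b
  | QMul a b => qeval a * qeval b
  | QScale k a => k *: qeval a
  | QStar a => (qeval a)^s
  end.

Lemma qeval_big (I : Type) (r : seq I) (F : I -> qterm R G) :
  qeval (\big[@QAdd R G/QZero]_(i <- r) F i) = \sum_(i <- r) qeval (F i).
Proof. by elim/big_rec2: _ => //= i a b _ <-. Qed.

Lemma qeval_qeq : qu_relations v -> forall a b, qeq a b -> qeval a = qeval b.
Proof.
move=> [vP vS vO vA] a b; elim=> {a b} //=;
  try by move=> *; congruence.
- by move=> a b c; rewrite addrA.
- by move=> a b; rewrite addrC.
- by move=> a; rewrite add0r.
- by move=> a; rewrite scaleN1r addNr.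
- by move=> k l a; rewrite scalerA.
- by move=> a; rewrite scale1r.
- by move=> k a b; rewrite scalerDr.
- by move=> k l a; rewrite scalerDl.
- by move=> a b c; rewrite mulrA.
- by move=> a; rewrite mul1r.
- by move=> a; rewrite mulr1.
- by move=> a b c; rewrite mulrDl.
- by move=> a b c; rewrite mulrDr.
- by move=> k a b; rewrite scalerAl.
- by move=> k a b; rewrite scalerAr.
- by move=> a; rewrite starK.
- by move=> a b; rewrite starD.
- by move=> k a; rewrite starZ.
- by move=> a b; rewrite starM.
- by move=> x y; have [] := vP x y.
- by move=> x y; have [] := vP x y.
- by move=> x; rewrite qeval_big; have [] := vS x.
- by move=> x; rewrite qeval_big; have [] := vS x.
- by move=> x y z /(vO x)[].
- by move=> x y z /(vO x)[].
- move=> x y; rewrite !qeval_big /= (eq_bigr _ (fun z _ => adj_scaler _ _ _)).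
  by rewrite vA; apply: eq_bigr => z _; rewrite adj_scalel.
Qed.

End Eval.

Section ComplexStar.
Variable R : realType.

HB.instance Definition _ := @isStarAlgebra.Build R (R[i]^o)
  (fun z : R[i] => z^*) (fun z => conjCK z) (fun a b => rmorphD _ a b)
  (fun c a => rmorphM _ c a)
  (fun a b => etrans (rmorphM _ a b) (mulrC _ _)).

Lemma qu_relations_delta (G : sgraph) :
  @qu_relations R (R[i]^o) G (fun x y => (x == y)%:R).
Proof.
split.
- move=> x y; split; first exact: conjC_nat.
  by case: (x == y); rewrite ?mulr1 ?mulr0.
- move=> x; split; rewrite (bigD1 x) //= eqxx big1 ?addr0 // => y.
    by rewrite eq_sym => /negPf ->.
  by move=> /negPf ->.
- move=> x y z yz; split.
    case: (eqVneq x y) => [->|_]; last by rewrite mul0r.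
    by rewrite (negPf yz) mulr0.
  case: (eqVneq y x) yz => [->|_ _]; last by rewrite mul0r.
  by rewrite eq_sym => /negPf ->; rewrite mulr0.
- move=> y x; rewrite (bigD1 y) //= eqxx mul1r big1 => [|z]; last first.
    by rewrite eq_sym => /negPf ->; rewrite mul0r.
  rewrite [RHS](bigD1 x) //= eqxx mulr1 [in RHS]big1 // => z /negPf ->.
  by rewrite mulr0.
Qed.

End ComplexStar.

HB.instance Definition _ (R : realType) (G : sgraph) :=
  gen_eqMixin (qterm R G).
HB.instance Definition _ (R : realType) (G : sgraph) :=
  gen_choiceMixin (qterm R G).

Section OQu.
Variables (R : realType) (G : sgraph).
Notation T := (qterm R G).

Definition qeqb (a b : T) : bool := `[< qeq a b >].

Lemma qeqb_refl : reflexive qeqb.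
Proof. by move=> a; apply/asboolP; exact: qeq_refl. Qed.

Lemma qeqb_sym : symmetric qeqb.
Proof. by move=> a b; apply/asboolP/asboolP => ?; exact: qeq_sym. Qed.

Lemma qeqb_trans : transitive qeqb.
Proof.
by move=> b a c /asboolP ab /asboolP bc; apply/asboolP; exact: qeq_trans ab bc.
Qed.

Canonical qeqb_equiv := EquivRel qeqb qeqb_refl qeqb_sym qeqb_trans.

Definition OQu : Type := {eq_quot qeqb_equiv}.

HB.instance Definition _ := Choice.on OQu.
HB.instance Definition _ := EqQuotient.on OQu.

Definition ocls (t : T) : OQu := \pi_OQu t.

Lemma oclsP a b : ocls a = ocls b <-> qeq a b.
Proof.
split=> [/eqmodP/asboolP //|ab].
by apply/eqmodP; apply/asboolP.
Qed.

Lemma ocls_ind (P : OQu -> Prop) : (forall t, P (ocls t)) -> forall a, P a.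
Proof. by move=> PT; elim/quotW. Qed.

Definition oadd (a b : OQu) : OQu := ocls (QAdd (repr a) (repr b)).
Definition omul (a b : OQu) : OQu := ocls (QMul (repr a) (repr b)).
Definition oscale (k : R[i]) (a : OQu) : OQu := ocls (QScale k (repr a)).
Definition ostar (a : OQu) : OQu := ocls (QStar (repr a)).

Lemma repr_ocls t : qeq (repr (ocls t)) t.
Proof. by apply/oclsP; rewrite /ocls reprK. Qed.

Lemma oaddE a b : oadd (ocls a) (ocls b) = ocls (QAdd a b).
Proof. by apply/oclsP/qeq_add; exact: repr_ocls. Qed.

Lemma omulE a b : omul (ocls a) (ocls b) = ocls (QMul a b).
Proof. by apply/oclsP/qeq_mul; exact: repr_ocls. Qed.

Lemma oscaleE k a : oscale k (ocls a) = ocls (QScale k a).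
Proof. by apply/oclsP/qeq_scale; exact: repr_ocls. Qed.

Lemma ostarE a : ostar (ocls a) = ocls (QStar a).
Proof. by apply/oclsP/qeq_star; exact: repr_ocls. Qed.

Fact oaddA : associative oadd.
Proof.
elim/ocls_ind=> a; elim/ocls_ind=> b; elim/ocls_ind=> c.
by rewrite !oaddE; apply/oclsP; exact: qeq_addA.
Qed.

Fact oaddC : commutative oadd.
Proof.
elim/ocls_ind=> a; elim/ocls_ind=> b.
by rewrite !oaddE; apply/oclsP; exact: qeq_addC.
Qed.

Fact oadd0 : left_id (ocls QZero) oadd.
Proof.
by elim/ocls_ind=> a; rewrite oaddE; apply/oclsP; exact: qeq_add0.
Qed.

Fact oaddN : left_inverse (ocls QZero) (oscale (-1)) oadd.
Proof.
by elim/ocls_ind=> a; rewrite oscaleE oaddE; apply/oclsP; exact: qeq_addN.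
Qed.

HB.instance Definition _ := GRing.isZmodule.Build OQu oaddA oaddC oadd0 oaddN.

Fact omulA : associative omul.
Proof.
elim/ocls_ind=> a; elim/ocls_ind=> b; elim/ocls_ind=> c.
by rewrite !omulE; apply/oclsP; exact: qeq_mulA.
Qed.

Fact omul1l : left_id (ocls QOne) omul.
Proof.
by elim/ocls_ind=> a; rewrite omulE; apply/oclsP; exact: qeq_mul1l.
Qed.

Fact omul1r : right_id (ocls QOne) omul.
Proof.
by elim/ocls_ind=> a; rewrite omulE; apply/oclsP; exact: qeq_mul1r.
Qed.

Fact omulDl : left_distributive omul +%R.
Proof.
elim/ocls_ind=> a; elim/ocls_ind=> b; elim/ocls_ind=> c.
rewrite -[_ + _]/(oadd _ _) -[RHS]/(oadd _ _) oaddE !omulE oaddE.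
by apply/oclsP; exact: qeq_mulDl.
Qed.

Fact omulDr : right_distributive omul +%R.
Proof.
elim/ocls_ind=> a; elim/ocls_ind=> b; elim/ocls_ind=> c.
rewrite -[_ + _]/(oadd _ _) -[RHS]/(oadd _ _) oaddE !omulE oaddE.
by apply/oclsP; exact: qeq_mulDr.
Qed.

Fact oone_neq0 : ocls QOne != 0.
Proof.
apply/eqP => /oclsP /(qeval_qeq (@qu_relations_delta R G)) /=.
by apply/eqP; rewrite oner_eq0.
Qed.

HB.instance Definition _ := GRing.Zmodule_isNzRing.Build OQu
  omulA omul1l omul1r omulDl omulDr oone_neq0.

Fact oscaleA k l a : oscale k (oscale l a) = oscale (k * l) a.
Proof.
elim/ocls_ind: a => a.
by rewrite !oscaleE; apply/oclsP; exact: qeq_scaleA.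
Qed.

Fact oscale1 : left_id 1 oscale.
Proof.
by elim/ocls_ind=> a; rewrite oscaleE; apply/oclsP; exact: qeq_scale1.
Qed.

Fact oscaleDr : right_distributive oscale +%R.
Proof.
move=> k; elim/ocls_ind=> a; elim/ocls_ind=> b.
rewrite -[_ + _]/(oadd _ _) -[RHS]/(oadd _ _) oaddE !oscaleE oaddE.
by apply/oclsP; exact: qeq_scaleDr.
Qed.

Fact oscaleDl a : {morph oscale^~ a : k l / k + l}.
Proof.
move=> k l; elim/ocls_ind: a => a.
rewrite -[RHS]/(oadd _ _) !oscaleE oaddE.
by apply/oclsP; exact: qeq_scaleDl.
Qed.

HB.instance Definition _ := GRing.Zmodule_isLmodule.Build R[i] OQu
  oscaleA oscale1 oscaleDr oscaleDl.

Fact oscaleAl (k : R[i]) (a b : OQu) : k *: (a * b) = (k *: a) * b.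
Proof.
elim/ocls_ind: a => a; elim/ocls_ind: b => b.
rewrite -[LHS]/(oscale k (omul _ _)) -[RHS]/(omul (oscale _ _) _).
by rewrite omulE !oscaleE omulE; apply/oclsP; exact: qeq_scaleAl.
Qed.

HB.instance Definition _ := GRing.Lmodule_isLalgebra.Build R[i] OQu oscaleAl.

Fact oscaleAr (k : R[i]) (a b : OQu) : k *: (a * b) = a * (k *: b).
Proof.
elim/ocls_ind: a => a; elim/ocls_ind: b => b.
rewrite -[LHS]/(oscale k (omul _ _)) -[RHS]/(omul _ (oscale _ _)).
by rewrite omulE !oscaleE omulE; apply/oclsP; exact: qeq_scaleAr.
Qed.

HB.instance Definition _ := GRing.Lalgebra_isAlgebra.Build R[i] OQu oscaleAr.

Fact ostarK a : ostar (ostar a) = a.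
Proof.
by elim/ocls_ind: a => a; rewrite !ostarE; apply/oclsP; exact: qeq_starK.
Qed.

Fact ostarD (a b : OQu) : ostar (a + b) = ostar a + ostar b.
Proof.
elim/ocls_ind: a => a; elim/ocls_ind: b => b.
rewrite -[_ + _]/(oadd _ _) -[RHS]/(oadd _ _) oaddE !ostarE oaddE.
by apply/oclsP; exact: qeq_starD.
Qed.

Fact ostarZ (k : R[i]) (a : OQu) : ostar (k *: a) = k^* *: ostar a.
Proof.
elim/ocls_ind: a => a.
rewrite -[k *: _]/(oscale _ _) -[RHS]/(oscale _ _) oscaleE !ostarE oscaleE.
by apply/oclsP; exact: qeq_starZ.
Qed.

Fact ostarM (a b : OQu) : ostar (a * b) = ostar b * ostar a.
Proof.
elim/ocls_ind: a => a; elim/ocls_ind: b => b.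
rewrite -[_ * _]/(omul _ _) -[RHS]/(omul _ _) omulE !ostarE omulE.
by apply/oclsP; exact: qeq_starM.
Qed.

HB.instance Definition _ := @isStarAlgebra.Build R OQu
  ostar ostarK ostarD ostarZ ostarM.

Definition qgen (x y : G) : OQu := ocls (QGen x y).

Lemma ocls_eval t : ocls t = qeval qgen t.
Proof.
elim: t => //= [a <- b <-|a <- b <-|k a <-|a <-].
- by rewrite -[RHS]/(oadd _ _) oaddE.
- by rewrite -[RHS]/(omul _ _) omulE.
- by rewrite -[RHS]/(oscale _ _) oscaleE.
- by rewrite -[RHS]/(ostar _) ostarE.
Qed.

Lemma qgen_relations : qu_relations qgen.
Proof.
have E a b : qeq a b -> qeval qgen a = qeval qgen b.
  by move=> ab; rewrite -!ocls_eval; apply/oclsP.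
split.
- by move=> x y; split; [exact: (E _ _ (qeq_gen_star _ x y))
                        |exact: (E _ _ (qeq_gen_idem _ x y))].
- by move=> x; split; [have := E _ _ (qeq_gen_row _ x)
                      |have := E _ _ (qeq_gen_col _ x)]; rewrite qeval_big.
- by move=> x y z yz; split; [exact: (E _ _ (qeq_gen_orow _ x yz))
                             |exact: (E _ _ (qeq_gen_ocol _ x yz))].
- move=> x y; have := E _ _ (qeq_gen_adj _ x y); rewrite !qeval_big /= => H.
  rewrite -(eq_bigr _ (fun z _ => adj_scaler _ _ _)) H.
  by apply: eq_bigr => z _; rewrite adj_scalel.
Qed.

Lemma OQu_universal (B : starAlgType R) (v : G -> G -> B) : qu_relations v ->
  exists f : {lrmorphism OQu -> B},
    [/\ star_preserving f, forall x y, f (qgen x y) = v x y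
      & forall g : {lrmorphism OQu -> B}, star_preserving g ->
          (forall x y, g (qgen x y) = v x y) -> g =1 f].
Proof.
move=> vR; pose f (a : OQu) := qeval v (repr a).
have fE t : f (ocls t) = qeval v t by apply: qeval_qeq vR _ _ (repr_ocls t).
have fB : zmod_morphism f.
  elim/ocls_ind=> a; elim/ocls_ind=> b.
  have -> : ocls a - ocls b = ocls (QAdd a (QScale (-1) b)).
    by rewrite !ocls_eval /= scaleN1r.
  by rewrite !fE /= scaleN1r.
have fM : monoid_morphism f.
  split; first by rewrite -[1]/(ocls QOne) fE.
  elim/ocls_ind=> a; elim/ocls_ind=> b.
  by rewrite -[_ * _]/(omul _ _) omulE !fE.
have fZ : scalable f.
  by move=> k; elim/ocls_ind=> a; rewrite -[k *: _]/(oscale _ _) oscaleE !fE.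
pose fA := GRing.isZmodMorphism.Build _ _ f fB.
pose fMm := GRing.isMonoidMorphism.Build _ _ f fM.
pose fZm := GRing.isScalable.Build _ _ _ _ f fZ.
pose F : {lrmorphism OQu -> B} :=
  HB.pack f fA fMm fZm.
exists F; split.
- by elim/ocls_ind=> a; rewrite -[_^s]/(ostar _) ostarE /= !fE.
- by move=> x y; rewrite /= fE.
- move=> g gs gv; elim/ocls_ind=> t /=; rewrite fE ocls_eval.
  elim: t => //= [||a <- b <-|a <- b <-|k a <-|a <-].
  + exact: rmorph0.
  + exact: rmorph1.
  + exact: rmorphD.
  + exact: rmorphM.
  + exact: linearZ.
  + exact: gs.
Qed.

End OQu.

Definition quantum_asymmetric (R : realType) (G : sgraph) : Prop :=
  bijective (fun c : R[i] => c%:A : OQu R G).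

Definition is_enveloping_cstar (R : realType) (O : starAlgType R)
    (A : cstarAlgType R) (iota : {lrmorphism O -> A}) : Prop :=
  star_preserving iota /\
  forall (B : cstarAlgType R) (f : {lrmorphism O -> B}), star_preserving f ->
    exists g : {lrmorphism A -> B},
      [/\ star_preserving g, forall a, g (iota a) = f a
        & forall h : {lrmorphism A -> B}, star_preserving h ->
            (forall a, h (iota a) = f a) -> h =1 g].

(* C(Qu(G)), which the universal property determines up to isomorphism, is not
   commutative. *)
Definition has_quantum_symmetry (R : realType) (G : sgraph) : Prop :=
  exists (A : cstarAlgType R) (iota : {lrmorphism OQu R G -> A}),
    is_enveloping_cstar iota /\ ~ commutative (@GRing.mul A).

(* Main.v *)
From HB Require Import structures.
From mathcomp Require Import all_boot all_order all_algebra all_fingroup.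
From mathcomp Require Import generic_quotient complex.
From mathcomp Require Import boolp reals.
From mathcomp Require classical_sets.
From mathcomp Require Import ring lra.
Require Import Defs.

(* A quantum isomorphism preserves adjacency, hence every vertex colour obtained
   by counting coloured (non-)neighbours, and every equivalence relation generated
   by a relation that is definable from adjacency and colours.  Accordingly, call a
   coloured vertex set splittable if it can be taken apart down to single vertices
   by two operations: refining the colours by such a count, and passing to the
   connected components that remain after complementing adjacency between some
   pairs of colour classes.  Cographs are split by component and co-component.  A
   tree is split by pruning its leaves until one vertex or one edge is left, cutting
   there, and then repeatedly cutting at the roots of the remaining rooted trees.
   Each tree-cograph is assembled from both.

   On a splittable set a magic unitary u decomposes into blocks, each of which is
   magic relative to an entry of a smaller magic matrix q indexed by the components.
   This gives, by induction: if u is nonzero the two coloured graphs are isomorphic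
   (count the components of each isomorphism type); if there are no automorphisms
   then u is the identity; and if no two nontrivial automorphisms are disjoint then
   the entries of u commute.  All of this is algebraic.

   C*-algebras enter in two ways.  Projections summing to 1 are orthogonal, because
   the unit is an extreme point of the unit ball; and C(Qu(G)) exists as the
   completion of O(Qu(G)) in the supremum of the norms of its representations, its
   universal property resting on the contractivity of *-morphisms.  Two disjoint
   automorphisms, moved by two noncommuting projections of the 2 x 2 matrices, make
   it noncommutative. *)

Set Implicit Arguments.
Unset Strict Implicit.
Unset Printing Implicit Defensive.

Import Order.TTheory GRing.Theory Num.Theory.

(** * Colour refinement and components *)

(** The induction runs over coloured vertex sets of one fixed graph, because a piece cut off on the
    way remembers the rest of the graph only through its colours. Trees are the obstacle:
    decomposition into components and co-components gets stuck on them, and only colours open them,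
    at places which every magic unitary has to respect. Between two blocks adjacency is a function
    of the colours, so isomorphisms of blocks can be glued freely. In particular isomorphic blocks
    can be swapped and an automorphism of a block extends by the identity; these are the
    automorphisms that contradict asymmetry or the failure of Schmidt's criterion. Commutation has
    two cases. If two blocks are isomorphic, then every block is rigid and each entry of [u] is 0 or
    an entry of [q]; the entries of [q] commute by an argument known for three points. If no two
    blocks are isomorphic, then [q] vanishes off the diagonal and at most one block has nontrivial
    automorphisms. *)

Section ColoredGraph.
Variable G : sgraph.
Implicit Types (T C D : {set G}) (chi : G -> seq bool).

(** With [b = false] and [z != x] this counts proper non-neighbours, so that refinement is available
    for a graph and for its complement alike. *)
Definition nb_count T chi (b : bool) (psi : pred (seq bool)) (x : G) : nat :=
  #|[set z in T | [&& z != x, adj x z == b & psi (chi z)]]|.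

Definition refine_color T chi b psi m (x : G) : seq bool :=
  (m <= nb_count T chi b psi x) :: chi x.

(** [F] tells between which colour classes adjacency is complemented. It may be asymmetric: the
    disjunction symmetrises the relation, and a pair of distinct vertices outside it has adjacency
    given by [F] in either order. *)
Definition flip_adj chi (F : rel (seq bool)) : rel G := fun x y =>
  (x != y) && ((adj x y != F (chi x) (chi y)) || (adj x y != F (chi y) (chi x))).

Definition flip_in T chi F : rel G :=
  fun x y => [&& x \in T, y \in T & flip_adj chi F x y].

Definition block T chi F (x : G) : {set G} :=
  [set y | connect (flip_in T chi F) x y].

Inductive splittable : {set G} -> (G -> seq bool) -> Prop :=
| splittable_small T chi : #|T| <= 1 -> splittable T chi
| splittable_refine T chi b psi m :
    splittable T (refine_color T chi b psi m) -> splittable T chi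
| splittable_blocks T chi F :
    (forall x, x \in T -> splittable (block T chi F x) chi) ->
    splittable T chi.

Lemma flip_adj_sym chi F : symmetric (flip_adj chi F).
Proof.
by move=> x y; rewrite /flip_adj eq_sym adj_sym orbC.
Qed.

Lemma flip_in_sym T chi F : symmetric (flip_in T chi F).
Proof. by move=> x y; rewrite /flip_in flip_adj_sym andbCA. Qed.

Lemma flip_connect_sym T chi F : connect_sym (flip_in T chi F).
Proof. exact/sym_connect_sym/flip_in_sym. Qed.

Lemma block_sub T chi F x : x \in T -> block T chi F x \subset T.
Proof.
move=> xT; apply/subsetP => y; rewrite inE => /connectP[p pP ->].
elim: p x xT pP => //= z p IH x xT /andP[/and3P[_ zT _]]; exact: IH.
Qed.

Lemma block_refl T chi F x : x \in block T chi F x.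
Proof. by rewrite inE connect0. Qed.

Lemma block_eq T chi F x y : y \in block T chi F x ->
  block T chi F y = block T chi F x.
Proof.
rewrite inE => xy; apply/setP => z; rewrite !inE.
by rewrite -(same_connect (@flip_connect_sym _ _ _) xy).
Qed.

Lemma flip_adjN chi F x y : x != y -> ~~ flip_adj chi F x y ->
  adj x y = F (chi x) (chi y).
Proof. by rewrite /flip_adj => -> /=; rewrite negb_or !negbK => /andP[/eqP]. Qed.

(** The reason why isomorphisms of blocks can be glued: as soon as two vertices lie in different
    blocks, their colours decide whether they are adjacent. *)
Lemma cross_adj T chi F x y : x \in T -> y \in T ->
  y \notin block T chi F x -> adj x y = F (chi x) (chi y).
Proof.
move=> xT yT; rewrite inE => nxy; apply: (@flip_adjN chi F).
  by apply: contraNneq nxy => ->.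
by apply: contra nxy => E; rewrite connect1 // /flip_in xT yT.
Qed.

End ColoredGraph.

(** * A hereditary property of tree-cographs *)

Section Hereditary.
Variable V : finType.
Implicit Types (e : rel V) (T : {set V}).

Definition acyclic_in e T : Prop :=
  forall c : seq V, 2 < size c -> {subset c <= T} -> ~~ ucycleb e c.

Definition disconnected_in e T : Prop :=
  exists A : {set V}, [/\ A \subset T, A != set0, T :\: A != set0 &
    forall x y, x \in A -> y \in T :\: A -> ~~ e x y].

Definition tame e T := acyclic_in e T \/ disconnected_in e T.
End Hereditary.

(** Because of the quantifier over [T], the alternative is inherited by every piece cut off later,
    and it is symmetric under complement. *)
Definition tame_graph (G : sgraph) : Prop := forall T : {set G},
  tame (@adj G) T \/ tame (@compl_adj G) T.

Lemma tame_imset (V W : finType) (e : rel V) (e' : rel W) (f : V -> W)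
    (T : {set V}) :
  injective f -> {mono f : x y / e x y >-> e' x y} -> tame e T ->
  tame e' (f @: T).
Proof.
move=> fI fE [acT|[A [AT A0 TA0 AE]]]; [left|right].
  move=> c c2 cT; pose g (y : W) := odflt y None.
  have [d dc] : exists d : seq V, c = [seq f x | x <- d].
    elim: c cT {c2} => [|y c IH] cT; first by exists [::].
    have /imsetP[x xT ->] := cT y (mem_head _ _).
    have [z zc|d ->] := IH; first by apply: cT; rewrite inE zc orbT.
    by exists (x :: d).
  rewrite dc in c2 cT *; rewrite size_map in c2.
  have dT : {subset d <= T}.
    by move=> x xd; rewrite -(mem_imset _ _ fI); apply: cT; apply: map_f.
  apply: contra (acT d c2 dT); rewrite /ucycleb map_inj_uniq // => /andP[+ ->].
  rewrite andbT; case: d {dc c2 cT dT} => //= x p.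
  by rewrite -map_rcons path_map /= (eq_path (e' := e)) // => a b /=; rewrite fE.
exists (f @: A); split.
- exact: imsetS.
- by apply: contraNneq A0 => /eqP; rewrite imset_eq0.
- case/set0Pn: TA0 => x; rewrite inE => /andP[xA xT]; apply/set0Pn.
  by exists (f x); rewrite inE !mem_imset // xA.
- move=> _ y /imsetP[x xA ->]; rewrite inE => /andP[+ /imsetP[z zT yz]].
  by rewrite yz mem_imset // fE => zA; apply: AE => //; rewrite inE zA.
Qed.

(** A vertex set of a disjoint union either meets two summands, hence is disconnected, or lies in a
    single summand, whose induction hypothesis is transported along the inclusion. Complement
    exchanges the two alternatives. *)
Lemma tame_tree_cograph G : tree_cograph G -> tame_graph G.
Proof.
elim=> {G} [G [_ acG]|I I0 F _ IH|G _ IH|G H [f [fB fE]] _ IH] T.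
- by left; left => c c2 _; apply: acG.
- have [->|/set0Pn[[i x] xT]] := eqVneq T set0.
    left; left => -[|y c] // _ /(_ y (mem_head _ _)); by rewrite inE.
  (* The part of [T] in the summand of one of its vertices; [T] is disconnected unless this is all
     of [T]. *)
  pose A := [set y in T | tag y == i].
  have [TA|TA0] := eqVneq (T :\: A) set0; last first.
    left; right; exists A; split => //.
    + by apply/subsetP => y; rewrite inE => /andP[].
    + by apply/set0Pn; exists (Tagged F x); rewrite inE xT eqxx.
    + move=> y z; rewrite !inE => /andP[yT /eqP yi] /andP[+ zT].
      rewrite zT /= /dunion_adj; apply: contra => /andP[/eqP <- _].
      exact/eqP.
  pose g (y : F i) : disjoint_union I0 F := Tagged F y.
  have gI : injective g.
    by move=> a b /eqP; rewrite eq_Tagged /= => /eqP.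
  have gE : {mono g : a b / adj a b}.
    by move=> a b /=; rewrite /dunion_adj /= eqxx tagged_asE.
  have gE' : {mono g : a b / compl_adj a b}.
    by move=> a b; rewrite /compl_adj (inj_eq gI) gE.
  have -> : T = g @: [set y | g y \in T].
    apply/setP => -[j y]; apply/idP/imsetP => [yT|[z]]; last by rewrite inE => zT ->.
    have /eqP ji : j == i.
      have: Tagged F y \notin T :\: A by rewrite TA inE.
      by rewrite !inE yT /= andbT negbK.
    by move: y yT; rewrite ji => y yT; exists y; rewrite ?inE.
  by case: (IH i [set y | g y \in T]) => ?; [left|right]; apply: tame_imset.
- case: (IH T) => H; [right|left] => //.
  have E : @compl_adj (complement G) =2 @adj G.
    move=> x y; rewrite /compl_adj /= /compl_adj.
    by have [->|] := eqVneq x y; rewrite ?adj_irrefl // negbK.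
  case: H => [ac|[A [AT A0 TA0 AE]]]; [left|right].
    move=> c c2 cT; apply: contra (ac c c2 cT); rewrite /ucycleb.
    by rewrite (eq_cycle E).
  by exists A; split => // x y xA yA; rewrite E; apply: AE.
- have [g fK gK] := fB.
  have fI : injective f by apply: can_inj fK.
  have fE' : {mono f : a b / compl_adj a b}.
    by move=> a b; rewrite /compl_adj (inj_eq fI) fE.
  have -> : T = f @: (g @: T).
    apply/setP => y; apply/idP/imsetP => [yT|[x /imsetP[z zT ->] ->]].
      by exists (g y); rewrite ?gK ?imset_f.
    by rewrite gK.
  by case: (IH (g @: T)) => ?; [left|right]; apply: tame_imset.
Qed.

(** * Trees *)

Section Induced.
Variable V : finType.
Implicit Types (e : rel V) (K D T : {set V}).

Definition induced e K : rel V := fun x y => [&& x \in K, y \in K & e x y].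

Definition connected_in e K := {in K &, forall x y, connect (induced e K) x y}.

Lemma connect_induced e e' K x y :
  (forall a b, a \in K -> e a b -> (b \in K) && e' a b) -> x \in K ->
  connect e x y -> connect (induced e' K) x y.
Proof.
move=> H xK /connectP[p pP ->] {y}.
elim: p x xK pP => //= z p IH x xK /andP[/(H _ _ xK)/andP[zK xz] pP].
by apply: connect_trans (IH _ zK pP); rewrite connect1 // /induced xK zK.
Qed.

Lemma uniq_path_induced e K x y : x \in K -> connect (induced e K) x y ->
  exists p, [/\ path e x p, last x p = y, uniq (x :: p)
              & {subset x :: p <= K}].
Proof.
move=> xK /connectP[p pP ->]; case/shortenP: pP => q qP qU _.
exists q; split=> //.
  by apply: sub_path qP => a b /and3P[].
elim: q x xK qP {qU} => [|z q IH] x xK /=.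
  by move=> _ y'; rewrite inE => /eqP->.
case/andP=> /and3P[_ zK _] /(IH _ zK) H w; rewrite inE => /orP[/eqP->//|].
exact: H.
Qed.

(** The path is cut at its first entry into [D], so that the part before the edge from [a] to [d]
    survives when the adjacency inside or at [D] is modified. *)
Lemma first_hit e D x y : connect e x y -> x \notin D -> y \in D ->
  exists a d, [/\ a \notin D, d \in D, e a d
    & connect (fun u v => [&& e u v, u \notin D & v \notin D]) x a].
Proof.
case/connectP=> p pP ->; elim: p x pP => [|z p IH] x /=.
  by move=> _ /negPf->.
case/andP=> xz pP xD yD; have [zD|zD] := boolP (z \in D).
  by exists x, z; split.
have [a [d [aD dD ad za]]] := IH z pP zD yD.
exists a, d; split=> //; apply: connect_trans za.
by rewrite connect1 // xz xD.
Qed.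

Lemma acyclic_path e K x p : acyclic_in e K -> path e x p -> uniq (x :: p) ->
  {subset x :: p <= K} -> 1 < size p -> ~~ e (last x p) x.
Proof.
move=> acK pP pU pK p2; have /= := acK (x :: p) p2 pK.
by rewrite /ucycleb pU andbT /= rcons_path pP.
Qed.

Lemma acyclic_sub e K K' : K' \subset K -> acyclic_in e K -> acyclic_in e K'.
Proof. by move=> /subsetP S ac c c2 cK; apply: ac => // x /cK /S. Qed.

End Induced.

Section Pruning.
Variable G : sgraph.
Implicit Types (D T K : {set G}).

Definition deg_in D x := #|[set z in D | adj x z]|.

Lemma deg_interior D x p1 z q : path (@adj G) x (p1 ++ z :: q) ->
  uniq (x :: p1 ++ z :: q) -> {subset x :: p1 ++ z :: q <= D} -> q != [::] ->
  1 < deg_in D z.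
Proof.
case: q => // w q pP pU pD _; apply/card_gt1P; exists (last x p1), w.
rewrite cat_path /= in pP; case/and4P: pP => _ lz zw _.
rewrite !inE zw adj_sym lz !andbT; split.
- by apply: pD; rewrite -cat_cons mem_cat mem_last.
- by apply: pD; rewrite inE mem_cat !inE eqxx !orbT.
- move: pU; rewrite -cat_cons cat_uniq => /and3P[_ /hasPn/= H _].
  have := H w; rewrite !inE eqxx orbT => /(_ isT).
  by apply: contraNneq => <-; rewrite -in_cons mem_last.
Qed.

(** Among three vertices, either some path without repetition between two of them has an interior
    vertex, or one of them is adjacent to the two others. *)
Lemma deg_ge2_card D : connected_in (@adj G) D -> 2 < #|D| ->
  exists2 x, x \in D & 1 < deg_in D x.
Proof.
move=> cD /card_gt2P[a [b [c [[aD bD cD'] [ab bc ca]]]]].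
have H x y : x \in D -> y \in D -> x != y ->
    adj x y \/ exists2 x, x \in D & 1 < deg_in D x.
  move=> xD yD xy; have [p [pP pl pU pD]] := uniq_path_induced xD (cD _ _ xD yD).
  case: p pP pl pU pD => [|z q] pP pl pU pD.
    by rewrite /= in pl; rewrite pl eqxx in xy.
  have [q0|q0] := eqVneq q [::].
    by left; move: pP pl; rewrite q0 /= andbT => + <-.
  right; exists z; first by apply: pD; rewrite !inE eqxx orbT.
  exact: (@deg_interior D x [::] z q).
have [E1|//] := H a b aD bD ab.
have [E2|//] := H c a cD' aD ca.
exists a => //; apply/card_gt1P; exists b, c.
by rewrite !inE bD cD' E1 adj_sym E2 bc.
Qed.

Definition prune D := [set x in D | 1 < deg_in D x].

(** A path without repetition between two surviving vertices survives whole, since its interior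
    vertices have a predecessor and a successor as neighbours. *)
Lemma prune_connected D : connected_in (@adj G) D ->
  connected_in (@adj G) (prune D).
Proof.
move=> cD x y; rewrite !inE => /andP[xD dx] /andP[yD dy].
have [p [pP pl pU pD]] := uniq_path_induced xD (cD _ _ xD yD).
have pD' : {subset x :: p <= prune D}.
  move=> z zp; rewrite inE (pD _ zp) /=.
  move: zp; rewrite inE => /orP[/eqP->//|zp].
  case/splitPr: zp pP pl pU pD => p1 q pP pl pU pD.
  have [q0|q0] := eqVneq q [::]; last exact: (deg_interior pP pU).
  by move: pl; rewrite q0 last_cat /= => ->.
apply/connectP; exists p => //.
elim: p x {xD dx pl pU pD} pP pD' => //= z p IH x /andP[xz pP] pD'.
rewrite /induced xz !pD' ?inE ?eqxx ?orbT //=; apply: IH => // w wp.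
by apply: pD'; rewrite inE wp orbT.
Qed.

(** If every vertex had two neighbours in [D], a path without repetition could be prolonged for
    ever. The path is written with its newest end [x] in front. *)
Lemma prune_proper D : acyclic_in (@adj G) D -> D != set0 -> prune D \proper D.
Proof.
move=> acD D0; rewrite properE; apply/andP; split.
  by apply/subsetP => x; rewrite inE => /andP[].
apply/negP => /subsetP sD.
suff H n : exists x p, [/\ path (@adj G) x p, uniq (x :: p),
    {subset x :: p <= D} & size p = n].
  have [x [p [_ pU pD sp]]] := H #|D|.
  have := card_uniqP pU; rewrite /= sp => E.
  have: #|x :: p| <= #|D| by apply: subset_leq_card; apply/subsetP.
  by rewrite E ltnn.
elim: n => [|n [x [p [pP pU pD pn]]]].
  case/set0Pn: D0 => x xD; exists x, [::]; split=> // y.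
  by rewrite inE => /eqP->.
have xD : x \in D by apply: pD; rewrite inE eqxx.
have := sD x xD; rewrite inE xD => /card_gt1P[a [b [+ + ab]]].
rewrite !inE => /andP[aD xa] /andP[bD xb].
(* Of the two neighbours of [x], one is not the vertex from which the path came. *)
have [z [zD xz zp]] : exists z, [/\ z \in D, adj x z & forall w q, p = w :: q -> z != w].
  have [az|az] := boolP (a == head x p).
    exists b; split=> // w q pw; rewrite pw /= in az.
    by rewrite -(eqP az) eq_sym.
  by exists a; split=> // w q pw; rewrite pw /= in az.
have zx : z != x by apply: contraTneq xz => ->; rewrite adj_irrefl.
have [zinp|znp] := boolP (z \in p); last first.
  exists z, (x :: p); split=> //=; rewrite ?pn //.
  - by rewrite adj_sym xz.
  - by rewrite inE negb_or zx znp.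
  - by move=> w; rewrite inE => /orP[/eqP->//|]; apply: pD.
case/splitPr: zinp pP pU pD {pn} zp => p1 p2 pP pU pD zp.
have sub : {subset x :: rcons p1 z <= x :: p1 ++ z :: p2}.
  move=> w; rewrite !inE mem_rcons mem_cat !inE.
  by case/or3P => ->; rewrite ?orbT.
have pP1 : path (@adj G) x (rcons p1 z).
  by move: pP; rewrite -cat_rcons cat_path => /andP[].
have pU1 : uniq (x :: rcons p1 z).
  by move: pU; rewrite -cat_rcons -cat_cons cat_uniq => /andP[].
have pD1 : {subset x :: rcons p1 z <= D} by move=> w /sub /pD.
(* Since [z] is not the first vertex of [p], going back to it closes a cycle of at least three
   vertices. *)
have p1s : 1 < size (rcons p1 z).
  by case: p1 zp {pP pU pD sub pP1 pU1 pD1} => [/(_ _ _ erefl)|w p1 _];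
    rewrite ?eqxx // size_rcons.
by have := acyclic_path acD pP1 pU1 pD1 p1s; rewrite last_rcons adj_sym xz.
Qed.

End Pruning.

(** * Splittability of forests and of tame sets *)

Section Splittable.
Variable G : sgraph.
Implicit Types (D T K : {set G}) (chi : G -> seq bool).

Lemma block_connected T chi F (e : rel G) x : x \in T ->
  {in T &, forall a b, flip_adj chi F a b -> e a b} ->
  connected_in e (block T chi F x).
Proof.
move=> xT fe a b aK bK.
have aT := subsetP (block_sub chi F xT) _ aK.
apply: (@connect_induced _ (flip_in T chi F)) => //; last first.
  by move: bK; rewrite -(block_eq aK) inE.
move=> c d cK cd; case/and3P: (cd) => cT dT fcd.
by rewrite fe // andbT -(block_eq cK) inE connect1.
Qed.

(** Once the colours single out the root, one refinement marks its neighbours, and complementing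
    between root and marked vertices deletes exactly the edges at the root. Each remaining component
    contains exactly one marked vertex, which becomes its root, recognised by the newest colour
    bit. *)
Lemma rooted_tree_splittable n T chi delta r : #|T| <= n ->
  acyclic_in (@adj G) T -> connected_in (@adj G) T -> r \in T ->
  {in T, forall x, delta (chi x) = (x == r)} -> splittable T chi.
Proof.
elim: n T chi delta r => [|n IH] T chi delta r Tn acT cT rT dT.
  by apply: splittable_small; rewrite (leq_trans Tn).
apply: (@splittable_refine _ _ _ true delta 1).
set chi' := refine_color _ _ _ _ _.
have chi'E x : x \in T -> chi' x = adj x r :: chi x.
  move=> xT; rewrite /chi' /refine_color /nb_count; congr (_ :: _).
  apply/card_gt0P/idP => [[z]|xr].
    by rewrite !inE => /and4P[zT zx /eqP xz]; rewrite dT // => /eqP <-.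
  by exists r; rewrite !inE rT dT // eqxx xr !andbT; apply: contraTneq xr => ->; rewrite adj_irrefl.
(* The bit in front says whether a vertex is adjacent to the root, so [F] reproduces the adjacency
   at the root and flipping by it leaves the root isolated. *)
pose F k k' := (delta (behead k) && head false k') || (delta (behead k') && head false k).
apply: (@splittable_blocks _ _ _ F) => x xT.
have flE : {in T &, forall a b, flip_adj chi' F a b -> [&& a != r, b != r & adj a b]}.
  move=> a b aT bT; rewrite /flip_adj /F !chi'E //= !dT //.
  have [->|ar] := eqVneq a r; have [->|br] := eqVneq b r => //=;
    rewrite ?adj_irrefl ?(adj_sym r) ?eqxx ?andbF ?orbF ?eqxx ?andbF //=.
  by case: adj; rewrite ?andbT ?andbF.
set K := block _ _ _ _; have KT : K \subset T by apply: block_sub.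
have [xr|xr] := eqVneq x r.
  apply: splittable_small; rewrite (@eq_card1 _ x) // => y; rewrite !inE.
  apply/connectP/eqP => [[[|z p] //= /andP[/and3P[_ zT /flE]]]|->].
    by rewrite xr eqxx /= => /(_ rT zT).
  by exists [::].
have Kr : r \notin K.
  rewrite /K inE flip_connect_sym; apply/negP => /connectP[[|z p] /=].
    by move=> _ rx; rewrite rx eqxx in xr.
  by case/andP=> /and3P[_ zT /(flE _ _ rT zT)]; rewrite eqxx.
have xr1 : x \notin [set r] by rewrite inE.
(* The last vertex [a] before the root on a path from [x] is a neighbour of the root inside the
   block. *)
have [a [d [+ + ad xa]]] := first_hit (cT _ _ xT rT) xr1 (set11 r).
rewrite !inE => ar /eqP dr; rewrite {d}dr in ad.
case/and3P: ad => aT _ ad.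
have aK : a \in K.
  rewrite inE; apply: connect_sub xa => u v /and3P[/and3P[uT vT uv]].
  rewrite !inE => ur vr; rewrite connect1 // /flip_in uT vT /flip_adj /F !chi'E //=.
  rewrite !dT // (negPf ur) (negPf vr) /= uv orbT andbT.
  by apply: contraTneq uv => ->; rewrite adj_irrefl.
have acK := acyclic_sub KT acT.
have cK : connected_in (@adj G) K.
  by apply: block_connected => // u v uT vT /(flE _ _ uT vT)/and3P[].
apply: (IH _ _ (head false) a) => //.
  have: K \proper T by rewrite properE KT; apply/subsetPn; exists r.
  by move/proper_card => KTc; rewrite -ltnS (leq_trans KTc).
move=> b bK; have bT := subsetP KT _ bK; rewrite chi'E //=.
(* Two neighbours [a] and [b] of the root in one block would be joined inside it by a path, which
   closes up through [r] to a cycle. *)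
apply/idP/eqP => [br|-> //]; apply/eqP; apply: contraT => ba.
have [p [pP pl pU pK]] := uniq_path_induced aK (cK _ _ aK bK).
have rU : uniq (r :: a :: p).
  by rewrite cons_uniq pU andbT; apply: contra Kr => /pK.
have rT' : {subset r :: a :: p <= T}.
  by move=> w; rewrite inE => /orP[/eqP->//|/pK]; apply: (subsetP KT).
have rP : path (@adj G) r (a :: p) by rewrite /= adj_sym ad.
have p2 : 1 < size (a :: p).
  by case: p pl {pP pU pK rU rT' rP} => //= ab; rewrite ab eqxx in ba.
by have := acyclic_path acT rP rU rT' p2; rewrite /= pl br.
Qed.

(** [T] stays fixed while the core [D], visible only through [delta] and the colours, shrinks by
    pruning. Counting at least two neighbours in [D] is what lets the refined colours recognise the
    pruned core. A core of more than two vertices has a vertex of degree two, so the core never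
    becomes empty. *)
Lemma tree_splittable n T D chi delta : #|D| <= n ->
  acyclic_in (@adj G) T -> connected_in (@adj G) T -> D \subset T -> D != set0 ->
  connected_in (@adj G) D -> {in T, forall x, delta (chi x) = (x \in D)} ->
  splittable T chi.
Proof.
elim: n D chi delta => [|n IH] D chi delta Dn acT cT DT D0 cD dT.
  by rewrite leqn0 cards_eq0 in Dn; rewrite Dn in D0.
have [D2|D2] := ltnP 2 #|D|.
  apply: (@splittable_refine _ _ _ true delta 2).
  apply: (IH (prune D) _ (fun k => head false k && delta (behead k))) => //.
  - have := proper_card (prune_proper (acyclic_sub DT acT) D0).
    by move=> H; rewrite -ltnS (leq_trans H).
  - by apply: subset_trans DT; apply/subsetP => x; rewrite inE => /andP[].
  - have [x xD dx] := deg_ge2_card cD D2.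
    by apply/set0Pn; exists x; rewrite inE xD.
  - exact: prune_connected.
  - move=> x xT; rewrite /refine_color /= dT // inE andbC; case: (x \in D) => //=.
    rewrite /nb_count /deg_in; congr (_ < #|pred_of_set _|); apply/setP => z; rewrite !inE.
    have [zD|zD] := boolP (z \in D); last first.
      by apply/negbTE; apply: contra zD => /and4P[zT _ _]; rewrite dT.
    have zT := subsetP DT _ zD; rewrite zT dT // zD andbT /=.
    by have [->|_] := eqVneq z x; rewrite ?adj_irrefl //; case: adj.
have clD : {in D &, forall x y, x != y -> adj x y}.
  move=> x y xD yD xy.
  have [[|z p] [pP pl pU pD]] := uniq_path_induced xD (cD _ _ xD yD).
    by move: xy; rewrite -pl eqxx.
  have zD : z \in D by apply: pD; rewrite !inE eqxx orbT.
  move: pP pU => /= /andP[xz _] /andP[+ _]; rewrite inE negb_or => /andP[nxz _].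
  suff <- : z = y by [].
  apply/eqP; apply: contraTT D2 => zy; rewrite -ltnNge; apply/card_gt2P.
  by exists x, z, y; split; split=> //; rewrite eq_sym.
(* The core is now one vertex or one edge; flipping inside it deletes that edge, if there is one,
   and leaves one core vertex, the new root, in each component. *)
pose F k k' := delta k && delta k'.
apply: (@splittable_blocks _ _ _ F) => x xT.
have flE : {in T &, forall a b, flip_adj chi F a b =
    adj a b && ~~ ((a \in D) && (b \in D))}.
  move=> a b aT bT; rewrite /flip_adj /F !dT //.
  have [->|nab] := eqVneq a b; first by rewrite adj_irrefl.
  have [aD|aD] := boolP (a \in D); have [bD|bD] := boolP (b \in D) => /=;
    rewrite ?(clD _ _ aD bD) //; by case: adj.
set K := block _ _ _ _; have KT : K \subset T by apply: block_sub.
have acK := acyclic_sub KT acT.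
have cK : connected_in (@adj G) K.
  by apply: block_connected => // u v uT vT; rewrite flE // => /andP[].
have [a aK aD] : exists2 a, a \in K & a \in D.
  have [xD|xD] := boolP (x \in D); first by exists x; rewrite ?block_refl.
  have [y yD] := set0Pn _ D0; have yT := subsetP DT _ yD.
  have [a [d [aD dD ad xa]]] := first_hit (cT _ _ xT yT) xD yD.
  exists d => //; rewrite inE; case/and3P: ad => aT dT' ad.
  apply: connect_trans (_ : connect _ a d).
    apply: connect_sub xa => u v /and3P[/and3P[uT vT uv] uD vD].
    by rewrite connect1 // /flip_in uT vT flE // uv (negPf uD).
  by rewrite connect1 // /flip_in aT dT' flE // ad (negPf aD).
apply: (@rooted_tree_splittable #|K| _ _ delta a) => //.
move=> b bK; have bT := subsetP KT _ bK; rewrite dT //.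
apply/idP/eqP => [bD|-> //]; apply/eqP; apply: contraT => ba.
have [p [pP pl pU pK]] : exists p, [/\ path (flip_in T chi F) a p, last a p = b,
    uniq (a :: p) & {subset a :: p <= K}].
  have : connect (induced (flip_in T chi F) K) a b.
    apply: (@connect_induced _ (flip_in T chi F)) => //.
      by move=> u v uK uv; rewrite uv andbT /K -(block_eq uK) inE connect1.
    by move: bK; rewrite /K -(block_eq aK) inE.
  exact: uniq_path_induced.
have pP' : path (@adj G) a p.
  by apply: sub_path pP => u v /and3P[uT vT]; rewrite flE // => /andP[].
(* A single step from [a] to [b] would use the deleted core edge. The path is therefore longer, and
   the core edge closes it to a cycle. *)
have p2 : 1 < size p.
  case: p pl pP {pU pK pP'} => [|z [|w p]] //=.
    by move=> ab; rewrite ab eqxx in ba.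
  by move=> -> /andP[/and3P[_ _ ]]; rewrite flE ?aD ?bD ?andbF // (subsetP KT).
by have := acyclic_path acK pP' pU pK p2; rewrite pl clD.
Qed.

Lemma acyclic_splittable T chi : acyclic_in (@adj G) T -> splittable T chi.
Proof.
move=> acT; apply: (@splittable_blocks _ _ _ (fun _ _ => false)) => x xT.
set K := block _ _ _ _; have KT : K \subset T by apply: block_sub.
have cK : connected_in (@adj G) K.
  apply: block_connected => // u v uT vT; rewrite /flip_adj => /andP[_].
  by case: adj.
apply: (@tree_splittable #|T| K K _ xpredT) => //.
- exact: subset_leq_card.
- exact: acyclic_sub KT acT.
- by apply/set0Pn; exists x; apply: block_refl.
Qed.

(** A block cannot leave the side of the separation on which it starts, so all blocks are proper
    subsets. The constant [F] equal to [false] serves the graph, [true] its complement. *)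
Lemma disconnected_splittable T chi F (e : rel G) :
  {in T &, forall x y, flip_adj chi F x y -> e x y} ->
  disconnected_in e T -> symmetric e ->
  (forall K, K \proper T -> splittable K chi) -> splittable T chi.
Proof.
move=> fe [A [AT A0 TA0 nA]] eS IH; apply: (@splittable_blocks _ _ _ F) => x xT.
apply: IH; rewrite properE block_sub //=.
have sub (B : {set G}) : B \subset T -> x \in B ->
    {in B & T :\: B, forall a b, ~~ e a b} -> block T chi F x \subset B.
  move=> BT xB nB; apply/subsetP => y; rewrite inE => /connectP[p pP ->].
  elim: p x xB pP {xT} => //= z p IHp x xB /andP[/and3P[xT zT /(fe _ _ xT zT)]].
  move=> xz; apply: IHp; apply: contraTT xz => zB; apply: nB => //.
  by rewrite inE zB.
have [xA|xA] := boolP (x \in A).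
  have [y] := set0Pn _ TA0; rewrite inE => /andP[yA yT].
  by apply/subsetPn; exists y => //; apply: contra yA; apply/subsetP/sub.
have [y yA] := set0Pn _ A0.
apply/subsetPn; exists y; first exact: (subsetP AT).
have /subsetP H : block T chi F x \subset T :\: A.
  apply: sub; rewrite ?subsetDl ?inE ?xA //.
  move=> a b; rewrite !inE negb_and negbK => /andP[aA aT] /andP[/orP[bA _|/negPf->//]].
  by rewrite eS; apply: nA; rewrite // inE aA.
by apply/negP => /H; rewrite inE yA.
Qed.

(** Both operations are self-dual: complementing the graph is compensated by negating [b] in a count
    and [F] in a flip. *)
Lemma splittable_complement T chi :
  @splittable (complement G) T chi -> splittable T chi.
Proof.
elim=> {}T {}chi.
- by move=> T1; apply: (@splittable_small G).
- move=> b psi m _ IH; apply: (@splittable_refine _ _ _ (~~ b) psi m).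
  suff E : @refine_color G T chi (~~ b) psi m = @refine_color (complement G) T chi b psi m.
    exact: (eq_ind_r (fun c => @splittable G T c) IH E).
  apply: funext => x; rewrite /refine_color /nb_count; congr ((_ <= #|pred_of_set _|) :: _).
  apply/setP => z; rewrite !inE /= /compl_adj eq_sym.
  by have [->|] := eqVneq z x => //=; case: adj; case: b {IH}.
- move=> F _ IH; apply: (@splittable_blocks _ _ _ (fun k k' => ~~ F k k')) => x xT.
  suff E : @block G T chi (fun k k' => ~~ F k k') x =
      @block (complement G) T chi F x.
    exact: (eq_ind_r (fun K => @splittable G K chi) (IH x xT) E).
  apply/setP => y; rewrite !inE; apply: eq_connect => a b.
  rewrite /flip_in /flip_adj /= /compl_adj; case: (a \in T); case: (b \in T) => //=.
  by case: (a == b) => //=; case: adj; case: (F _ _); case: (F _ _).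
Qed.

End Splittable.

Lemma tame_splittable (G : sgraph) (T : {set G}) chi :
  tame_graph G -> splittable T chi.
Proof.
move=> tG; have [n Tn] := ubnP #|T|; elim: n T Tn => // n IH T Tn.
have IH' (K : {set G}) : K \proper T -> splittable K chi.
  by move=> /proper_card KT; apply: IH; rewrite (leq_trans KT).
case: (tG T) => -[acT|dT].
- exact: acyclic_splittable.
- apply: (@disconnected_splittable _ T chi (fun _ _ => false)) dT _ IH'.
  + by move=> x y _ _; rewrite /flip_adj => /andP[_]; case: adj.
  + exact: adj_sym.
- exact/splittable_complement/acyclic_splittable.
- apply: (@disconnected_splittable _ T chi (fun _ _ => true)) dT _ IH'.
  + by move=> x y _ _; rewrite /flip_adj /compl_adj => /andP[->]; case: adj.
  + exact: compl_adj_sym.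
Qed.

Lemma tree_cograph_splittable (G : sgraph) (T : {set G}) chi :
  tree_cograph G -> splittable T chi.
Proof. by move=> /tame_tree_cograph /tame_splittable. Qed.

Local Open Scope ring_scope.

(** * Isomorphisms of coloured sets *)

Section Representatives.
Variable G : sgraph.
Implicit Types (T : {set G}) (chi : G -> seq bool).

Definition rep T chi F (x : G) : G := fingraph.root (flip_in T chi F) x.

Definition reps T chi F : {set G} := [set x in T | rep T chi F x == x].

Lemma rep_block T chi F x : rep T chi F x \in block T chi F x.
Proof. by rewrite inE connect_root. Qed.

Lemma block_rep T chi F x : block T chi F (rep T chi F x) = block T chi F x.
Proof. exact/block_eq/rep_block. Qed.

Lemma repP T chi F x y : (rep T chi F y == rep T chi F x) = (y \in block T chi F x).
Proof. by rewrite inE eq_sym root_connect //; apply: flip_connect_sym. Qed.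

Lemma rep_reps T chi F x : x \in T -> rep T chi F x \in reps T chi F.
Proof.
move=> xT; rewrite inE repP rep_block andbT.
exact: (subsetP (block_sub chi F xT)) (rep_block _ _ _ _).
Qed.

Lemma reps_sub T chi F x : x \in reps T chi F -> x \in T.
Proof. by rewrite inE => /andP[]. Qed.

Lemma reps_id T chi F x : x \in reps T chi F -> rep T chi F x = x.
Proof. by rewrite inE => /andP[_ /eqP]. Qed.

Lemma sum_blocks (A : nmodType) T chi F (f : G -> A) :
  \sum_(x in T) f x = \sum_(r in reps T chi F) \sum_(x in block T chi F r) f x.
Proof.
rewrite (partition_big (rep T chi F) (mem (reps T chi F))) /=; last exact: rep_reps.
apply: eq_bigr => r rR; apply: eq_bigl => x.
rewrite -{1}(reps_id rR) repP andb_idl // => /(subsetP (block_sub _ _ _)); apply.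
exact: reps_sub rR.
Qed.

End Representatives.

Section ColoredIso.
Variables G H : sgraph.
Implicit Types (T : {set G}) (S : {set H}).

(** [f] is defined on all of [G], but only its values on [T] matter; gluing, composing and
    restricting to blocks thus need no subtypes. *)
Record colored_iso (chi : G -> seq bool) (T : {set G})
    (chi' : H -> seq bool) (S : {set H}) (f : G -> H) : Prop := ColoredIso {
  iso_inj : {in T &, injective f};
  iso_img : f @: T = S;
  iso_adj : {in T &, forall x y, adj (f x) (f y) = adj x y};
  iso_color : {in T, forall x, chi' (f x) = chi x} }.

Lemma iso_mem chi T chi' S f x : colored_iso chi T chi' S f -> x \in T -> f x \in S.
Proof. by case=> _ <- _ _ xT; apply: imset_f. Qed.

Lemma iso_eq chi T chi' S f g : {in T, f =1 g} ->
  colored_iso chi T chi' S f -> colored_iso chi T chi' S g.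
Proof.
move=> fg [fI fS fA fC]; split.
- by move=> x y xT yT; rewrite -!fg //; apply: fI.
- by rewrite -fS; apply/esym/eq_in_imset.
- by move=> x y xT yT; rewrite -!fg // fA.
- by move=> x xT; rewrite -fg // fC.
Qed.

End ColoredIso.

Lemma iso_id (G : sgraph) chi (T : {set G}) : colored_iso chi T chi T id.
Proof. by split; rewrite ?imset_id. Qed.

Lemma iso_comp (G H L : sgraph) chiG (T : {set G}) chiH (S : {set H})
    chiL (U : {set L}) f g :
  colored_iso chiG T chiH S f -> colored_iso chiH S chiL U g ->
  colored_iso chiG T chiL U (g \o f).
Proof.
move=> fI gI; have fS x : x \in T -> f x \in S := iso_mem fI.
split=> [x y xT yT /= E|||].
- by apply: (iso_inj fI) => //; apply: (iso_inj gI) => //; apply: fS.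
- by rewrite imset_comp (iso_img fI) (iso_img gI).
- by move=> x y xT yT /=; rewrite (iso_adj gI) ?fS ?(iso_adj fI).
- by move=> x xT /=; rewrite (iso_color gI) ?fS ?(iso_color fI).
Qed.

Lemma iso_inv (G H : sgraph) chiG (T : {set G}) chiH (S : {set H}) f :
  colored_iso chiG T chiH S f ->
  exists g, [/\ colored_iso chiH S chiG T g, {in T, cancel f g} & {in S, cancel g f}].
Proof.
move=> fI; have /card_gt0P[x0 _] := vertex_gt0 G.
pose g y := odflt x0 [pick x in T | f x == y].
have fgK : {in T, cancel f g}.
  move=> x xT; rewrite /g; case: pickP => [z /andP[zT /eqP E]|/(_ x)].
    exact: (iso_inj fI).
  by rewrite xT eqxx.
have [gfK gT] : {in S, cancel g f} /\ {in S, forall y, g y \in T}.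
  by split=> y; rewrite -(iso_img fI) => /imsetP[x xT ->]; rewrite fgK.
exists g; split=> //; split.
- exact: can_in_inj gfK.
- apply/setP => x; apply/imsetP/idP => [[y yS ->]|xT]; first exact: gT.
  by exists (f x); rewrite ?fgK ?(iso_mem fI).
- by move=> x y xS yS; rewrite -(iso_adj fI) ?gT ?gfK.
- by move=> x xS; rewrite -(iso_color fI) ?gT ?gfK.
Qed.

Section Glue.
Variables (G H : sgraph) (chiG : G -> seq bool) (chiH : H -> seq bool).
Variables (T : {set G}) (S : {set H}) (F : rel (seq bool)).
Let PT := reps T chiG F.
Let PS := reps S chiH F.
Let BT := block T chiG F.
Let BS := block S chiH F.
Let rT := rep T chiG F.

(** Inside a block adjacency is preserved by [f r]. Across blocks it is computed on both sides by
    the same [F] from colours, which the [f r] preserve; injectivity of [h] keeps different blocks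
    different. *)
Lemma iso_glue (h : G -> H) (f : G -> G -> H) :
  {in PT &, injective h} -> h @: PT = PS ->
  {in PT, forall r, colored_iso chiG (BT r) chiH (BS (h r)) (f r)} ->
  colored_iso chiG T chiH S (fun x => f (rT x) x).
Proof.
move=> hI hP fI.
have hS r : r \in PT -> h r \in PS by rewrite -hP; apply: imset_f.
have BT_T x : x \in T -> BT (rT x) \subset T.
  by move=> xT; rewrite /BT block_rep block_sub.
have xB x : x \in BT (rT x) by rewrite /BT block_rep block_refl.
have rP x : x \in T -> rT x \in PT by apply: rep_reps.
have fB x : x \in T -> f (rT x) x \in BS (h (rT x)).
  by move=> xT; apply: (iso_mem (fI _ (rP x xT))).
have fS x : x \in T -> f (rT x) x \in S.
  move=> xT; apply: (subsetP (block_sub _ _ _)) (fB x xT).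
  exact/reps_sub/hS/rP.
have fR x : x \in T -> rep S chiH F (f (rT x) x) = h (rT x).
  move=> xT; rewrite -[RHS](reps_id (hS _ (rP _ xT))); apply/eqP.
  by rewrite repP; apply: fB.
have fC x : x \in T -> chiH (f (rT x) x) = chiG x.
  by move=> xT; apply: (iso_color (fI _ (rP x xT))).
have fJ : {in T &, injective (fun x => f (rT x) x)}.
  move=> x y xT yT E.
  have Er : rT x = rT y by apply: hI; rewrite ?rP // -!fR // E.
  apply: (iso_inj (fI _ (rP x xT))) => //; first by rewrite Er.
  by rewrite E Er.
split=> //.
- apply/setP => y; apply/imsetP/idP => [[x xT ->]|yS]; first exact: fS.
  have := rep_reps chiH F yS; rewrite -/PS -hP => /imsetP[r rP' E].
  have : y \in BS (h r) by rewrite -E /BS block_rep block_refl.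
  rewrite -(iso_img (fI r rP')) => /imsetP[x xr ->].
  have rT' := reps_sub rP'.
  exists x; first exact: (subsetP (block_sub _ _ rT')) xr.
  by move: xr; rewrite /BT -repP => /eqP Ex; rewrite /rT Ex (reps_id rP').
- move=> x y xT yT; have [Er|Er] := eqVneq (rT x) (rT y).
    rewrite -Er; apply: (iso_adj (fI _ (rP x xT))) => //; by rewrite Er.
  rewrite (@cross_adj _ T chiG F) ?(@cross_adj _ S chiH F) ?fC ?fS //.
    by rewrite -repP !fR // (inj_in_eq hI) ?rP // eq_sym.
  by rewrite -repP eq_sym.
Qed.

End Glue.

Section BlockAutomorphisms.
Variables (G : sgraph) (chi : G -> seq bool) (T : {set G}) (F : rel (seq bool)).
Local Notation B := (block T chi F).
Local Notation auto T := (colored_iso chi T chi T).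

Lemma block_auto_extend x g : x \in T -> auto (B x) g ->
  exists2 f, auto T f & forall z, f z = if z \in B x then g z else z.
Proof.
move=> xT gI; pose r := rep T chi F x.
exists (fun z => if rep T chi F z == r then g z else z); last first.
  by move=> z; rewrite repP.
apply: (iso_eq _ (iso_glue (h := id) (f := fun s z => if s == r then g z else z) _ _ _)).
- by [].
- by move=> ? ? _ _.
- by rewrite imset_id.
- move=> s sP; have [->|_] := eqVneq s r; last exact: iso_id.
  by rewrite block_rep.
Qed.

(** The representatives of the two blocks are transposed, with [g] in one direction and its inverse
    in the other. The vertex [x] moves because its image lies in the other block. *)
Lemma block_swap x y g : x \in T -> y \in T -> y \notin B x ->
  colored_iso chi (B x) chi (B y) g ->
  exists f, [/\ auto T f, f x != x & forall z, z \notin B x -> z \notin B y -> f z = z].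
Proof.
move=> xT yT xy gI; have [g' [g'I gK g'K]] := iso_inv gI.
pose r := rep T chi F x; pose s := rep T chi F y.
have rs : r != s by rewrite eq_sym repP.
pose f t z := if t == r then g z else if t == s then g' z else z.
pose h t := if t == r then s else if t == s then r else t.
have hK : involutive h.
  move=> a; rewrite /h; have [->|ar] := eqVneq a r.
    by rewrite eq_sym (negPf rs) eqxx.
  have [->|as_] := eqVneq a s; first by rewrite eqxx.
  by rewrite (negPf ar) (negPf as_).
have hP t : t \in reps T chi F -> h t \in reps T chi F.
  by rewrite /h; case: ifP => _; [|case: ifP => _]; rewrite // rep_reps.
exists (fun z => f (rep T chi F z) z); split.
- apply: (iso_glue (h := h)).
  + by move=> a b _ _; apply: inv_inj.
  + apply/setP => t; apply/imsetP/idP => [[u uP ->]|tP]; first exact: hP.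
    by exists (h t); rewrite ?hK ?hP.
  + move=> t tP; rewrite /f /h; have [->|tr] := eqVneq t r.
      by rewrite !block_rep.
    have [->|ts] := eqVneq t s; last exact: iso_id.
    by rewrite !block_rep.
- rewrite /f -/r eqxx; have := iso_mem gI (block_refl _ _ _ x).
  apply: contraTneq => ->; apply: contra xy => /block_eq E.
  by rewrite E block_refl.
- by move=> z zx zy; rewrite /f !repP (negPf zx) (negPf zy).
Qed.

End BlockAutomorphisms.

(** Fibres of equal size are matched in the order of their enumerations; [j0] is only a default
    value for [nth]. *)
Lemma match_classes (I J : finType) (K : eqType) (P : {set I}) (Q : {set J})
    (k : I -> K) (l : J -> K) (j0 : J) :
  (forall c, #|[set i in P | k i == c]| = #|[set j in Q | l j == c]|) ->
  exists h : I -> J, [/\ {in P &, injective h}, h @: P = Q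
    & {in P, forall i, l (h i) = k i}].
Proof.
move=> E; pose PC c := enum [set i in P | k i == c].
pose QC c := enum [set j in Q | l j == c].
have sz c : size (PC c) = size (QC c) by rewrite -!cardE E.
pose h i := nth j0 (QC (k i)) (index i (PC (k i))).
have iP i : i \in P -> i \in PC (k i) by move=> iP; rewrite mem_enum inE iP /=.
have hQ i : i \in P -> (h i \in Q) && (l (h i) == k i).
  move=> /iP iPC; have : h i \in QC (k i) by rewrite mem_nth // -sz index_mem.
  by rewrite mem_enum inE.
exists h; split.
- move=> i i' iP1 iP2 hE.
  have kE : k i = k i'.
    by case/andP: (hQ _ iP1) => _ /eqP <-; case/andP: (hQ _ iP2) => _ /eqP <-; rewrite hE.
  move: hE; rewrite /h kE => /eqP; rewrite nth_uniq ?enum_uniq -?sz ?index_mem -?kE ?iP //.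
    by rewrite kE => /eqP H; rewrite -(nth_index i (iP _ iP1)) kE H -kE kE nth_index // iP.
  by rewrite kE iP.
- apply/setP => j; apply/imsetP/idP => [[i iP1 ->]|jQ].
    by case/andP: (hQ _ iP1).
  have jQC : j \in QC (l j) by rewrite mem_enum inE jQ /=.
  have lt : (index j (QC (l j)) < size (PC (l j)))%N by rewrite sz index_mem.
  have [i0 _] : exists i0 : I, True.
    by case: (PC (l j)) lt => // i0 s _; exists i0.
  pose i := nth i0 (PC (l j)) (index j (QC (l j))).
  have : i \in PC (l j) by rewrite mem_nth.
  rewrite mem_enum inE => /andP[iP1 /eqP ki]; exists i => //.
  by rewrite /h ki index_uniq ?enum_uniq // nth_index.
- by move=> i /hQ/andP[_ /eqP].
Qed.

(** * Magic unitaries on splittable sets *)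

Section Magic.
Variables (K : numFieldType) (A : algType K).

(** The passage from algebra to counting: two expressions of one sum as multiples of a nonzero
    element give equal numbers. *)
Lemma mulrn_inj (a : A) (m n : nat) : a *+ m = a *+ n -> a != 0 -> m = n.
Proof.
move=> E a0; apply/eqP; have /eqP := E; rewrite -!scaler_nat -subr_eq0 -scalerBl.
by rewrite scaler_eq0 (negPf a0) orbF subr_eq0 eqr_nat.
Qed.

(* The rows and columns sum to an idempotent [p], not necessarily to 1, so that
   the blocks of a magic unitary are again of this form. *)
Record magic (G H : sgraph) (chi : G -> seq bool) (T : {set G})
    (chi' : H -> seq bool) (S : {set H}) (p : A) (u : H -> G -> A) : Prop := Magic {
  magic_idem : {in S & T, forall y x, u y x * u y x = u y x};
  magic_row0 : {in S & T, forall y x, {in T, forall z, x != z -> u y x * u y z = 0}};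
  magic_col0 : {in S & T, forall y x, {in S, forall z, y != z -> u y x * u z x = 0}};
  magic_row : {in S, forall y, \sum_(x in T) u y x = p};
  magic_col : {in T, forall x, \sum_(y in S) u y x = p};
  magic_adj : {in S & T, forall y x, {in S & T, forall y' x',
    adj y y' != adj x x' -> u y x * u y' x' = 0}};
  magic_color : {in S & T, forall y x, chi' y != chi x -> u y x = 0} }.

Lemma magic_tr (G H : sgraph) chi (T : {set G}) chi' (S : {set H}) p u :
  magic chi T chi' S p u -> magic chi' S chi T p (fun x y => u y x).
Proof.
case=> i1 i2 i3 i4 i5 i6 i7; split=> //; first by move=> x y *; auto.
- by move=> x y *; auto.
- by move=> x y *; auto.
- by move=> x y xT yS x' y' x'T y'S ne; rewrite i6 // eq_sym.
- by move=> x y xT yS ne; rewrite i7 // eq_sym.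
Qed.

Section Fixed.
Variables (G H : sgraph) (chi : G -> seq bool) (T : {set G})
    (chi' : H -> seq bool) (S : {set H}) (p : A) (u : H -> G -> A).
Hypothesis M : magic chi T chi' S p u.

Lemma magic_mulp x y : x \in T -> y \in S -> u y x * p = u y x.
Proof.
move=> xT yS; rewrite -(magic_row M yS) mulr_sumr (bigD1 x) //= (magic_idem M) //.
rewrite big1 ?addr0 // => z /andP[zT zx].
by rewrite (magic_row0 M) // eq_sym.
Qed.

Lemma magic_pmul x y : x \in T -> y \in S -> p * u y x = u y x.
Proof.
move=> xT yS; rewrite -(magic_row M yS) mulr_suml (bigD1 x) //= (magic_idem M) //.
by rewrite big1 ?addr0 // => z /andP[zT zx]; rewrite (magic_row0 M).
Qed.

Lemma magic_card : p != 0 -> #|T| = #|S|.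
Proof.
apply: mulrn_inj; rewrite -!sumr_const -(eq_bigr _ (magic_col M)) exchange_big /=.
exact: eq_bigr (magic_row M).
Qed.

(** If [u y x] is nonzero, the two counts agree: expanding along the columns of the counted [z], or
    along the rows of the counted [w], gives the same double sum of [u y x * u w z], equal to either
    count times [u y x]. *)
Lemma magic_refine b psi m :
  magic (refine_color T chi b psi m) T (refine_color S chi' b psi m) S p u.
Proof.
case: (M) => i1 i2 i3 i4 i5 i6 i7; split=> // y x yS xT.
rewrite /refine_color; have [E|/(i7 _ _ yS xT)//] := eqVneq (chi' y) (chi x).
rewrite E; apply: contraNeq => u0; suff -> : nb_count T chi b psi x = nb_count S chi' b psi y by [].
apply: mulrn_inj u0; rewrite /nb_count -!sumr_const.
(* A product is zero as soon as exactly one of [z] and [w] is counted, because equality with the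
   base point, adjacency and colour must all match. *)
have N z w : z \in T -> w \in S -> [&& z != x, adj x z == b & psi (chi z)] !=
    [&& w != y, adj y w == b & psi (chi' w)] -> u y x * u w z = 0.
  move=> zT wS.
  have [Ec|/(i7 _ _ wS zT)->] := eqVneq (chi' w) (chi z); last by rewrite mulr0.
  have [Ea|/i6->//] := eqVneq (adj y w) (adj x z).
  rewrite Ea Ec; have [->|zx] := eqVneq z x; have [->|wy] := eqVneq w y;
    rewrite ?eqxx //= => _.
  - by rewrite i3 // eq_sym.
  - by rewrite i2 // eq_sym.
transitivity (\sum_(z in T | [&& z != x, adj x z == b & psi (chi z)])
   \sum_(w in S | [&& w != y, adj y w == b & psi (chi' w)]) u y x * u w z).
  apply: eq_big => [z|z]; rewrite inE // => /andP[zT Pz].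
  rewrite -{1}(magic_mulp xT yS) -(i5 z zT) mulr_sumr.
  rewrite (bigID [pred w | [&& w != y, adj y w == b & psi (chi' w)]]) /=.
  by rewrite [X in _ + X]big1 ?addr0 // => w /andP[wS /negPf Pw]; rewrite N // Pz Pw.
rewrite exchange_big /=; apply: eq_big => [w|w]; first by rewrite inE.
case/andP=> wS Pw.
rewrite -[RHS](magic_mulp xT yS) -(i4 w wS) mulr_sumr.
rewrite [RHS](bigID [pred z | [&& z != x, adj x z == b & psi (chi z)]]) /=.
by rewrite [X in _ + X]big1 ?addr0 // => z /andP[zT /negPf Pz]; rewrite N // Pz Pw.
Qed.

Section Blocks.
Variable F : rel (seq bool).
Local Notation BT := (block T chi F).
Local Notation BS := (block S chi' F).

Lemma magic_flip x x' y y' : x \in T -> x' \in T -> y \in S -> y' \in S ->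
  flip_adj chi F x x' != flip_adj chi' F y y' -> u y x * u y' x' = 0.
Proof.
move=> xT x'T yS y'S.
have [E1|/(magic_color M yS xT)->] := eqVneq (chi' y) (chi x); last by rewrite mul0r.
have [E2|/(magic_color M y'S x'T)->] := eqVneq (chi' y') (chi x'); last by rewrite mulr0.
have [Ea|/(magic_adj M)->//] := eqVneq (adj y y') (adj x x').
rewrite /flip_adj E1 E2 Ea.
have [->|zx] := eqVneq x x'; have [->|wy] := eqVneq y y'; rewrite ?eqxx //= => _.
- by rewrite (magic_col0 M).
- by rewrite (magic_row0 M).
Qed.

(** Walk along a path from [x] to [x'] and insert [p] as the sum of the column of the next vertex
    [z]. A term [w] either is not related to [y] by the flipped adjacency, and vanishes, or lies in
    the block of [y], where the induction hypothesis applies. *)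
Lemma magic_connectl x x' y y' : x \in T -> x' \in T -> y \in S -> y' \in S ->
  x' \in BT x -> y' \notin BS y -> u y x * u y' x' = 0.
Proof.
move=> xT x'T yS y'S; rewrite inE => /connectP[q qP x'q].
elim: q x y xT yS qP x'q => [|z q IH] x y xT yS /= qP x'q nyy'.
  rewrite x'q in x'T *; apply: (magic_col0 M) => //.
  by apply: contraNneq nyy' => ->; apply: block_refl.
case/andP: qP => /and3P[_ zT xz] qP.
rewrite -(magic_mulp xT yS) -(magic_col M zT) mulr_sumr mulr_suml big1 // => w wS.
have [yw|nyw] := boolP (flip_adj chi' F y w); last first.
  by rewrite (magic_flip xT) ?mul0r // xz (negPf nyw).
rewrite -mulrA (IH z w) ?mulr0 //.
suff <- : BS y = BS w by [].
by apply/esym/block_eq; rewrite inE connect1 // /flip_in yS wS.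
Qed.

End Blocks.
End Fixed.

Lemma magic_connect (G H : sgraph) chi (T : {set G}) chi' (S : {set H}) p u F x x' y y' :
  magic chi T chi' S p u -> x \in T -> x' \in T -> y \in S -> y' \in S ->
  (x' \in block T chi F x) != (y' \in block S chi' F y) -> u y x * u y' x' = 0.
Proof.
move=> M xT x'T yS y'S.
have [xx'|nxx'] := boolP (x' \in _); have [yy'|nyy'] := boolP (y' \in _) => // _.
  exact: (magic_connectl M) xx' nyy'.
exact: (magic_connectl (magic_tr M)) yy' nxx'.
Qed.

Section BlockSum.
Variables (G H : sgraph) (chi : G -> seq bool) (T : {set G})
    (chi' : H -> seq bool) (S : {set H}) (p : A) (u : H -> G -> A).
Variable F : rel (seq bool).
Hypothesis M : magic chi T chi' S p u.
Local Notation BT := (block T chi F).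
Local Notation BS := (block S chi' F).

Definition block_sum y x := \sum_(y' in BS y) u y' x.
Local Notation q := block_sum.

(** Both sides equal the sum of [u y' x * u y x'] over [y'] in the block of [y] and [x'] in the
    block of [x]: completing the inner sum to a full row or column adds only products that vanish by
    [magic_connect]. *)
Lemma block_sum_row x y : x \in T -> y \in S -> q y x = \sum_(x' in BT x) u y x'.
Proof.
move=> xT yS; have BTs := subsetP (block_sub chi F xT).
have BSs := subsetP (block_sub chi' F yS).
transitivity (\sum_(y' in BS y) \sum_(x' in BT x) u y' x * u y x').
  apply: eq_bigr => y' y'B; have y'S := BSs _ y'B.
  rewrite -{1}(magic_mulp M xT y'S) -(magic_row M yS) mulr_sumr.
  rewrite (bigID (mem (BT x))) /= [X in _ + X]big1 ?addr0.
    by apply: eq_bigl => z; rewrite andb_idl // => /BTs.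
  move=> z /andP[zT /negPf nz]; apply: (magic_connect (F := F) M) => //.
  by rewrite nz (block_eq y'B) block_refl.
rewrite exchange_big /=; apply: eq_bigr => x' x'B; have x'T := BTs _ x'B.
rewrite -{2}(magic_pmul M x'T yS) -(magic_col M xT) mulr_suml.
rewrite [RHS](bigID (mem (BS y))) /= [X in _ + X]big1 ?addr0.
  by apply: eq_bigl => z; rewrite andb_idl // => /BSs.
move=> z /andP[zS nz]; apply: (magic_connect (F := F) M) => //.
rewrite x'B; apply: contra nz => /eqP/esym E.
by rewrite (block_eq E) block_refl.
Qed.

Lemma block_sum_eq x x' y y' : x \in T -> y \in S ->
  x' \in BT x -> y' \in BS y -> q y' x' = q y x.
Proof.
move=> xT yS x'B y'B; have x'T := subsetP (block_sub chi F xT) _ x'B.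
transitivity (q y x'); first by rewrite /q (block_eq y'B).
by rewrite !block_sum_row // (block_eq x'B).
Qed.

Lemma block_sum_mul x y : x \in T -> y \in S -> q y x * u y x = u y x.
Proof.
move=> xT yS; rewrite /q mulr_suml (bigD1 y) ?block_refl //= (magic_idem M) //.
rewrite big1 ?addr0 // => z /andP[zB zy].
by rewrite (magic_col0 M) // (subsetP (block_sub chi' F yS)).
Qed.

Lemma magic_block x y : x \in T -> y \in S -> magic chi (BT x) chi' (BS y) (q y x) u.
Proof.
move=> xT yS; have BTs := subsetP (block_sub chi F xT).
have BSs := subsetP (block_sub chi' F yS); split.
- by move=> b a /BSs bS /BTs aT; apply: (magic_idem M).
- by move=> b a /BSs bS /BTs aT c /BTs cT; apply: (magic_row0 M).
- by move=> b a /BSs bS /BTs aT c /BSs cT; apply: (magic_col0 M).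
- move=> b bB; have bS := BSs _ bB; rewrite -(block_sum_row xT bS).
  by apply: block_sum_eq; rewrite ?block_refl.
- by move=> a aB; rewrite -(block_sum_eq xT yS aB (block_refl _ _ _ _)).
- by move=> b a /BSs bS /BTs aT d c /BSs dS /BTs cT; apply: (magic_adj M).
- by move=> b a /BSs bS /BTs aT; apply: (magic_color M).
Qed.

Lemma block_sum_col x : x \in T -> \sum_(y in reps S chi' F) q y x = p.
Proof. by move=> xT; rewrite -sum_blocks (magic_col M). Qed.

Lemma block_sum_row1 y : y \in S -> \sum_(x in reps T chi F) q y x = p.
Proof.
move=> yS; rewrite -(magic_row M yS) [RHS](sum_blocks _ chi F); apply: eq_bigr => x xR.
by rewrite block_sum_row // (reps_sub xR).
Qed.

Lemma block_sum_orth x x' y y' : x \in T -> x' \in T -> y \in S -> y' \in S ->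
  (x' \in BT x) != (y' \in BS y) -> q y x * q y' x' = 0.
Proof.
move=> xT x'T yS y'S ne; rewrite /q mulr_suml big1 // => b bB.
rewrite mulr_sumr big1 // => d dB.
have bS := subsetP (block_sub chi' F yS) _ bB.
have dS := subsetP (block_sub chi' F y'S) _ dB.
apply: (magic_connect (F := F) M) => //; rewrite (block_eq bB).
suff -> : (d \in BS y) = (y' \in BS y) by [].
by rewrite -!repP; congr (_ == _); apply/eqP; rewrite repP.
Qed.

End BlockSum.

Definition colored_isomorphic (G H : sgraph) chi (T : {set G}) chi' (S : {set H}) :=
  exists f, colored_iso chi T chi' S f.

(** In the case of blocks, a nonzero [q s r] yields by induction an isomorphism between the blocks
    of [r] and [s]. Hence [q] respects isomorphism types, and its row and column sums count the
    blocks of each type. *)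
Theorem splittable_magic_iso (G : sgraph) (T : {set G}) chi : splittable T chi ->
  forall (H : sgraph) (S : {set H}) chi' p u, magic chi T chi' S p u -> p != 0 ->
  colored_isomorphic chi T chi' S.
Proof.
elim=> {T chi} [T chi T1|T chi b psi m _ IH|T chi F _ IH] H S chi' p u M p0.
- have TS := magic_card M p0; have /card_gt0P[y0 _] := vertex_gt0 H.
  have [T0|/set0Pn[x xT]] := eqVneq T set0.
    exists (fun _ => y0); rewrite T0 cards0 in TS *.
    have -> : S = set0 by apply/eqP; rewrite -cards_eq0 -TS.
    by split; rewrite ?imset0 // => ?; rewrite inE.
  have Tx : T = [set x].
    by apply/esym/eqP; rewrite eqEcard sub1set xT cards1.
  have /cards1P[y Sy] : #|S| == 1 by rewrite -TS Tx cards1.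
  exists (fun _ => y); split.
  + by move=> a b'; rewrite Tx !inE => /eqP-> /eqP->.
  + by rewrite Tx Sy imset_set1.
  + by move=> a b'; rewrite Tx !inE => /eqP-> /eqP->; rewrite !adj_irrefl.
  + move=> a; rewrite Tx inE => /eqP ->; apply/eqP; apply: contraNT p0 => ne.
    have yS : y \in S by rewrite Sy inE.
    by rewrite -(magic_col M xT) Sy big_set1 (magic_color M) // ?Sy ?inE // eqxx.
- have [f fI] := IH _ _ _ _ _ (magic_refine M b psi m) p0.
  exists f; split; [exact: iso_inj fI|exact: iso_img fI|exact: iso_adj fI|].
  by move=> x /(iso_color fI)[].
pose q := block_sum chi' S u F.
pose PT := reps T chi F; pose PS := reps S chi' F.
pose isoT (r r' : G) := `[< colored_isomorphic chi (block T chi F r) chi (block T chi F r') >].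
pose isoS (r : G) (s : H) := `[< colored_isomorphic chi (block T chi F r) chi' (block S chi' F s) >].
(* Names for isomorphism types: [pick] depends only on the predicate, so isomorphic blocks receive
   the same representative of [T]. The name of a block of [S] may be [None]. *)
pose k r := [pick r' in PT | isoT r' r]; pose l s := [pick r' in PT | isoS r' s].
have kl r s : r \in T -> s \in S -> q s r != 0 -> k r = l s.
  move=> rT sS q0; have [f fI] := IH r rT _ _ _ _ _ (magic_block F M rT sS) q0.
  apply: eq_pick => r' /=; congr (_ && _); apply/asboolP/asboolP => -[g gI].
    by exists (f \o g); apply: iso_comp gI fI.
  have [f' [f'I _ _]] := iso_inv fI.
  by exists (f' \o g); apply: iso_comp gI f'I.
(* Entries of [q] between different types vanish, so summing [q] over one type by columns and by
   rows gives the two counts times [p]. *)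
have cnt c : #|[set r in PT | k r == c]| = #|[set s in PS | l s == c]|.
  apply: mulrn_inj p0; rewrite -!sumr_const.
  transitivity (\sum_(r in PT | k r == c) \sum_(s in PS | l s == c) q s r).
    apply: eq_big => [r|r]; rewrite inE // => /andP[rP /eqP kr].
    rewrite -(block_sum_col F M (reps_sub rP)) (bigID [pred s | l s == c]) /=.
    rewrite [X in _ + X]big1 ?addr0 // => s /andP[sP].
    by apply: contraNeq => q0; rewrite -kr (kl _ _ (reps_sub rP) (reps_sub sP) q0).
  rewrite exchange_big /=; apply: eq_big => [s|s]; first by rewrite [in RHS]inE.
  case/andP=> sP /eqP ls.
  rewrite -(block_sum_row1 F M (reps_sub sP)) [RHS](bigID [pred r | k r == c]) /=.
  rewrite [X in _ + X]big1 ?addr0 // => r /andP[rP].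
  by apply: contraNeq => q0; rewrite -ls (kl _ _ (reps_sub rP) (reps_sub sP) q0).
have /card_gt0P[y0 _] := vertex_gt0 H.
have [h [hI hP hk]] := match_classes y0 cnt.
have fP r : exists f, r \in PT ->
    colored_iso chi (block T chi F r) chi' (block S chi' F (h r)) f.
  have [rP|] := boolP (r \in PT); last by exists (fun _ => y0).
  (* [k r] is not [None], since [r] itself is a candidate; the common name is thus isomorphic to
     both blocks and provides the map between them. *)
  have : k r = l (h r) by rewrite hk.
  rewrite /k /l; case: pickP => [r1 /andP[_ /asboolP[g gI]]|/(_ r)]; last first.
    rewrite rP /=; have -> // : isoT r r.
    by apply/asboolP; exists id; apply: iso_id.
  case: pickP => // r2 /andP[_ /asboolP[g' g'I]] [E]; subst r2.
  have [g1 [g1I _ _]] := iso_inv gI.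
  by exists (g' \o g1) => _; apply: iso_comp g1I g'I.
have [f fI] := choice fP.
by exists (fun x => f (rep T chi F x) x); apply: iso_glue hI hP fI.
Qed.

End Magic.

(** * Rigidity and commutation for magic unitaries on one graph *)

Section SelfMagic.
Variables (K : numFieldType) (A : algType K) (G : sgraph).
Implicit Types (T : {set G}) (chi : G -> seq bool).

Local Notation auto chi T := (colored_iso chi T chi T).

Definition asymmetric_in chi T := forall f, auto chi T f -> {in T, f =1 id}.

Definition schmidt_in chi T := exists f g,
  [/\ auto chi T f, auto chi T g, exists2 x, x \in T & f x != x,
      exists2 x, x \in T & g x != x
    & {in T, forall x, f x = x \/ g x = x}].

Lemma asymmetricPn chi T : ~ asymmetric_in chi T ->
  exists2 f, auto chi T f & exists2 x, x \in T & f x != x.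
Proof.
move=> nA; apply: contrapT => nE; apply: nA => f fI x xT.
by apply/eqP; apply: contrapT => /negP ne; apply: nE; exists f => //; exists x.
Qed.

(** Turns the part of [u] between two isomorphic blocks into a magic matrix on one of them, to which
    [splittable_magic_diag] applies. *)
Lemma magic_pull (H : sgraph) chi T (chi' : H -> seq bool) (S : {set H}) (p : A) u f :
  magic chi T chi' S p u -> colored_iso chi T chi' S f ->
  magic chi T chi T p (fun b a => u (f b) a).
Proof.
move=> M fI; have fS x : x \in T -> f x \in S := iso_mem fI; split.
- by move=> y x /fS yS xT; apply: (magic_idem M).
- by move=> y x /fS yS xT z zT; apply: (magic_row0 M).
- move=> y x yT xT z zT ne; apply: (magic_col0 M); rewrite ?fS //.
  by apply: contra_neq ne; apply: (iso_inj fI).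
- by move=> y /fS; apply: (magic_row M).
- move=> x xT; rewrite -(magic_col M xT) -(iso_img fI) big_imset //.
  exact: iso_inj fI.
- move=> y x yT xT y' x' y'T x'T ne.
  by apply: (magic_adj M); rewrite ?fS // (iso_adj fI).
- by move=> y x yT xT ne; apply: (magic_color M); rewrite ?fS // (iso_color fI).
Qed.

Section Blocks.
Variables (T : {set G}) (chi : G -> seq bool) (F : rel (seq bool)).
Local Notation B := (block T chi F).
Local Notation isoB x y := (colored_isomorphic chi (B x) chi (B y)).

Lemma isoB_sym x y : isoB x y -> isoB y x.
Proof. by case=> f /iso_inv[g [gI _ _]]; exists g. Qed.

Lemma isoB_trans x y z : isoB x y -> isoB y z -> isoB x z.
Proof. by case=> f fI [g gI]; exists (g \o f); apply: iso_comp fI gI. Qed.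

Lemma disjoint_blocks x y z : y \notin B x -> z \in B x -> z \notin B y.
Proof.
move=> yx zx; apply: contra yx => zy.
by rewrite -(block_eq zx) (block_eq zy) block_refl.
Qed.

Lemma asymmetric_block x : x \in T -> asymmetric_in chi T -> asymmetric_in chi (B x).
Proof.
move=> xT aT f fI z zB; have [g gI gE] := block_auto_extend xT fI.
by rewrite -[RHS](aT g gI) ?gE ?zB // (subsetP (block_sub chi F xT)).
Qed.

Lemma schmidt_block x : x \in T -> schmidt_in chi (B x) -> schmidt_in chi T.
Proof.
move=> xT [f [g [fI gI [a aB fa] [b bB gb] dis]]].
have [f' f'I f'E] := block_auto_extend xT fI.
have [g' g'I g'E] := block_auto_extend xT gI.
have BT := subsetP (block_sub chi F xT).
exists f', g'; split=> //.
- by exists a; rewrite ?f'E ?aB ?BT.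
- by exists b; rewrite ?g'E ?bB ?BT.
- by move=> z zT; rewrite f'E g'E; case: ifP => [/dis//|_]; left.
Qed.

Lemma schmidt_two_blocks x y : x \in T -> y \in T -> y \notin B x ->
  ~ asymmetric_in chi (B x) -> ~ asymmetric_in chi (B y) -> schmidt_in chi T.
Proof.
move=> xT yT yx /asymmetricPn[f fI [a aB fa]] /asymmetricPn[g gI [b bB gb]].
have [f' f'I f'E] := block_auto_extend xT fI.
have [g' g'I g'E] := block_auto_extend yT gI.
exists f', g'; split=> //.
- by exists a; rewrite ?f'E ?aB // (subsetP (block_sub chi F xT)).
- by exists b; rewrite ?g'E ?bB // (subsetP (block_sub chi F yT)).
- move=> z zT; rewrite f'E g'E; have [zx|zx] := boolP (z \in B x); last by left.
  by right; rewrite (negPf (disjoint_blocks yx zx)).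
Qed.

Lemma schmidt_two_swaps i i' k k' : i \in T -> i' \in T -> k \in T -> k' \in T ->
  i' \notin B i -> k' \notin B k -> k \notin B i -> k' \notin B i ->
  k \notin B i' -> k' \notin B i' -> isoB i i' -> isoB k k' -> schmidt_in chi T.
Proof.
move=> iT i'T kT k'T ii' kk' ki k'i ki' k'i' [f fI] [g gI].
have [f' [f'I f'i f'E]] := block_swap iT i'T ii' fI.
have [g' [g'I g'k g'E]] := block_swap kT k'T kk' gI.
exists f', g'; split=> //; [by exists i|by exists k|].
move=> z zT; have [zi|zi] := boolP (z \in B i).
  by right; apply: g'E; apply: disjoint_blocks zi.
have [zi'|zi'] := boolP (z \in B i'); last by left; apply: f'E.
by right; apply: g'E; apply: disjoint_blocks zi'.
Qed.

(** A nontrivial automorphism of [B z] would have a disjoint companion: its conjugate on the twin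
    block if [B z] is one of the two isomorphic blocks, and otherwise the swap of these two. *)
Lemma isomorphic_blocks_asymmetric i i' z : i \in T -> i' \in T -> z \in T ->
  i' \notin B i -> isoB i i' -> ~ schmidt_in chi T -> asymmetric_in chi (B z).
Proof.
move=> iT i'T zT ii' iso nS; apply: contrapT => nA; apply: nS.
have twin x y : x \in T -> y \in T -> y \notin B x -> isoB x y ->
    ~ asymmetric_in chi (B x) -> schmidt_in chi T.
  move=> xT yT yx [f fI] nAx; apply: (schmidt_two_blocks xT yT yx) => //.
  move=> aY; have [g gI [a aB ga]] := asymmetricPn nAx.
  have [f' [f'I fK f'K]] := iso_inv fI.
  have := aY _ (iso_comp (iso_comp f'I gI) fI) (f a) (iso_mem fI aB).
  rewrite /= fK // => /(iso_inj fI) E; rewrite E ?eqxx // in ga.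
  exact: iso_mem gI aB.
have [zi|zi] := boolP (z \in B i).
  by apply: (twin i i'); rewrite // -(block_eq zi).
have [zi'|zi'] := boolP (z \in B i').
  apply: (twin i' i); rewrite -?(block_eq zi') //.
  - by apply: contra ii'; rewrite (block_eq zi') => /block_eq ->; apply: block_refl.
  - by rewrite (block_eq zi'); apply: isoB_sym.
have [g gI [a aB ga]] := asymmetricPn nA.
have [g' g'I g'E] := block_auto_extend zT gI.
have [f fI] := iso.
have [f' [f'I f'i f'E]] := block_swap iT i'T ii' fI.
exists f', g'; split=> //; first by exists i.
  by exists a; rewrite ?g'E ?aB // (subsetP (block_sub chi F zT)).
move=> w wT; rewrite g'E; have [wz|wz] := boolP (w \in B z); last by right.
left; apply: f'E; apply: disjoint_blocks wz.
  by apply: contra zi => /block_eq ->; apply: block_refl.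
by apply: contra zi' => /block_eq ->; apply: block_refl.
Qed.

Section Self.
Variables (p : A) (u : G -> G -> A).
Hypothesis M : magic chi T chi T p u.
Hypothesis spl : forall x, x \in T -> splittable (B x) chi.
Local Notation q := (block_sum chi T u F).

Lemma block_sum_iso x y : x \in T -> y \in T -> q y x != 0 -> isoB x y.
Proof. by move=> xT yT; apply: splittable_magic_iso (spl xT) _ _ _ _ _ (magic_block F M xT yT). Qed.

Lemma block_sum_diag x : x \in T ->
  {in T, forall y, y \notin B x -> q y x = 0} -> q x x = p.
Proof.
move=> xT q0; rewrite -(block_sum_col F M xT).
rewrite (bigD1 (rep T chi F x)) ?rep_reps //= big1 ?addr0.
  by apply/esym/(block_sum_eq M); rewrite ?block_refl ?rep_block.
move=> y /andP[yR yx]; apply: q0; first exact: reps_sub yR.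
by rewrite -repP (reps_id yR).
Qed.

Lemma block_sum_mulp x y : x \in T -> y \in T -> q y x * p = q y x.
Proof.
move=> xT yT; rewrite /block_sum mulr_suml; apply: eq_bigr => z zB.
by rewrite (magic_mulp M) // (subsetP (block_sub chi F yT)).
Qed.

Lemma block_sum_pmul x y : x \in T -> y \in T -> p * q y x = q y x.
Proof.
move=> xT yT; rewrite /block_sum mulr_sumr; apply: eq_bigr => z zB.
by rewrite (magic_pmul M) // (subsetP (block_sub chi F yT)).
Qed.

(* The algebraic proof that a 3 x 3 magic matrix has commuting entries still
   works as long as no two disjoint pairs of blocks are isomorphic. *)
Lemma block_sum_comm x y x' y' : ~ schmidt_in chi T ->
  x \in T -> y \in T -> x' \in T -> y' \in T ->
  q y x * q y' x' = q y' x' * q y x.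
Proof.
move=> nS.
have repE a b : a \in T -> b \in T -> q b (rep T chi F a) = q b a.
  by move=> aT bT; apply: (block_sum_eq M); rewrite ?block_refl ?rep_block.
have orth a b c d : a \in T -> b \in T -> c \in T -> d \in T ->
    (c \in B a) != (d \in B b) -> q b a * q d c = 0.
  by move=> *; apply: (block_sum_orth M).
have sum3 (a b : A) (f : G -> A) : a * (\sum_(k in reps T chi F) f k) * b =
    \sum_(k in reps T chi F) a * f k * b by rewrite mulr_sumr mulr_suml.
have Bsym a b : (a \in B b) = (b \in B a) by rewrite -!repP eq_sym.
(* Expand [q j i * p * q j i' = 0] along row [l]. Terms in the blocks of [i] and [i'] vanish by
   orthogonality. A further nonzero term [k'] outside the block of [k] would make [i], [i'] and [k],
   [k'] two disjoint pairs of isomorphic blocks, against [nS]. Only the term of [k] is left. *)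
have Z i i' k j l : i \in T -> i' \in T -> k \in T -> j \in T -> l \in T ->
    i' \notin B i -> k \notin B i -> k \notin B i' -> l \notin B j ->
    q j i * q l k * q j i' = 0.
  move=> iT i'T kT jT lT ii' ki ki' lj.
  have [->|qlk] := eqVneq (q l k) 0; first by rewrite mulr0 mul0r.
  have : q j i * p * q j i' = 0.
    by rewrite block_sum_mulp // orth // (negPf ii') block_refl.
  rewrite -(block_sum_row1 F M lT) sum3 (bigD1 (rep T chi F k)) ?rep_reps //=.
  rewrite repE // big1 ?addr0 // => k' /andP[k'R k'k]; have k'T := reps_sub k'R.
  have {}k'k : k' \notin B k by rewrite -repP (reps_id k'R).
  have [k'i|k'i] := boolP (k' \in B i).
    by rewrite orth ?mul0r // k'i (negPf lj).
  have [k'i'|k'i'] := boolP (k' \in B i').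
    by rewrite -mulrA orth ?mulr0 // Bsym k'i' Bsym (negPf lj).
  have [->|q1] := eqVneq (q j i) 0; first by rewrite !mul0r.
  have [->|q2] := eqVneq (q l k') 0; first by rewrite mulr0 mul0r.
  have [->|q3] := eqVneq (q j i') 0; first by rewrite mulr0.
  case: nS; apply: (schmidt_two_swaps iT i'T kT k'T) => //.
    exact: isoB_trans (block_sum_iso iT jT q1) (isoB_sym (block_sum_iso i'T jT q3)).
  exact: isoB_trans (block_sum_iso kT lT qlk) (isoB_sym (block_sum_iso k'T lT q2)).
move=> xT yT x'T y'T.
have [xx'|xx'] := boolP (x' \in B x); have [yy'|yy'] := boolP (y' \in B y).
- by rewrite (block_sum_eq M xT yT xx' yy').
- by rewrite !orth // ?xx' ?(negPf yy') // Bsym xx' Bsym (negPf yy').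
- by rewrite !orth // ?yy' ?(negPf xx') // Bsym (negPf xx') Bsym yy'.
(* Both products equal this symmetric one: insert [p] as the sum of row [y] on the right,
   respectively on the left, and discard the other terms by orthogonality and [Z]. *)
transitivity (q y x * q y' x' * q y x).
  rewrite -{1}(block_sum_mulp x'T y'T) mulrA -(block_sum_row1 F M yT).
  rewrite -[LHS]mulr1 sum3.
  rewrite (bigD1 (rep T chi F x)) ?rep_reps //= repE // mulr1 big1 ?addr0 //.
  move=> i' /andP[i'R i'x]; have i'T := reps_sub i'R.
  have {}i'x : i' \notin B x by rewrite -repP (reps_id i'R).
  have [i'x'|i'x'] := boolP (i' \in B x').
    by rewrite mulr1 -mulrA orth ?mulr0 // i'x' Bsym (negPf yy').
  by rewrite mulr1 Z // Bsym.
have -> : q y' x' * q y x = 1 * p * (q y' x' * q y x).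
  by rewrite mul1r mulrA block_sum_pmul.
rewrite -(block_sum_row1 F M yT) sum3.
rewrite (bigD1 (rep T chi F x)) ?rep_reps //= repE // mul1r mulrA big1 ?addr0 //.
move=> i' /andP[i'R i'x]; have i'T := reps_sub i'R.
have {}i'x : i' \notin B x by rewrite -repP (reps_id i'R).
rewrite mul1r mulrA; have [i'x'|i'x'] := boolP (i' \in B x').
  by rewrite orth ?mul0r // Bsym i'x' (negPf yy').
by rewrite Z // Bsym.
Qed.

End Self.
End Blocks.

(** A nonzero [q] between distinct blocks would make them isomorphic, and swapping them would be a
    nontrivial automorphism. So [q] is [p] on the diagonal and 0 off it, and the induction
    hypothesis applies in each block with the same [p]. *)
Theorem splittable_magic_diag T chi : splittable T chi -> asymmetric_in chi T ->
  forall (p : A) u, magic chi T chi T p u ->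
  {in T &, forall y x, u y x = if y == x then p else 0}.
Proof.
elim=> {T chi} [T chi T1|T chi b psi m _ IH|T chi F spl IH] aT p u M y x yT xT.
- have Tx : T = [set x] by apply/esym/eqP; rewrite eqEcard sub1set xT cards1.
  have yx : y = x by apply/eqP; rewrite -in_set1 -Tx.
  by rewrite yx eqxx -(magic_col M xT) Tx big_set1.
- apply: (IH _ _ _ (magic_refine M b psi m)) => // f fI; apply: aT.
  split; [exact: iso_inj fI|exact: iso_img fI|exact: iso_adj fI|].
  by move=> z /(iso_color fI)[].
have q0 a b : a \in T -> b \in T -> b \notin block T chi F a ->
    block_sum chi T u F b a = 0.
  move=> a1 b1 ba; apply/eqP; apply: contraT => /(block_sum_iso M spl a1 b1)[f fI].
  have [g [gI ga _]] := block_swap a1 b1 ba fI.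
  by move: ga; rewrite (aT g gI) // eqxx.
have [yx|yx] := boolP (y \in block T chi F x).
  have qp : block_sum chi T u F x x = p.
    by apply: (block_sum_diag M) => // z zT; apply: q0.
  have := magic_block F M xT xT; rewrite qp => M'.
  by apply: (IH x xT _ _ _ M') => //; [apply: asymmetric_block|apply: block_refl].
rewrite -(block_sum_mul F M xT yT) q0 // mul0r ifN //.
by apply: contraNneq yx => ->; apply: block_refl.
Qed.

Theorem splittable_magic_comm T chi : splittable T chi -> ~ schmidt_in chi T ->
  forall (p : A) u, magic chi T chi T p u ->
  {in T &, forall y x, {in T &, forall y' x',
    u y x * u y' x' = u y' x' * u y x}}.
Proof.
elim=> {T chi} [T chi T1|T chi b psi m _ IH|T chi F spl IH] nS p u M.
- move=> y x yT xT y' x' y'T x'T.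
  have Tx : T = [set x] by apply/esym/eqP; rewrite eqEcard sub1set xT cards1.
  by move: yT y'T x'T; rewrite Tx !inE => /eqP-> /eqP-> /eqP->.
- apply: (IH _ _ _ (magic_refine M b psi m)) => -[f [g [fI gI f1 g1 dis]]].
  have W h : colored_iso (refine_color T chi b psi m) T (refine_color T chi b psi m) T h ->
      colored_iso chi T chi T h.
    move=> hI; split; [exact: iso_inj hI|exact: iso_img hI|exact: iso_adj hI|].
    by move=> z /(iso_color hI)[].
  by apply: nS; exists f, g; split; auto.
pose q := block_sum chi T u F.
have [[i [i' [iT i'T ii' iso]]]|nD] := pselect (exists i i',
    [/\ i \in T, i' \in T, i' \notin block T chi F i
      & colored_isomorphic chi (block T chi F i) chi (block T chi F i')]).
  (* All blocks are now rigid. After identifying the block of [y] with that of [x], the part of [u]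
     between them is diagonal, with [q y x] on the diagonal. *)
  have uE y x : y \in T -> x \in T -> u y x = q y x \/ u y x = 0.
    move=> yT xT; have [q0|q0] := eqVneq (q y x) 0.
      by right; rewrite -(block_sum_mul F M xT yT) -/q q0 mul0r.
    have [f fI] := block_sum_iso M spl xT yT q0.
    have aX := isomorphic_blocks_asymmetric iT i'T xT ii' iso nS.
    have M' := magic_pull (magic_block F M xT yT) fI.
    have [g [gI fK gK]] := iso_inv fI.
    have gB : g y \in block T chi F x by apply: iso_mem gI (block_refl _ _ _ _).
    have := splittable_magic_diag (spl x xT) aX M' gB (block_refl _ _ _ _).
    by rewrite gK ?block_refl // => ->; case: ifP; [left|right].
  move=> y x yT xT y' x' y'T x'T.
  case: (uE y x yT xT) => ->; last by rewrite mul0r mulr0.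
  case: (uE y' x' y'T x'T) => ->; last by rewrite mul0r mulr0.
  exact: (block_sum_comm M spl).
have q0 a b : a \in T -> b \in T -> b \notin block T chi F a -> q b a = 0.
  move=> a1 b1 ba; apply/eqP; apply: contrapT => /negP/(block_sum_iso M spl a1 b1) iso.
  by apply: nD; exists a, b.
have qp x : x \in T -> q x x = p.
  by move=> xT; apply: (block_sum_diag M) => // z zT; apply: q0.
have u0 y x : y \in T -> x \in T -> y \notin block T chi F x -> u y x = 0.
  by move=> yT xT yx; rewrite -(block_sum_mul F M xT yT) -/q q0 ?mul0r.
have Mb x : x \in T -> magic chi (block T chi F x) chi (block T chi F x) p u.
  by move=> xT; have := magic_block F M xT xT; rewrite -/q qp.
move=> y x yT xT y' x' y'T x'T.
have [yx|/u0->//] := boolP (y \in block T chi F x); last by rewrite mul0r mulr0.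
have [yx'|/u0->//] := boolP (y' \in block T chi F x'); last by rewrite mul0r mulr0.
have [xx'|xx'] := boolP (x' \in block T chi F x).
  have nSx : ~ schmidt_in chi (block T chi F x) by move=> /(schmidt_block xT).
  apply: (IH x xT nSx _ _ (Mb x xT)); rewrite ?block_refl //.
  by rewrite -(block_eq xx').
(* On a rigid block the entries are 0 or [p], which acts as a unit. For two different blocks this
   settles commutation, since both having automorphisms would give Schmidt's criterion. *)
have scal a b : a \in T -> asymmetric_in chi (block T chi F a) ->
    b \in block T chi F a -> u b a = p \/ u b a = 0.
  move=> a1 aA ba; rewrite (splittable_magic_diag (spl a a1) aA (Mb a a1)) ?block_refl //.
  by case: ifP; [left|right].
have [aX|nX] := pselect (asymmetric_in chi (block T chi F x)).
  case: (scal _ _ xT aX yx) => ->; last by rewrite mul0r mulr0.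
  by rewrite (magic_mulp M) // (magic_pmul M).
have [aX'|nX'] := pselect (asymmetric_in chi (block T chi F x')).
  case: (scal _ _ x'T aX' yx') => ->; last by rewrite mul0r mulr0.
  by rewrite (magic_mulp M) // (magic_pmul M).
by case: nS; exact: (schmidt_two_blocks xT x'T xx' nX nX').
Qed.

End SelfMagic.

(** * C*-algebras *)

Section Vanishing.
Variable R : realType.
Implicit Types x y : nat -> R.

(** Only an upper bound is asked for, so that the notion is stable under domination; convergence is
    expressed by applying it to distances. *)
Definition vanishing x := forall e : R, 0 < e ->
  exists N : nat, forall n, (N <= n)%N -> x n < e.

Lemma vanishing_le x y : (forall n, x n <= y n) -> vanishing y -> vanishing x.
Proof.
move=> xy yv e e0; have [N yN] := yv e e0; exists N => n /yN.
exact: le_lt_trans.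
Qed.

Lemma vanishingD x y : vanishing x -> vanishing y -> vanishing (fun n => x n + y n).
Proof.
move=> xv yv e e0; have e20 : 0 < e / 2 by rewrite divr_gt0.
have [N xN] := xv _ e20; have [M yM] := yv _ e20.
exists (maxn N M) => n; rewrite geq_max => /andP[/xN xn /yM yn]; lra.
Qed.

Lemma vanishingZ (c : R) x : 0 <= c -> vanishing x -> vanishing (fun n => c * x n).
Proof.
move=> c0 xv e e0; have c1 : 0 < c + 1 by lra.
(* Dividing by [c + 1] rather than [c] includes the case [c = 0]. *)
have [N xN] := xv (e / (c + 1)) (divr_gt0 e0 c1); exists N => n /xN xn.
have [x0|x0] := leP 0 (x n); last by nra.
by apply: le_lt_trans (_ : (c + 1) * x n < e); [nra|rewrite mulrC -ltr_pdivlMr].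
Qed.

Lemma vanishing_const_le0 (c : R) : vanishing (fun _ => c) -> c <= 0.
Proof.
by move=> cv; rewrite leNgt; apply/negP => /cv[N /(_ N (leqnn _))]; rewrite ltxx.
Qed.

Lemma vanishing_expr (a : R) : 0 <= a -> a < 1 -> vanishing (fun n => a ^+ n).
Proof.
move=> a0 a1 e e0.
(* A form of Bernoulli's inequality: the left-hand side decreases with [n], its decrement being a
   product of nonnegative factors. *)
have B n : a ^+ n * (1 + n%:R * (1 - a)) <= 1.
  elim: n => [|n IH]; first by rewrite expr0 mul0r addr0 mulr1.
  apply: le_trans IH; rewrite -subr_ge0 exprS -natr1.
  set m := n%:R; set b := a ^+ n.
  have -> : b * (1 + m * (1 - a)) - a * b * (1 + (m + 1) * (1 - a)) =
            b * ((1 - a) ^+ 2 * (m + 1)) by ring.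
  by rewrite mulr_ge0 ?exprn_ge0 // mulr_ge0 ?sqr_ge0 // addr_ge0.
have d0 : 0 < (1 - a) * e by rewrite mulr_gt0 // subr_gt0.
pose N := Num.bound (((1 - a) * e)^-1).
have HN : ((1 - a) * e)^-1 < N%:R.
  by apply: archi_boundP; rewrite invr_ge0 ltW.
exists N => n Nn; rewrite ltNge; apply/negP => en.
have nN : N%:R <= n%:R :> R by rewrite ler_nat.
have : 1 < n%:R * ((1 - a) * e).
  by rewrite -ltr_pdivrMr // div1r; apply: lt_le_trans HN nN.
move=> H; have := B n; apply/negP; rewrite -ltNge.
apply: lt_le_trans (ler_wpM2r _ en); last by rewrite addr_ge0 // mulr_ge0 // subr_ge0 ltW.
have -> : e * (1 + n%:R * (1 - a)) = e + n%:R * ((1 - a) * e) by ring.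
by apply: lt_trans H _; rewrite ltrDr.
Qed.

Lemma cauchy_real_cvg x : (forall e : R, 0 < e ->
    exists N : nat, forall m n, (N <= m)%N -> (N <= n)%N -> `|x m - x n| < e) ->
  exists l, vanishing (fun n => `|x n - l|).
Proof.
(* [E] collects the eventual lower bounds of the sequence, so its supremum is the lower limit. *)
move=> xC; pose E (r : R) : Prop := exists N, forall n, (N <= n)%N -> r <= x n.
have HE (e : R) : 0 < e -> exists N, forall n, (N <= n)%N ->
    E (x n - e) /\ classical_sets.ubound E (x n + e).
  move=> e0; have [N xN] := xC e e0; exists N => n Nn; split.
    by exists N => m Nm; have := xN n m Nn Nm; rewrite ltr_norml; lra.
  move=> r [M rM]; have := rM (maxn M N) (leq_maxl _ _).
  by have := xN (maxn M N) n (leq_maxr _ _) Nn; rewrite ltr_norml; lra.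
have supE : classical_sets.has_sup E.
  have [N H] := HE 1 ltr01; have [e1 e2] := H N (leqnn _).
  by split; [exists (x N - 1)|exists (x N + 1)].
exists (sup E) => e e0; have e20 : 0 < e / 2 by rewrite divr_gt0.
have [N H] := HE _ e20; exists N => n /H[e1 e2].
have := ub_le_sup (proj2 supE) e1; have := ge_sup (proj1 supE) e2.
by rewrite ltr_norml; lra.
Qed.

End Vanishing.

Section StarAlgebra.
Variables (R : realType) (O : starAlgType R).
Implicit Types a b : O.

Lemma star0 : (0 : O)^s = 0.
Proof. by rewrite -[in LHS](scale0r 0) starZ rmorph0 scale0r. Qed.

Lemma starN a : (- a)^s = - a^s.
Proof. by rewrite -scaleN1r starZ rmorphN rmorph1 scaleN1r. Qed.

Lemma starB a b : (a - b)^s = a^s - b^s.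
Proof. by rewrite starD starN. Qed.

Lemma star1 : (1 : O)^s = 1.
Proof. by rewrite -[LHS]mulr1 -{2}(starK 1) -starM mulr1 starK. Qed.

Lemma starZr (r : R) a : ((r%:C)%C *: a)^s = (r%:C)%C *: a^s.
Proof. by rewrite starZ; congr (_ *: _); apply: conjc_real. Qed.

End StarAlgebra.

(** Without definiteness and completeness, the same facts serve the norm of a C*-algebra, the
    supremum of the norms of representations before completion, and the operator norm on
    matrices. *)
Record cstar_seminorm (R : realType) (O : starAlgType R) := CstarSeminorm {
  snorm :> O -> R;
  snormD : forall a b, snorm (a + b) <= snorm a + snorm b;
  snormZ : forall (c : R[i]) a, snorm (c *: a) = ComplexField.Normc.normc c * snorm a;
  snormM : forall a b, snorm (a * b) <= snorm a * snorm b;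
  snorm_star_mul : forall a, snorm (a^s * a) = snorm a ^+ 2 }.

Definition cnorm_seminorm (R : realType) (A : cstarAlgType R) :=
  CstarSeminorm (@cnormD R A) (@cnormZ R A) (@cnormM R A) (@cnorm_star R A).

Section Seminorm.
Variables (R : realType) (O : starAlgType R) (N : cstar_seminorm O).
Implicit Types a b : O.

Lemma normc_real (r : R) : ComplexField.Normc.normc (r%:C)%C = `|r|.
Proof. by rewrite /= expr0n addr0 sqrtr_sqr. Qed.

Lemma snormZr (r : R) a : N ((r%:C)%C *: a) = `|r| * N a.
Proof. by rewrite snormZ normc_real. Qed.

Lemma snorm0 : N 0 = 0.
Proof. by rewrite -(scale0r 0) -[0]/((0%:C)%C : R[i]) snormZr normr0 mul0r. Qed.

Lemma snormN a : N (- a) = N a.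
Proof.
have -> : - a = ((-1)%:C)%C *: a by rewrite rmorphN rmorph1 scaleN1r.
by rewrite snormZr normrN1 mul1r.
Qed.

Lemma snorm_ge0 a : 0 <= N a.
Proof. have := snormD N a (- a); rewrite subrr snorm0 snormN; lra. Qed.

Lemma snorm_distC a b : N (a - b) = N (b - a).
Proof. by rewrite -snormN opprB. Qed.

Lemma snorm_dist a b : `|N a - N b| <= N (a - b).
Proof.
have := snormD N (a - b) b; have := snormD N (b - a) a.
by rewrite !subrK (snorm_distC b) ler_norml; lra.
Qed.

Lemma snorm_tri b a c : N (a - c) <= N (a - b) + N (b - c).
Proof. by rewrite -[a - c](subrKA b) snormD. Qed.

(** The C*-identity and submultiplicativity give [N b ^+ 2 <= N b^s * N b]; then exchange [b] and
    [b^s]. *)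
Lemma snorm_star a : N a^s = N a.
Proof.
have H b : N b <= N b^s.
  have := snormM N b^s b; rewrite snorm_star_mul => E.
  have := snorm_ge0 b; have := snorm_ge0 b^s; nra.
by apply/le_anti; rewrite H -{2}(starK a) H.
Qed.

Lemma snorm_selfadj a : a^s = a -> N (a * a) = N a ^+ 2.
Proof. by move=> aE; rewrite -{1}aE snorm_star_mul. Qed.

Lemma snorm_sum (I : Type) (r : seq I) (P : pred I) (F : I -> O) :
  N (\sum_(i <- r | P i) F i) <= \sum_(i <- r | P i) N (F i).
Proof.
elim/big_ind2: _ => [|a x b y ax by_|//]; first by rewrite snorm0.
by apply: le_trans (snormD _ _ _) (lerD ax by_).
Qed.

(* [x] is the real part of the normal element [z = x + iy], and
   [x^2 + y^2 = z^* z]. *)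
Lemma snorm_sum_squares x y : x^s = x -> y^s = y -> x * y = y * x ->
  N (x * x) <= N (x * x + y * y).
Proof.
move=> xE yE xy; pose i : R[i] := 'i%C; pose z := x + i *: y.
have i2 : i * i = -1 by apply: (sqr_i R).
have iE : i^* = - i by apply/eqP; rewrite eq_complex /= oppr0 !eqxx.
have zE : z^s = x - i *: y by rewrite starD starZ iE xE yE scaleNr.
have zz : z^s * z = x * x + y * y.
  rewrite zE /z mulrBl !mulrDr -!scalerAl -!scalerAr scalerA i2 scaleN1r xy opprD opprK.
  by rewrite addrA addrK.
rewrite snorm_selfadj // -zz snorm_star_mul.
have : N (x + x) <= N z + N z.
  by rewrite -{2}(snorm_star z) (_ : x + x = z + z^s) ?snormD // zE /z addrACA subrr addr0.
have -> : x + x = (2%:C)%C *: x.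
  by rewrite -[2]/(1 + 1) rmorphD rmorph1 scalerDl !scale1r.
rewrite snormZr ger0_norm //; have := snorm_ge0 x; have := snorm_ge0 z; nra.
Qed.

End Seminorm.

(** * Orthogonality of projections, square roots and contractivity *)

Section CStar.
Variables (R : realType) (A : cstarAlgType R).
Implicit Types a b p h : A.
Local Notation N := (cnorm_seminorm A).
Local Notation "r %:C" := (real_complex R r).

Lemma cnorm0 : cnorm (0 : A) = 0.
Proof. exact: (snorm0 N). Qed.

Lemma cnorm_ge0 a : 0 <= cnorm a.
Proof. exact: (snorm_ge0 N). Qed.

Lemma cnorm_starE a : cnorm a^s = cnorm a.
Proof. exact: (snorm_star N). Qed.

Lemma cnorm_distC a b : cnorm (a - b) = cnorm (b - a).
Proof. exact: (snorm_distC N). Qed.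

Lemma cnorm_tri b a c : cnorm (a - c) <= cnorm (a - b) + cnorm (b - c).
Proof. exact: (snorm_tri N). Qed.

Lemma cnorm_selfadj a : a^s = a -> cnorm (a * a) = cnorm a ^+ 2.
Proof. exact: (snorm_selfadj N). Qed.

Lemma cnorm_sum (I : Type) (r : seq I) (P : pred I) (F : I -> A) :
  cnorm (\sum_(i <- r | P i) F i) <= \sum_(i <- r | P i) cnorm (F i).
Proof. exact: (snorm_sum N). Qed.

Lemma cnormZr (r : R) a : 0 <= r -> cnorm (r%:C *: a) = r * cnorm a.
Proof. by move=> r0; have /= -> := snormZr N r a; rewrite ger0_norm. Qed.

Lemma cnorm1 : cnorm (1 : A) = 1.
Proof.
have := cnorm_selfadj (star1 A); rewrite mulr1 => E.
have : cnorm (1 : A) != 0.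
  by apply/eqP => /cnorm0_eq0/eqP; rewrite oner_eq0.
by move=> n0; apply: (mulfI n0); rewrite mulr1 -expr2 -E.
Qed.

Lemma cnorm_projection p : projection p -> cnorm p <= 1.
Proof.
case=> pE pp; have := cnorm_selfadj pE; rewrite pp /= => E.
have := cnorm_ge0 p => /=; nra.
Qed.

(* The unit [p] of a corner is an extreme point of its unit ball.  With
   [k = h^2] and [s >= 0], [(sp + k)^2 = (sp - k)^2 + (2 sqrt(s) h)^2] gives
   [4 s |k| <= |sp + k|^2]; at [s = |k|] this reads [2 |k| <= | |k| p + k |],
   and convexity turns [|p + k| <= 1] into [|k| = 0]. *)
Lemma projection_extreme p h : projection p -> h^s = h -> p * h = h ->
  h * p = h -> cnorm (p + h) <= 1 -> cnorm (p - h) <= 1 -> h = 0.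
Proof.
move=> [pE pp] hE ph hp n1 n2; pose k := h * h.
have kE : k^s = k by rewrite starM hE.
have pk : p * k = k by rewrite mulrA ph.
have kp : k * p = k by rewrite -mulrA hp.
have hk : h * k = k * h by rewrite /k mulrA.
pose c := cnorm k; have c0 : 0 <= c := cnorm_ge0 k.
have p1 : cnorm p <= 1 by apply: cnorm_projection.
have sZ (r : R) a : cnorm (r%:C *: a) = `|r| * cnorm a := snormZr N r a.
have H (s : R) : 0 <= s -> 4 * s * c <= cnorm (s%:C *: p + k) ^+ 2.
  move=> s0; pose x := s%:C *: p - k; pose y := (2 * Num.sqrt s)%:C *: h.
  have xE : x^s = x by rewrite starB starZr pE kE.
  have yE : y^s = y by rewrite starZr hE.
  have xy : x * y = y * x.
    rewrite /x /y -scalerAr -scalerAl; congr (_ *: _).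
    by rewrite mulrBl mulrBr -scalerAl -scalerAr ph hp hk.
  have yy : y * y = (4 * s)%:C *: k.
    rewrite -scalerAl -scalerAr scalerA -rmorphM; congr (_%:C *: _).
    by rewrite mulrACA -[X in _ * X]expr2 sqr_sqrtr // -natrM.
  pose w := s%:C *: k; have yw : y * y = w + w + (w + w).
    have s4 : (4 * s)%:C = s%:C + s%:C + (s%:C + s%:C) :> R[i].
      by rewrite -!rmorphD; congr (_%:C); ring.
    by rewrite yy s4 !scalerDl.
  have xx : x * x + y * y = (s%:C *: p + k) * (s%:C *: p + k).
    rewrite yw /x mulrBl !mulrBr mulrDl !mulrDr -!scalerAl -!scalerAr pk kp -/w.
    rewrite pp opprB [LHS](AC ((2*2)*(2*2)) ((1*5*(7*3))*((2*6)*(4*8)))) /=.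
    by rewrite !addNr !addr0.
  have := snorm_sum_squares N yE xE (esym xy); rewrite addrC xx yy /= sZ.
  have skE : (s%:C *: p + k)^s = s%:C *: p + k by rewrite starD starZr pE kE.
  have /= -> := cnorm_selfadj skE; rewrite ger0_norm // mulr_ge0 //.
(* The parallelogram identity expresses [p + k] as the mean of the squares of [p + h] and
   [p - h]. *)
have pk1 : cnorm (p + k) <= 1.
  have sq : (p + h) * (p + h) + (p - h) * (p - h) = 2%:C *: (p + k).
    have -> : 2%:C = 1 + 1 :> R[i] by rewrite -[2]/(1 + 1) rmorphD rmorph1.
    rewrite scalerDl !scale1r !mulrDl !mulrDr !mulNr !mulrN pp ph hp opprK.
    rewrite [LHS](AC ((2*2)*(2*2)) ((1*4*(5*8))*((2*6)*(3*7)))) /=.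
    by rewrite !subrr !addr0.
  have := cnormD ((p + h) * (p + h)) ((p - h) * (p - h)); rewrite sq sZ ger0_norm //.
  have := cnormM (p + h) (p + h); have := cnormM (p - h) (p - h).
  have := cnorm_ge0 (p + h); have := cnorm_ge0 (p - h) => /=; nra.
(* The case [s = 1] bounds [c] away from 1, so that the combination with weights [c] and [1 - c]
   below is convex. *)
have c1 : 4 * c <= 1.
  have := H 1 ler01; rewrite scale1r mulr1; have := cnorm_ge0 (p + k) => /=; nra.
have c2 : 2 * c <= cnorm (c%:C *: p + k).
  have := H c c0; have := cnorm_ge0 (c%:C *: p + k) => /=; nra.
have c3 : cnorm (c%:C *: p + k) <= c * cnorm (p + k) + (1 - c) * c.
  have -> : c%:C *: p + k = c%:C *: (p + k) + (1 - c)%:C *: k.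
    by rewrite rmorphB rmorph1 scalerBl scale1r scalerDr -addrA [c%:C *: k + _]addrC subrK.
  apply: le_trans (cnormD _ _) _; rewrite !sZ !ger0_norm //; lra.
(* The bounds combine to [2 * c <= c + (1 - c) * c], that is [c ^+ 2 <= 0]. *)
have c00 : c = 0 by nra.
have := cnorm_selfadj hE; rewrite -/k /= -/c c00 => /esym/eqP.
by rewrite sqrf_eq0 => /eqP/cnorm0_eq0.
Qed.

Lemma projectionC p : projection p -> projection (1 - p).
Proof.
case=> pE pp; split; first by rewrite starB star1 pE.
by rewrite mulrBl mul1r mulrBr mulr1 pp subrr subr0.
Qed.

(** Extremality replaces the theory of positive elements. The compressions [x k] of the other
    projections to the corner of [p i] sum to 0, and each [p i - x k] has norm at most 1. A small
    multiple of [x j] can then be both added to and subtracted from [p i] within the unit ball, so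
    it is 0, and [x j] is the C*-square of [p j * p i]. *)
Lemma sum_projections_orth (I : finType) (p : I -> A) (i j : I) :
  (forall i, projection (p i)) -> \sum_i p i = 1 -> i != j -> p i * p j = 0.
Proof.
move=> pP p1 ij; have [iE ii] := pP i.
pose x k := p i * p k * p i.
have xE k : (x k)^s = x k.
  by have [kE _] := pP k; rewrite /x !starM kE iE mulrA.
have ix k : p i * x k = x k by rewrite /x !mulrA ii.
have xi k : x k * p i = x k by rewrite /x -!mulrA ii.
have nx k : cnorm (p i - x k) <= 1.
  have [kE kk] := projectionC (pP k).
  have -> : p i - x k = ((1 - p k) * p i)^s * ((1 - p k) * p i).
    by rewrite starM kE iE mulrA -(mulrA (p i)) kk /x mulrBr mulrBl mulr1 ii.
  rewrite cnorm_star exprn_ile1 ?cnorm_ge0 //; apply: le_trans (cnormM _ _) _.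
  by rewrite mulr_ile1 ?cnorm_ge0 ?cnorm_projection //; apply: projectionC.
have x0 : \sum_(k | k != i) x k = 0.
  have : p i * (\sum_k p k) * p i = p i by rewrite p1 mulr1 ii.
  rewrite (bigD1 i) //= mulrDr mulrDl !ii -[RHS]addr0 => /addrI.
  by rewrite mulr_sumr mulr_suml.
have ji : j != i by rewrite eq_sym.
pose n := #|[pred k | (k != i) && (k != j)]|.
(* Since the [x k] sum to 0, [x j] is minus the sum of the [n] others. *)
have nP : cnorm ((n%:R)%:C *: p i + x j) <= n%:R.
  have -> : (n%:R)%:C *: p i + x j = \sum_(k | (k != i) && (k != j)) (p i - x k).
    rewrite sumrB sumr_const -/n rmorph_nat scaler_nat; congr (_ + _).
    by apply/eqP; rewrite -addr_eq0; apply/eqP; rewrite -[RHS]x0 [RHS](bigD1 j).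
  apply: le_trans (cnorm_sum _ _ _) _.
  by rewrite /n -sumr_const; apply: ler_sum => k _; apply: nx.
(* With [t = 1 / (n + 1)], both [p i + t x j] and [p i - t x j] are convex combinations of elements
   of norm at most 1. *)
pose t : R := (n.+1%:R)^-1.
have t0 : 0 < t by rewrite invr_gt0.
have tn : t * n%:R + t = 1.
  by rewrite -{2}[t]mulr1 -mulrDr natr1 mulVf // pnatr_eq0.
have ip := cnorm_projection (pP i).
clearbody t.
have n0 : 0 <= n%:R :> R by [].
have tx : t%:C *: x j = 0.
  apply: (projection_extreme (pP i)).
  - by rewrite starZr xE.
  - by rewrite -scalerAr ix.
  - by rewrite -scalerAl xi.
  - have -> : p i + t%:C *: x j = t%:C *: ((n%:R)%:C *: p i + x j) + t%:C *: p i.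
      rewrite scalerDr scalerA -rmorphM addrAC -scalerDl -rmorphD tn.
      by rewrite rmorph1 scale1r.
    apply: le_trans (cnormD _ _) _; rewrite !cnormZr ?(ltW t0) //.
    have := ler_wpM2l (ltW t0) nP; have := ler_wpM2l (ltW t0) ip; lra.
  - have -> : p i - t%:C *: x j = t%:C *: (p i - x j) + (1 - t)%:C *: p i.
      by rewrite scalerBr rmorphB rmorph1 scalerBl scale1r [RHS]addrC addrA subrK.
    have t1 : 0 <= 1 - t by have := mulr_ge0 (ltW t0) n0; lra.
    apply: le_trans (cnormD _ _) _; rewrite !cnormZr ?(ltW t0) //.
    have := ler_wpM2l (ltW t0) (nx j); have := ler_wpM2l t1 ip; lra.
have xj : x j = 0.
  by move: tx => /(congr1 (fun z => (t^-1)%:C *: z)); rewrite scalerA -rmorphM mulVf ?gt_eqF // scale1r scaler0.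
have [jE jj] := pP j.
have : cnorm (p j * p i) ^+ 2 = 0.
  by rewrite -cnorm_star starM iE jE mulrA -(mulrA (p i)) jj -/(x j) xj cnorm0.
move/eqP; rewrite sqrf_eq0 => /eqP/cnorm0_eq0 H.
by rewrite -[LHS]starK starM iE jE H star0.
Qed.

(** The square root of [1 - a * a], without functional calculus: the iteration converges to a
    solution of [l + l = a * a + l * l], and [c = 1 - l]. All iterates are self-adjoint and commute
    with [a], and these properties pass to the limit. *)
Lemma selfadj_contraction_sqrt a : a^s = a -> cnorm a < 1 ->
  exists c, [/\ c^s = c, a * c = c * a & a * a + c * c = 1].
Proof.
move=> aE a1; pose al := cnorm a ^+ 2.
have a0 := cnorm_ge0 a; rewrite /= in a0.
have al0 : 0 <= al by rewrite sqr_ge0.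
have al1 : al < 1 by rewrite /al; nra.
pose half : R := 2^-1.
have h0 : 0 <= half by rewrite invr_ge0.
pose y n := iter n (fun y : A => half%:C *: (a * a + y * y)) 0.
have naa : cnorm (a * a) = al by apply: (cnorm_selfadj).
have yE n : (y n)^s = y n.
  by elim: n => [|n IH]; rewrite /= ?star0 // starZr starD !starM aE IH.
have ay n : a * y n = y n * a.
  elim: n => [|n IH]; first by rewrite mulr0 mul0r.
  by rewrite /= -scalerAr -scalerAl mulrDr mulrDl !mulrA IH -!mulrA IH.
have yy m n : y m * y n = y n * y m.
  elim: m => [|m IH]; first by rewrite mulr0 mul0r.
  rewrite /= -scalerAr -scalerAl mulrDr mulrDl; congr (_ *: (_ + _)).
    by rewrite -mulrA ay mulrA ay mulrA.
  by rewrite -mulrA IH mulrA IH mulrA.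
have yn n : cnorm (y n) <= al.
  elim: n => [|n IH]; first by rewrite cnorm0.
  rewrite /= cnormZr //; have := cnormD (a * a) (y n * y n).
  have := cnormM (y n) (y n); rewrite naa; have := cnorm_ge0 (y n).
  by rewrite /half /=; nra.
(* A difference of squares of commuting iterates factors through their sum, of norm at most
   [2 * al]; the factor [half] turns this into contraction by [al < 1]. *)
have yd k n : cnorm (y (n + k)%N - y n) <= al ^+ n * al.
  elim: n => [|n IH]; first by rewrite add0n subr0 expr0 mul1r.
  have -> : y (n.+1 + k)%N - y n.+1 = half%:C *: ((y (n + k)%N - y n) * (y (n + k)%N + y n)).
    rewrite addSn /= -scalerBr; congr (_ *: _).
    by rewrite mulrBl !mulrDr [y n * y (n + k)%N]yy addrKA opprD addrACA subrr add0r.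
  rewrite cnormZr // exprS.
  have := cnormM (y (n + k)%N - y n) (y (n + k)%N + y n).
  have := cnormD (y (n + k)%N) (y n); have := yn n; have := yn (n + k)%N.
  have := cnorm_ge0 (y (n + k)%N - y n); have := cnorm_ge0 (y (n + k)%N + y n) => /=.
  have := exprn_ge0 n al0; set b := al ^+ n in IH *.
  set c1 := cnorm (_ - _) in IH *; set c2 := cnorm (_ + _); set c3 := cnorm (_ * _).
  move=> b0 c20 c10 H1 H2 H3 H4.
  have H5 : c2 <= 2 * al by lra.
  have H6 : c3 <= b * al * (2 * al).
    by apply: le_trans H4 _; apply: ler_pM.
  have : half * c3 <= half * (b * al * (2 * al)) by rewrite ler_wpM2l.
  by rewrite /half; lra.
have yC : forall e : R, 0 < e -> exists M : nat, forall m n : nat,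
    (M <= m)%N -> (M <= n)%N -> cnorm (y m - y n) < e.
  have v : vanishing (fun n => al * al ^+ n) by apply: vanishingZ => //; apply: vanishing_expr.
  move=> e e0; have e20 : 0 < e / 2 by rewrite divr_gt0.
  have [M HM] := v _ e20; exists M => m n Mm Mn.
  have D q : (M <= q)%N -> cnorm (y q - y M) < e / 2.
    move=> Mq; rewrite -(subnKC Mq); apply: le_lt_trans (yd _ _) _.
    by rewrite mulrC; apply: HM.
  apply: le_lt_trans (cnorm_tri (y M) _ _) _; rewrite (cnorm_distC (y M)) /=.
  have := D m Mm; have := D n Mn; lra.
have [l lP] := cnorm_complete _ yC.
have lv : vanishing (fun n => cnorm (y n - l)) := lP.
have lim0 b x : vanishing x -> (forall n, cnorm b <= x n) -> b = 0.
  move=> xv bx; apply: cnorm0_eq0; apply/le_anti; rewrite cnorm_ge0 andbT.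
  by apply: vanishing_const_le0; apply: vanishing_le bx xv.
have lE : l^s = l.
  apply/eqP; rewrite -subr_eq0; apply/eqP; apply: lim0 (vanishingD lv lv) _ => n.
  apply: le_trans (cnorm_tri (y n) _ _) _; rewrite -{1}(yE n) -starB.
  by rewrite cnorm_starE (cnorm_distC l).
have al_ : a * l = l * a.
  apply/eqP; rewrite -subr_eq0; apply/eqP.
  apply: lim0 (vanishingZ (addr_ge0 a0 a0) lv) _ => n.
  apply: le_trans (cnorm_tri (a * y n) _ _) _; rewrite {2}ay -mulrBr -mulrBl.
  have := cnormM a (l - y n); have := cnormM (y n - l) a.
  by rewrite (cnorm_distC l); lra.
have ll : l + l = a * a + l * l.
  apply/eqP; rewrite -subr_eq0; apply/eqP.
  have lv1 : vanishing (fun n => cnorm (y n.+1 - l)).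
    by move=> e /lv[M HM]; exists M => n Mn; apply: HM; apply: leqW.
  have K0 : 0 <= al + cnorm l by rewrite addr_ge0 ?cnorm_ge0.
  apply: lim0 (vanishingD (vanishingD lv1 lv1) (vanishingZ K0 lv)) _ => n.
  have -> : l + l - (a * a + l * l) = (l - y n.+1) + (l - y n.+1) +
      ((y n - l) * y n + l * (y n - l)).
    have y2 : y n.+1 + y n.+1 = a * a + y n * y n.
      rewrite /= -scalerDl -rmorphD (_ : half + half = 1) ?rmorph1 ?scale1r //.
      by rewrite /half; lra.
    rewrite mulrBl mulrBr [X in _ = _ + X]addrA subrK [X in _ = X + _]addrACA.
    by rewrite -(opprD (y n.+1)) y2 -[RHS]addrA; congr (_ + _); rewrite !opprD -addrA addKr.
  apply: le_trans (cnormD _ _) _; apply: lerD.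
    by apply: le_trans (cnormD _ _) _; rewrite !(cnorm_distC l).
  apply: le_trans (cnormD _ _) _; rewrite [leRHS]mulrDl; apply: lerD.
    by apply: le_trans (cnormM _ _) _; rewrite mulrC ler_wpM2r ?cnorm_ge0.
  exact: cnormM.
exists (1 - l); split.
- by rewrite starB star1 lE.
- by rewrite mulrBr mulrBl mulr1 mul1r al_.
- rewrite mulrBl !mulrBr !mul1r mulr1 opprB.
  transitivity (1 + (a * a + l * l) - (l + l)); last by rewrite -ll addrK.
  by rewrite opprD [LHS](AC (1*(2*2)) ((2*(1*4))*(3*5))) /=.
Qed.

End CStar.

(** For a self-adjoint [c] of norm below 1, complete [c * c] to 1 by a square [d * d]. The image
    then satisfies the same equation, and a square is bounded by the norm of a sum of commuting
    squares, here 1. The C*-identity reduces the general case to this one. *)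
Lemma star_morphism_contractive (R : realType) (A B : cstarAlgType R)
    (f : {lrmorphism A -> B}) a : star_preserving f -> cnorm (f a) <= cnorm a.
Proof.
move=> fs.
have sa b : b^s = b -> cnorm (f b) <= cnorm b.
  (* Dividing by a number slightly larger than the norm gives the strict contraction required by the
     square root, including for [b = 0]. *)
  move=> bE; apply/ler_addgt0Pr => e e0; pose r := cnorm b + e.
  have r0 : 0 < r by rewrite /r; have := cnorm_ge0 b; lra.
  pose c := (r^-1%:C)%C *: b.
  have cE : c^s = c by rewrite starZr bE.
  have c1 : cnorm c < 1.
    rewrite cnormZr ?invr_ge0 ?(ltW r0) // mulrC ltr_pdivrMr // mul1r /r; lra.
  have [d [dE cd cd1]] := selfadj_contraction_sqrt cE c1.
  have fcE : (f c)^s = f c by rewrite -fs cE.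
  have fdE : (f d)^s = f d by rewrite -fs dE.
  have := snorm_sum_squares (cnorm_seminorm B) fcE fdE.
  rewrite -!rmorphM cd -rmorphD cd1 rmorph1 /= cnorm1 => /(_ erefl).
  rewrite rmorphM cnorm_selfadj // => H.
  have fc1 : cnorm (f c) <= 1 by have := cnorm_ge0 (f c); nra.
  have -> : f b = (r%:C)%C *: f c.
    by rewrite -linearZ scalerA -rmorphM mulfV ?gt_eqF // scale1r.
  rewrite cnormZr ?(ltW r0) //; apply: (@le_trans _ _ r) => //.
  by rewrite ler_piMr // ltW.
have := sa (a^s * a); rewrite starM starK => /(_ erefl).
have -> : f (a^s * a) = (f a)^s * f a by rewrite rmorphM; congr (_ * _); apply: fs.
rewrite !cnorm_star.
have := cnorm_ge0 (f a); have := cnorm_ge0 a; nra.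
Qed.

(** * Completion of a C*-seminorm *)

Lemma vanishing_bounded (R : realType) (x : nat -> R) : vanishing x ->
  exists2 K, 0 <= K & forall n, x n <= K.
Proof.
move=> /(_ 1 ltr01)[M HM]; exists (\sum_(i < M) `|x i| + 1).
  by rewrite addr_ge0 // sumr_ge0.
move=> n; have [Mn|nM] := leqP M n.
  apply: le_trans (ltW (HM n Mn)) _; by rewrite lerDr sumr_ge0.
apply: le_trans (ler_norm _) _; rewrite (bigD1 (Ordinal nM)) //= -addrA lerDl.
by rewrite addr_ge0 // sumr_ge0.
Qed.

Lemma vanishing_inv (R : realType) : vanishing (fun n => n.+1%:R^-1 : R).
Proof.
move=> e e0; exists (Num.bound e^-1) => n Mn.
rewrite invf_plt ?posrE //; have := @archi_boundP _ e^-1; rewrite invr_ge0 (ltW e0).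
move=> /(_ isT) H; apply: lt_le_trans H _; rewrite ler_nat; exact: leqW.
Qed.

Lemma normc_ge0 (R : realType) (k : R[i]) : 0 <= ComplexField.Normc.normc k.
Proof. by case: k => a b; rewrite /= sqrtr_ge0. Qed.

Section Completion.
Local Open Scope quotient_scope.
Variables (R : realType) (O : starAlgType R) (N : cstar_seminorm O).

(* Carrying a modulus of convergence, rather than the usual quantifiers, reduces
   the closure properties below to arithmetic on the moduli. *)
Definition cauchy (u : nat -> O) := exists2 x : nat -> R,
  vanishing x & forall m n, N (u m - u n) <= x m + x n.

Record cseq := CSeq { cval :> nat -> O; cvalP : cauchy cval }.

HB.instance Definition _ := gen_eqMixin cseq.
HB.instance Definition _ := gen_choiceMixin cseq.

Lemma cauchy_bounded u : cauchy u -> exists2 K, 0 <= K & forall n, N (u n) <= K.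
Proof.
case=> x xv xu; have [K K0 xK] := vanishing_bounded xv.
exists (N (u 0) + (K + K)); first by rewrite !addr_ge0 // snorm_ge0.
move=> n; have := snormD N (u 0) (u n - u 0); rewrite addrC subrK.
have := xu n 0; have := xK n; have := xK 0; lra.
Qed.

Lemma snorm_mulB (a b a' b' : O) :
  N (a * b - a' * b') <= N (a - a') * N b + N a' * N (b - b').
Proof.
have -> : a * b - a' * b' = (a - a') * b + a' * (b - b').
  by rewrite mulrBl mulrBr addrA subrK.
by apply: le_trans (snormD _ _ _) _; apply: lerD; apply: snormM.
Qed.

Fact cconst_cauchy a : cauchy (fun _ => a).
Proof.
exists (fun _ => 0); first by move=> e e0; exists 0%N.
by move=> _ _; rewrite subrr snorm0 addr0.
Qed.

Fact cadd_cauchy (u v : cseq) : cauchy (fun n => u n + v n).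
Proof.
have [[x xv xu] [y yv yu]] := (cvalP u, cvalP v).
exists (fun n => x n + y n); first exact: vanishingD.
move=> m n; rewrite opprD addrACA [leRHS]addrACA.
exact: le_trans (snormD _ _ _) (lerD (xu m n) (yu m n)).
Qed.

Fact cscale_cauchy k (u : cseq) : cauchy (fun n => k *: u n).
Proof.
have [x xv xu] := cvalP u; pose c := ComplexField.Normc.normc k.
have c0 : 0 <= c by apply: normc_ge0.
exists (fun n => c * x n); first exact: vanishingZ.
by move=> m n; rewrite -scalerBr snormZ -mulrDr ler_wpM2l.
Qed.

Fact cstar_cauchy (u : cseq) : cauchy (fun n => (u n)^s).
Proof.
have [x xv xu] := cvalP u; exists x => // m n.
by rewrite -starB snorm_star.
Qed.

Fact cmul_cauchy (u v : cseq) : cauchy (fun n => u n * v n).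
Proof.
have [[x xv xu] [y yv yu]] := (cvalP u, cvalP v).
have [K K0 uK] := cauchy_bounded (cvalP u).
have [L L0 vL] := cauchy_bounded (cvalP v).
exists (fun n => L * x n + K * y n); first by apply: vanishingD; apply: vanishingZ.
move=> m n; apply: le_trans (snorm_mulB _ _ _ _) _.
have -> : L * x m + K * y m + (L * x n + K * y n) =
  (x m + x n) * L + K * (y m + y n) by ring.
by apply: lerD; apply: ler_pM; rewrite ?snorm_ge0.
Qed.

Definition cconst a := CSeq (cconst_cauchy a).
Definition cadd u v := CSeq (cadd_cauchy u v).
Definition cscale k u := CSeq (cscale_cauchy k u).
Definition cstar u := CSeq (cstar_cauchy u).
Definition cmul u v := CSeq (cmul_cauchy u v).

Definition ceq (u v : cseq) : Prop := vanishing (fun n => N (u n - v n)).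

Lemma ceq_ext (u v : cseq) : (forall n, u n = v n) -> ceq u v.
Proof. by move=> uv e e0; exists 0%N => n _; rewrite uv subrr snorm0. Qed.

Lemma ceq_sym u v : ceq u v -> ceq v u.
Proof. by apply: vanishing_le => n; rewrite snorm_distC. Qed.

Lemma ceq_trans v u w : ceq u v -> ceq v w -> ceq u w.
Proof.
by move=> uv vw; apply: vanishing_le (vanishingD uv vw) => n; apply: snorm_tri.
Qed.

Lemma ceq_add u u' v v' : ceq u u' -> ceq v v' -> ceq (cadd u v) (cadd u' v').
Proof.
move=> uu vv; apply: vanishing_le (vanishingD uu vv) => n /=.
by rewrite opprD addrACA snormD.
Qed.

Lemma ceq_scale k u u' : ceq u u' -> ceq (cscale k u) (cscale k u').
Proof.
move=> uu; apply: vanishing_le (vanishingZ (normc_ge0 k) uu) => n /=.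
by rewrite -scalerBr snormZ.
Qed.

Lemma ceq_star u u' : ceq u u' -> ceq (cstar u) (cstar u').
Proof. by apply: vanishing_le => n /=; rewrite -starB snorm_star. Qed.

Lemma ceq_mul u u' v v' : ceq u u' -> ceq v v' -> ceq (cmul u v) (cmul u' v').
Proof.
move=> uu vv.
have [K K0 uK] := cauchy_bounded (cvalP u').
have [L L0 vL] := cauchy_bounded (cvalP v).
apply: vanishing_le (vanishingD (vanishingZ L0 uu) (vanishingZ K0 vv)) => n /=.
apply: le_trans (snorm_mulB _ _ _ _) _; rewrite [L * _]mulrC.
by apply: lerD; apply: ler_pM; rewrite ?snorm_ge0.
Qed.

Lemma clim_exists (u : cseq) : exists l, vanishing (fun n => `|N (u n) - l|).
Proof.
have [x xv xu] := cvalP u; apply: cauchy_real_cvg => e e0.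
have e20 : 0 < e / 2 by rewrite divr_gt0.
have [M HM] := xv _ e20; exists M => m n Mm Mn.
have := snorm_dist N (u m) (u n); have := xu m n; have := HM m Mm; have := HM n Mn.
lra.
Qed.

Definition clim u : R := sval (cid (clim_exists u)).

Lemma climP (u : cseq) : vanishing (fun n => `|N (u n) - clim u|).
Proof. exact: svalP (cid (clim_exists u)). Qed.

Lemma clim_unique (u : cseq) l : vanishing (fun n => `|N (u n) - l|) -> clim u = l.
Proof.
move=> ul; apply/eqP; rewrite -subr_eq0 -normr_le0; apply: vanishing_const_le0.
apply: vanishing_le (vanishingD (climP u) ul) => n.
by have := ler_distD (N (u n)) (clim u) l; rewrite [`|clim u - N _|]distrC.
Qed.

Lemma clim_ge0 u : 0 <= clim u.
Proof.
rewrite -oppr_le0; apply: vanishing_const_le0; apply: vanishing_le (climP u) => n.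
have := snorm_ge0 N (u n); have := ler_norm (N (u n) - clim u); lra.
Qed.

Lemma clim_le (u : cseq) y c : vanishing y -> (forall n, N (u n) <= y n + c) ->
  clim u <= c.
Proof.
move=> yv uy; rewrite -subr_le0; apply: vanishing_const_le0.
apply: vanishing_le (vanishingD yv (climP u)) => n.
have := uy n; have := ler_norm (clim u - N (u n)); rewrite distrC; lra.
Qed.

Lemma clim_add (u v : cseq) : clim (cadd u v) <= clim u + clim v.
Proof.
apply: (clim_le (vanishingD (climP u) (climP v))) => n /=.
have := snormD N (u n) (v n).
have := ler_norm (N (u n) - clim u); have := ler_norm (N (v n) - clim v); lra.
Qed.

Lemma clim_scale k u : clim (cscale k u) = ComplexField.Normc.normc k * clim u.
Proof.
apply: clim_unique; apply: vanishing_le (vanishingZ (normc_ge0 k) (climP u)) => n /=.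
by rewrite snormZ -mulrBr normrM ger0_norm ?normc_ge0.
Qed.

Lemma clim_mul u v : clim (cmul u v) <= clim u * clim v.
Proof.
have [K K0 uK] := cauchy_bounded (cvalP u).
apply: (clim_le (vanishingD (vanishingZ K0 (climP v))
  (vanishingZ (clim_ge0 v) (climP u)))) => n /=.
have := snormM N (u n) (v n).
have := ler_norm (N (u n) - clim u); have := ler_norm (N (v n) - clim v).
have := clim_ge0 v; have := uK n; have := snorm_ge0 N (u n).
set a := N (u n); set b := N (v n); set l := clim u; set l' := clim v.
move=> a0 aK l0 h1 h2 h3.
have : a * (b - l') <= K * `|b - l'|.
  by apply: le_trans (ler_wpM2l a0 h1) _; rewrite ler_wpM2r.
have : l' * (a - l) <= l' * `|a - l| by rewrite ler_wpM2l.
lra.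
Qed.

Lemma clim_star_mul u : clim (cmul (cstar u) u) = clim u ^+ 2.
Proof.
have [K K0 uK] := cauchy_bounded (cvalP u).
apply: clim_unique.
apply: vanishing_le (vanishingZ (addr_ge0 K0 (clim_ge0 u)) (climP u)) => n /=.
rewrite snorm_star_mul subr_sqr normrM mulrC ler_wpM2r //.
by rewrite ger0_norm ?addr_ge0 ?snorm_ge0 ?clim_ge0 // lerD2r.
Qed.

Lemma clim_eq0 u : clim u = 0 -> ceq u (cconst 0).
Proof.
move=> u0; have := climP u; rewrite u0; apply: vanishing_le => n /=.
by rewrite !subr0 ler_norm.
Qed.

Definition ceqb (u v : cseq) : bool := `[< ceq u v >].

Lemma ceqb_refl : reflexive ceqb.
Proof. by move=> u; apply/asboolP; apply: ceq_ext. Qed.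

Lemma ceqb_sym : symmetric ceqb.
Proof. by move=> u v; apply/asboolP/asboolP; apply: ceq_sym. Qed.

Lemma ceqb_trans : transitive ceqb.
Proof.
by move=> v u w /asboolP uv /asboolP vw; apply/asboolP; apply: ceq_trans uv vw.
Qed.

Canonical ceqb_equiv := EquivRel ceqb ceqb_refl ceqb_sym ceqb_trans.

(** The normalisation is an argument of the type because the ring structure declared on the quotient
    needs its unit to be nonzero. *)
Definition completion of N 1 = 1 : Type := {eq_quot ceqb_equiv}.

Variable N1 : N 1 = 1.
Notation Q := (completion N1).

HB.instance Definition _ := Choice.on Q.
HB.instance Definition _ := EqQuotient.on Q.

Definition cls (u : cseq) : Q := \pi_Q u.

Lemma clsP u v : cls u = cls v <-> ceq u v.
Proof.
split=> [/eqmodP/asboolP //|uv].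
by apply/eqmodP; apply/asboolP.
Qed.

Lemma cls_ind (P : Q -> Prop) : (forall u, P (cls u)) -> forall a, P a.
Proof. by move=> PT; elim/quotW. Qed.

Definition qadd (a b : Q) : Q := cls (cadd (repr a) (repr b)).
Definition qmul (a b : Q) : Q := cls (cmul (repr a) (repr b)).
Definition qscale k (a : Q) : Q := cls (cscale k (repr a)).
Definition qstar (a : Q) : Q := cls (cstar (repr a)).
Definition qnorm (a : Q) : R := clim (repr a).

Lemma repr_cls u : ceq (repr (cls u)) u.
Proof. by apply/clsP; rewrite /cls reprK. Qed.

Lemma qaddE u v : qadd (cls u) (cls v) = cls (cadd u v).
Proof. by apply/clsP/ceq_add; apply: repr_cls. Qed.

Lemma qmulE u v : qmul (cls u) (cls v) = cls (cmul u v).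
Proof. by apply/clsP/ceq_mul; apply: repr_cls. Qed.

Lemma qscaleE k u : qscale k (cls u) = cls (cscale k u).
Proof. by apply/clsP/ceq_scale; apply: repr_cls. Qed.

Lemma qstarE u : qstar (cls u) = cls (cstar u).
Proof. by apply/clsP/ceq_star; apply: repr_cls. Qed.

Lemma qnormE u : qnorm (cls u) = clim u.
Proof.
apply: clim_unique; have := repr_cls u => ru.
apply: vanishing_le (vanishingD ru (climP u)) => n.
apply: le_trans (ler_distD (N (u n)) _ _) _; rewrite lerD2r; exact: snorm_dist.
Qed.

Fact qaddA : associative qadd.
Proof.
elim/cls_ind=> a; elim/cls_ind=> b; elim/cls_ind=> c.
by rewrite !qaddE; apply/clsP/ceq_ext => n /=; rewrite addrA.
Qed.

Fact qaddC : commutative qadd.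
Proof.
elim/cls_ind=> a; elim/cls_ind=> b.
by rewrite !qaddE; apply/clsP/ceq_ext => n /=; rewrite addrC.
Qed.

Fact qadd0 : left_id (cls (cconst 0)) qadd.
Proof.
by elim/cls_ind=> a; rewrite qaddE; apply/clsP/ceq_ext => n /=; rewrite add0r.
Qed.

Fact qaddN : left_inverse (cls (cconst 0)) (qscale (-1)) qadd.
Proof.
elim/cls_ind=> a; rewrite qscaleE qaddE; apply/clsP/ceq_ext => n /=.
by rewrite scaleN1r addNr.
Qed.

HB.instance Definition _ := GRing.isZmodule.Build Q qaddA qaddC qadd0 qaddN.

Lemma clsD u v : cls u + cls v = cls (cadd u v).
Proof. exact: qaddE. Qed.

Fact qmulA : associative qmul.
Proof.
elim/cls_ind=> a; elim/cls_ind=> b; elim/cls_ind=> c.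
by rewrite !qmulE; apply/clsP/ceq_ext => n /=; rewrite mulrA.
Qed.

Fact qmul1l : left_id (cls (cconst 1)) qmul.
Proof.
by elim/cls_ind=> a; rewrite qmulE; apply/clsP/ceq_ext => n /=; rewrite mul1r.
Qed.

Fact qmul1r : right_id (cls (cconst 1)) qmul.
Proof.
by elim/cls_ind=> a; rewrite qmulE; apply/clsP/ceq_ext => n /=; rewrite mulr1.
Qed.

Fact qmulDl : left_distributive qmul +%R.
Proof.
elim/cls_ind=> a; elim/cls_ind=> b; elim/cls_ind=> c.
by rewrite clsD !qmulE clsD; apply/clsP/ceq_ext => n /=; rewrite mulrDl.
Qed.

Fact qmulDr : right_distributive qmul +%R.
Proof.
elim/cls_ind=> a; elim/cls_ind=> b; elim/cls_ind=> c.
by rewrite clsD !qmulE clsD; apply/clsP/ceq_ext => n /=; rewrite mulrDr.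
Qed.

Fact qone_neq0 : cls (cconst 1) != 0.
Proof.
apply/eqP => /clsP v; have := @vanishing_const_le0 _ (N (1 - 0)) v.
by rewrite subr0 N1 ler10.
Qed.

HB.instance Definition _ := GRing.Zmodule_isNzRing.Build Q
  qmulA qmul1l qmul1r qmulDl qmulDr qone_neq0.

Lemma clsM u v : cls u * cls v = cls (cmul u v).
Proof. exact: qmulE. Qed.

Fact qscaleA k l a : qscale k (qscale l a) = qscale (k * l) a.
Proof.
elim/cls_ind: a => a.
by rewrite !qscaleE; apply/clsP/ceq_ext => n /=; rewrite scalerA.
Qed.

Fact qscale1 : left_id 1 qscale.
Proof.
by elim/cls_ind=> a; rewrite qscaleE; apply/clsP/ceq_ext => n /=; rewrite scale1r.
Qed.

Fact qscaleDr : right_distributive qscale +%R.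
Proof.
move=> k; elim/cls_ind=> a; elim/cls_ind=> b.
by rewrite clsD !qscaleE clsD; apply/clsP/ceq_ext => n /=; rewrite scalerDr.
Qed.

Fact qscaleDl a : {morph qscale^~ a : k l / k + l}.
Proof.
move=> k l; elim/cls_ind: a => a.
by rewrite !qscaleE clsD; apply/clsP/ceq_ext => n /=; rewrite scalerDl.
Qed.

HB.instance Definition _ := GRing.Zmodule_isLmodule.Build R[i] Q
  qscaleA qscale1 qscaleDr qscaleDl.

Lemma clsZ k u : k *: cls u = cls (cscale k u).
Proof. exact: qscaleE. Qed.

Fact qscaleAl (k : R[i]) (a b : Q) : k *: (a * b) = (k *: a) * b.
Proof.
elim/cls_ind: a => a; elim/cls_ind: b => b.
by rewrite clsM !clsZ clsM; apply/clsP/ceq_ext => n /=; rewrite scalerAl.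
Qed.

HB.instance Definition _ := GRing.Lmodule_isLalgebra.Build R[i] Q qscaleAl.

Fact qscaleAr (k : R[i]) (a b : Q) : k *: (a * b) = a * (k *: b).
Proof.
elim/cls_ind: a => a; elim/cls_ind: b => b.
by rewrite clsM !clsZ clsM; apply/clsP/ceq_ext => n /=; rewrite scalerAr.
Qed.

HB.instance Definition _ := GRing.Lalgebra_isAlgebra.Build R[i] Q qscaleAr.

Fact qstarK a : qstar (qstar a) = a.
Proof.
by elim/cls_ind: a => a; rewrite !qstarE; apply/clsP/ceq_ext => n /=; rewrite starK.
Qed.

Fact qstarD (a b : Q) : qstar (a + b) = qstar a + qstar b.
Proof.
elim/cls_ind: a => a; elim/cls_ind: b => b.
by rewrite clsD !qstarE clsD; apply/clsP/ceq_ext => n /=; rewrite starD.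
Qed.

Fact qstarZ (k : R[i]) (a : Q) : qstar (k *: a) = k^* *: qstar a.
Proof.
elim/cls_ind: a => a.
by rewrite clsZ !qstarE clsZ; apply/clsP/ceq_ext => n /=; rewrite starZ.
Qed.

Fact qstarM (a b : Q) : qstar (a * b) = qstar b * qstar a.
Proof.
elim/cls_ind: a => a; elim/cls_ind: b => b.
by rewrite clsM !qstarE clsM; apply/clsP/ceq_ext => n /=; rewrite starM.
Qed.

HB.instance Definition _ := @isStarAlgebra.Build R Q
  qstar qstarK qstarD qstarZ qstarM.

Lemma cls_star u : (cls u)^s = cls (cstar u).
Proof. exact: qstarE. Qed.

Fact qnormD (a b : Q) : qnorm (a + b) <= qnorm a + qnorm b.
Proof.
elim/cls_ind: a => a; elim/cls_ind: b => b.
by rewrite clsD !qnormE clim_add.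
Qed.

Fact qnormZ (c : R[i]) (a : Q) :
  qnorm (c *: a) = ComplexField.Normc.normc c * qnorm a.
Proof. by elim/cls_ind: a => a; rewrite clsZ !qnormE clim_scale. Qed.

Fact qnorm0_eq0 (a : Q) : qnorm a = 0 -> a = 0.
Proof. by elim/cls_ind: a => a; rewrite qnormE => /clim_eq0/clsP. Qed.

Fact qnormM (a b : Q) : qnorm (a * b) <= qnorm a * qnorm b.
Proof.
elim/cls_ind: a => a; elim/cls_ind: b => b.
by rewrite clsM !qnormE clim_mul.
Qed.

Fact qnorm_star (a : Q) : qnorm (star a * a) = qnorm a ^+ 2.
Proof. by elim/cls_ind: a => a; rewrite cls_star clsM !qnormE clim_star_mul. Qed.

Definition qnorm_seminorm := CstarSeminorm qnormD qnormZ qnormM qnorm_star.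

Lemma clsB u v : cls u - cls v = cls (cadd u (cscale (-1) v)).
Proof. by rewrite -scaleN1r clsZ clsD. Qed.

Lemma qnorm_const a : qnorm (cls (cconst a)) = N a.
Proof.
rewrite qnormE; apply: clim_unique => e e0; exists 0%N => n _.
by rewrite /= subrr normr0.
Qed.

Lemma qnorm_tail (u : cseq) x : vanishing x ->
  (forall m n, N (u m - u n) <= x m + x n) ->
  forall n, qnorm (cls u - cls (cconst (u n))) <= x n.
Proof.
move=> xv xu n; rewrite clsB qnormE; apply: (clim_le xv) => m /=.
by rewrite scaleN1r; apply: xu.
Qed.

Lemma qnorm_dense (a : Q) (e : R) : 0 < e ->
  exists o, qnorm (a - cls (cconst o)) < e.
Proof.
elim/cls_ind: a => u e0; have [x xv xu] := cvalP u.
have [M HM] := xv e e0; exists (u M).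
exact: le_lt_trans (qnorm_tail xv xu M) (HM M (leqnn _)).
Qed.

(** A diagonal argument: a tail element [u (k n)] is approximated by a constant [o n], and the
    sequence [o] is itself Cauchy, hence represents the limit. *)
Fact qnorm_complete (u : nat -> Q) :
  (forall e : R, 0 < e -> exists M : nat, forall m n : nat,
     (M <= m)%N -> (M <= n)%N -> qnorm (u m - u n) < e) ->
  exists l : Q, forall e : R, 0 < e -> exists M : nat, forall n : nat,
     (M <= n)%N -> qnorm (u n - l) < e.
Proof.
move=> uC; have i0 n : 0 < n.+1%:R^-1 :> R by rewrite invr_gt0.
have /choice[k kP] n := uC _ (i0 n).
have /choice[o oP] n := qnorm_dense (u (k n)) (i0 n).
(* One [1 / (n + 1)] pays for replacing [u (k n)] by [o n], the other for the distance from
   [u (k n)] to later terms. *)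
pose x n : R := 2 * n.+1%:R^-1.
have xv : vanishing x by apply: vanishingZ => //; apply: vanishing_inv.
have tri := snorm_tri qnorm_seminorm; rewrite /= in tri.
have distC := snorm_distC qnorm_seminorm; rewrite /= in distC.
have ox m n : N (o m - o n) <= x m + x n.
  have -> : N (o m - o n) = qnorm (cls (cconst (o m)) - cls (cconst (o n))).
    rewrite -qnorm_const clsB; congr qnorm; apply/clsP/ceq_ext => j /=.
    by rewrite scaleN1r.
  pose M := maxn (k m) (k n).
  have h1 := kP m (k m) M (leqnn _) (leq_maxl _ _).
  have h2 := kP n M (k n) (leq_maxr _ _) (leqnn _).
  have h3 := oP m; rewrite distC in h3; have h4 := oP n.
  apply: le_trans (tri (u (k m)) _ _) _.
  have := tri (u M) (u (k m)) (cls (cconst (o n))).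
  have := tri (u (k n)) (u M) (cls (cconst (o n))).
  rewrite /x; move: (m.+1%:R^-1) (n.+1%:R^-1) h1 h2 h3 h4 => a b; lra.
pose v := CSeq (ex_intro2 _ _ x xv ox).
exists (cls v) => e e0; have e40 : 0 < e / 2 by rewrite divr_gt0.
have [M HM] := xv _ e40; exists (k M) => n Mn.
have h1 := kP M n (k M) Mn (leqnn _); have h2 := oP M.
have h3 := qnorm_tail (u := v) xv ox M; rewrite distC /= in h3.
have h4 := HM M (leqnn _); rewrite /x in h3 h4.
move: (M.+1%:R^-1) h1 h2 h3 h4 => a h1 h2 h3 h4.
have := tri (u (k M)) (u n) (cls v).
have := tri (cls (cconst (o M))) (u (k M)) (cls v); lra.
Qed.

HB.instance Definition _ := @isCStarAlgebra.Build R Q qnorm qnormD qnormZ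
  qnorm0_eq0 qnormM qnorm_star qnorm_complete.

End Completion.

Theorem cstar_completion (R : realType) (O : starAlgType R) (N : cstar_seminorm O) :
  N 1 = 1 -> exists (A : cstarAlgType R) (iota : {lrmorphism O -> A}),
  [/\ star_preserving iota, forall a, cnorm (iota a) = N a
    & forall (a : A) (e : R), 0 < e -> exists o, cnorm (a - iota o) < e].
Proof.
move=> N1; pose A : cstarAlgType R := completion N1.
pose f (a : O) : A := cls N1 (cconst N a).
have fB : zmod_morphism f.
  by move=> a b; rewrite /f clsB; apply/clsP/ceq_ext => n /=; rewrite scaleN1r.
have fM : monoid_morphism f.
  split=> // a b; rewrite /f clsM; exact/clsP/ceq_ext.
have fZ : scalable f.
  by move=> k a; rewrite /f clsZ; apply/clsP/ceq_ext.
pose fA := GRing.isZmodMorphism.Build _ _ f fB.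
pose fMm := GRing.isMonoidMorphism.Build _ _ f fM.
pose fZm := GRing.isScalable.Build _ _ _ _ f fZ.
pose iota : {lrmorphism O -> A} := HB.pack f fA fMm fZm.
exists A, iota; split.
- by move=> a; rewrite /= /f cls_star; apply/clsP/ceq_ext.
- by move=> a; apply: qnorm_const.
- exact: qnorm_dense.
Qed.

(** * Enveloping C*-algebras *)

Section DenseExtension.
Variables (R : realType) (O : starAlgType R) (N : cstar_seminorm O).
Variables (A : cstarAlgType R) (iota : {lrmorphism O -> A}).
Hypothesis iota_star : star_preserving iota.
Hypothesis iota_norm : forall a, cnorm (iota a) = N a.
Hypothesis iota_dense : forall (a : A) (e : R), 0 < e ->
  exists o, cnorm (a - iota o) < e.

Let r (n : nat) : R := n.+1%:R^-1.

Let r_gt0 n : 0 < r n. Proof. by rewrite invr_gt0. Qed.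

Let r_le1 n : r n <= 1. Proof. by rewrite invf_le1 // ler1n. Qed.

Lemma small_eq (B : cstarAlgType R) (a b : B) K : 0 <= K ->
  (forall n, cnorm (a - b) <= K * r n) -> a = b.
Proof.
move=> K0 ab; apply/eqP; rewrite -subr_eq0; apply/eqP/cnorm0_eq0/le_anti.
rewrite cnorm_ge0 andbT; apply: vanishing_const_le0; apply: vanishing_le ab _.
exact: vanishingZ K0 (@vanishing_inv R).
Qed.

Lemma approx_mul (B : cstarAlgType R) (a b a' b' : B) n :
  cnorm (a - a') <= r n -> cnorm (b - b') <= r n ->
  cnorm (a * b - a' * b') <= (cnorm a + 1 + cnorm b) * r n.
Proof.
move=> ha hb; have /= := snorm_mulB (cnorm_seminorm B) a b a' b'.
have : cnorm a' <= cnorm a + 1.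
  have := cnormD a (a' - a); rewrite addrC subrK cnorm_distC; have := r_le1 n; lra.
have := cnorm_ge0 b; have := cnorm_ge0 a'; have := r_gt0 n.
have := cnorm_ge0 (b - b').
set x := cnorm a'; set y := cnorm b; set z := cnorm (b - b') in hb *.
set w := cnorm (a - a') in ha *; set t := r n in ha hb *.
move=> z0 t0 x0 y0 xa H; apply: le_trans H _.
have : w * y <= t * y by rewrite ler_wpM2r.
have : x * z <= (cnorm a + 1) * t by apply: ler_pM.
lra.
Qed.

Lemma dense_approx : exists s : A -> nat -> O, forall a n, cnorm (a - iota (s a n)) <= r n.
Proof.
have /choice[s sP] (an : A * nat) : exists o, cnorm (an.1 - iota o) <= r an.2.
  by have [o /ltW] := iota_dense an.1 (r_gt0 an.2); exists o.
by exists (fun a n => s (a, n)) => a n; apply: (sP (a, n)).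
Qed.

Lemma dense_commutative : commutative (@GRing.mul O) -> commutative (@GRing.mul A).
Proof.
move=> cO a b; have [s sP] := dense_approx.
apply: (@small_eq _ _ _ ((cnorm a + 1 + cnorm b) + (cnorm b + 1 + cnorm a))) => [|n].
  by rewrite !addr_ge0 ?cnorm_ge0.
apply: le_trans (cnorm_tri (iota (s a n * s b n)) _ _) _; rewrite [leRHS]mulrDl.
apply: lerD; first by rewrite rmorphM; apply: approx_mul (sP a n) (sP b n).
by rewrite cnorm_distC cO rmorphM; apply: approx_mul (sP b n) (sP a n).
Qed.

Section Extension.
Variables (B : cstarAlgType R) (f : {lrmorphism O -> B}).
Hypothesis f_star : star_preserving f.
Hypothesis f_norm : forall a, cnorm (f a) <= N a.

(** The inequality against all [o] at once specifies the extension: it forces agreement with [f] on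
    the image of [iota], and every algebraic law follows by approximating the arguments. *)
Lemma dense_extension_value (a : A) :
  exists b : B, forall o, cnorm (b - f o) <= cnorm (a - iota o).
Proof.
have [s sP] := dense_approx.
have fs m n : cnorm (f (s a m) - f (s a n)) <= r m + r n.
  rewrite -rmorphB; apply: le_trans (f_norm _) _; rewrite -iota_norm rmorphB.
  apply: le_trans (cnorm_tri a _ _) _; rewrite (cnorm_distC _ a).
  exact: lerD (sP a m) (sP a n).
have [|b bP] := @cnorm_complete _ B (fun n => f (s a n)).
  move=> e e0; have e20 : 0 < e / 2 by rewrite divr_gt0.
  have [M HM] := @vanishing_inv R _ e20; exists M => m n Mm Mn.
  have := fs m n; have := HM m Mm; have := HM n Mn; rewrite -/(r m) -/(r n); lra.
exists b => o; rewrite -subr_le0; apply: vanishing_const_le0.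
have bv : vanishing (fun n => cnorm (f (s a n) - b)) := bP.
apply: vanishing_le (vanishingD bv (@vanishing_inv R)) => n; rewrite -/(r n).
have := cnorm_tri (f (s a n)) b (f o); rewrite (cnorm_distC b (f (s a n))).
have := f_norm (s a n - o); rewrite -iota_norm !rmorphB.
have := cnorm_tri a (iota (s a n)) (iota o); rewrite (cnorm_distC _ a).
have := sP a n; lra.
Qed.

(** Only uniqueness calls for [star_morphism_contractive]: a competing *-morphism is not assumed
    continuous, and contractivity makes it agree with [g] beyond the dense image. *)
Lemma dense_extension : exists g : {lrmorphism A -> B},
  [/\ star_preserving g, forall a, g (iota a) = f a
    & forall h : {lrmorphism A -> B}, star_preserving h ->
        (forall a, h (iota a) = f a) -> h =1 g].
Proof.
have [s sP] := dense_approx; have /choice[g gP] := dense_extension_value.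
have gs a n : cnorm (g a - f (s a n)) <= r n by apply: le_trans (gP _ _) (sP _ _).
have near a x n K : cnorm (a - iota x) <= K * r n -> cnorm (g a - f x) <= K * r n.
  exact: le_trans (gP _ _).
have gD a b : g (a + b) = g a + g b.
  have K0 : 0 <= 2 + 2 :> R by lra.
  apply: (small_eq K0) => n.
  apply: le_trans (cnorm_tri (f (s a n + s b n)) _ _) _; rewrite [leRHS]mulrDl; apply: lerD.
    apply: near; rewrite rmorphD opprD addrACA; apply: le_trans (cnormD _ _) _.
    have := sP a n; have := sP b n; lra.
  rewrite cnorm_distC rmorphD opprD addrACA; apply: le_trans (cnormD _ _) _.
  have := gs a n; have := gs b n; lra.
have gZ k a : g (k *: a) = k *: g a.
  have c0 := normc_ge0 k; set c := ComplexField.Normc.normc k in c0.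
  apply: (@small_eq _ _ _ (c + c)) => [|n]; first exact: addr_ge0.
  apply: le_trans (cnorm_tri (f (k *: s a n)) _ _) _; rewrite [leRHS]mulrDl; apply: lerD.
    by apply: near; rewrite linearZ -scalerBr cnormZ; apply: (ler_wpM2l c0 (sP a n)).
  by rewrite cnorm_distC linearZ -scalerBr cnormZ; apply: (ler_wpM2l c0 (gs a n)).
have gM a b : g (a * b) = g a * g b.
  apply: (@small_eq _ _ _ ((cnorm a + 1 + cnorm b) + (cnorm (g a) + 1 + cnorm (g b)))) => [|n].
    by rewrite !addr_ge0 ?cnorm_ge0.
  apply: le_trans (cnorm_tri (f (s a n * s b n)) _ _) _; rewrite [leRHS]mulrDl; apply: lerD.
    by apply: near; rewrite rmorphM; apply: approx_mul (sP a n) (sP b n).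
  by rewrite cnorm_distC rmorphM; apply: approx_mul (gs a n) (gs b n).
have gi a : g (iota a) = f a.
  apply/eqP; rewrite -subr_eq0; apply/eqP/cnorm0_eq0/le_anti; rewrite cnorm_ge0 andbT.
  by apply: le_trans (gP _ a) _; rewrite subrr cnorm0.
have gS a : g (a^s) = (g a)^s.
  have K0 : 0 <= 1 + 1 :> R by lra.
  apply: (small_eq K0) => n.
  apply: le_trans (cnorm_tri (f (s a n)^s) _ _) _; rewrite [leRHS]mulrDl mul1r; apply: lerD.
    apply: le_trans (gP _ _) _; rewrite (_ : iota (s a n)^s = (iota (s a n))^s); last exact: iota_star.
    by rewrite -starB cnorm_starE.
  rewrite (_ : f (s a n)^s = (f (s a n))^s); last exact: f_star.
  by rewrite -starB cnorm_starE cnorm_distC.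
have gB : zmod_morphism g by move=> a b; rewrite -scaleN1r gD gZ scaleN1r.
have gMm : monoid_morphism g by split=> //; rewrite -(rmorph1 iota) gi rmorph1.
pose gA := GRing.isZmodMorphism.Build _ _ g gB.
pose gMm' := GRing.isMonoidMorphism.Build _ _ g gMm.
pose gZm := GRing.isScalable.Build _ _ _ _ g (gZ : scalable g).
pose g' : {lrmorphism A -> B} := HB.pack g gA gMm' gZm.
exists g'; split=> // h hs hi a /=.
have K0 : 0 <= 1 + 1 :> R by lra.
apply: (small_eq K0) => n.
apply: le_trans (cnorm_tri (f (s a n)) _ _) _; rewrite [leRHS]mulrDl mul1r; apply: lerD.
  rewrite -hi -rmorphB; apply: le_trans (star_morphism_contractive _ hs) _.
  exact: sP.
by rewrite cnorm_distC.
Qed.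

End Extension.
End DenseExtension.

Section Enveloping.
Variables (R : realType) (O : starAlgType R).

(** A set of real numbers, although representations range over all C*-algebras; its supremum can be
    taken without choosing a family of representations. *)
Definition rep_norm (a : O) (x : R) : Prop :=
  exists (B : cstarAlgType R) (f : {lrmorphism O -> B}),
    star_preserving f /\ x = cnorm (f a).

Hypothesis rep_ex : exists (B : cstarAlgType R) (f : {lrmorphism O -> B}),
  star_preserving f.
Hypothesis rep_bound : forall a, exists M, forall (B : cstarAlgType R)
  (f : {lrmorphism O -> B}), star_preserving f -> cnorm (f a) <= M.

Let sup_norm (a : O) : R := sup (rep_norm a).

Let rep_has_sup a : classical_sets.has_sup (rep_norm a).
Proof.
have [B [f fs]] := rep_ex; have [M HM] := rep_bound a.
split; first by exists (cnorm (f a)), B, f.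
by exists M => _ [B' [f' [fs' ->]]]; apply: HM.
Qed.

Let sup_norm_ub a (B : cstarAlgType R) (f : {lrmorphism O -> B}) :
  star_preserving f -> cnorm (f a) <= sup_norm a.
Proof.
move=> fs; apply: (ub_le_sup (proj2 (rep_has_sup a))).
by exists B, f.
Qed.

Let sup_norm_le a c : (forall (B : cstarAlgType R) (f : {lrmorphism O -> B}),
  star_preserving f -> cnorm (f a) <= c) -> sup_norm a <= c.
Proof.
move=> H; apply: (ge_sup (proj1 (rep_has_sup a))) => _ [B [f [fs ->]]].
exact: H.
Qed.

Let sup_norm_ge0 a : 0 <= sup_norm a.
Proof.
have [B [f fs]] := rep_ex.
exact: le_trans (cnorm_ge0 (f a)) (sup_norm_ub a fs).
Qed.

Fact sup_normD a b : sup_norm (a + b) <= sup_norm a + sup_norm b.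
Proof.
apply: sup_norm_le => B f fs; rewrite rmorphD.
by apply: le_trans (cnormD _ _) _; apply: lerD; apply: sup_norm_ub.
Qed.

Fact sup_normZ (c : R[i]) a :
  sup_norm (c *: a) = ComplexField.Normc.normc c * sup_norm a.
Proof.
have H k b : sup_norm (k *: b) <= ComplexField.Normc.normc k * sup_norm b.
  apply: sup_norm_le => B f fs; rewrite linearZ cnormZ.
  by rewrite ler_wpM2l ?normc_ge0 // sup_norm_ub.
apply/le_anti; rewrite H /=; have [->|c0] := eqVneq c 0.
  by rewrite ComplexField.Normc.normc0 mul0r.
have := H c^-1 (c *: a); rewrite scalerA mulVf // scale1r => /(ler_wpM2l (normc_ge0 c)).
by rewrite mulrA -ComplexField.Normc.normcM mulfV // ComplexField.Normc.normc1 mul1r.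
Qed.

Fact sup_normM a b : sup_norm (a * b) <= sup_norm a * sup_norm b.
Proof.
apply: sup_norm_le => B f fs; rewrite rmorphM.
by apply: le_trans (cnormM _ _) _; apply: ler_pM; rewrite ?cnorm_ge0 // sup_norm_ub.
Qed.

Fact sup_norm_star a : sup_norm (a^s * a) = sup_norm a ^+ 2.
Proof.
have E (B : cstarAlgType R) (f : {lrmorphism O -> B}) : star_preserving f ->
    cnorm (f (a^s * a)) = cnorm (f a) ^+ 2.
  move=> fs; have -> : f (a^s * a) = (f a)^s * f a.
    by rewrite rmorphM; congr (_ * _); apply: fs.
  exact: cnorm_star.
apply/le_anti/andP; split.
  apply: sup_norm_le => B f fs; rewrite E // lerXn2r ?nnegrE ?cnorm_ge0 //.
  exact: sup_norm_ub.
rewrite -[leRHS]sqr_sqrtr // lerXn2r ?nnegrE ?sqrtr_ge0 //.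
apply: sup_norm_le => B f fs; rewrite -(ler_pXn2r (n := 2)) ?nnegrE ?sqrtr_ge0 ?cnorm_ge0 //.
by rewrite sqr_sqrtr // -E // sup_norm_ub.
Qed.

Theorem enveloping_exists : exists (A : cstarAlgType R) (iota : {lrmorphism O -> A}),
  is_enveloping_cstar iota /\
  (commutative (@GRing.mul O) -> commutative (@GRing.mul A)).
Proof.
pose N := CstarSeminorm sup_normD sup_normZ sup_normM sup_norm_star.
have N1 : N 1 = 1.
  apply/le_anti/andP; split.
    by apply: sup_norm_le => B f fs; rewrite rmorph1 cnorm1.
  by have [B [f fs]] := rep_ex; have := sup_norm_ub 1 fs; rewrite rmorph1 cnorm1.
have [A [iota [iS iN iD]]] := cstar_completion N1.
exists A, iota; split; last exact: dense_commutative iD.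
split=> // B f fs; apply: (dense_extension iS iN iD fs) => a.
exact: sup_norm_ub.
Qed.

End Enveloping.

(** * Two by two matrices *)

Section Matrices.
Variable R : realType.
Local Notation nc := ComplexField.Normc.normc.
Local Notation V := 'cV[R[i]]_2.

(** A separate name for the matrices, to carry the star structure given by the conjugate
    transpose. *)
Definition M2 : Type := 'M[R[i]]_2.
HB.instance Definition _ := GRing.Algebra.copy M2 'M[R[i]]_2.

Definition adjoint (a : M2) : M2 := \matrix_(i, j) (a j i)^*.

Fact adjointK a : adjoint (adjoint a) = a.
Proof. by apply/matrixP => i j; rewrite !mxE conjCK. Qed.

Fact adjointD a b : adjoint (a + b) = adjoint a + adjoint b.
Proof. by apply/matrixP => i j; rewrite !mxE rmorphD. Qed.

Fact adjointZ (c : R[i]) a : adjoint (c *: a) = c^* *: adjoint a.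
Proof. by apply/matrixP => i j; rewrite !mxE rmorphM. Qed.

Fact adjointM a b : adjoint (a * b) = adjoint b * adjoint a.
Proof.
apply/matrixP => i j; rewrite !mxE rmorph_sum; apply: eq_bigr => k _.
by rewrite !mxE rmorphM mulrC.
Qed.

HB.instance Definition _ := @isStarAlgebra.Build R M2
  adjoint adjointK adjointD adjointZ adjointM.

Definition vsq (v : V) : R := nc (v 0 0) ^+ 2 + nc (v 1 0) ^+ 2.
Definition vnorm (v : V) : R := Num.sqrt (vsq v).
Definition inner (v w : V) : R[i] := (v 0 0)^* * w 0 0 + (v 1 0)^* * w 1 0.

Lemma vsq_ge0 v : 0 <= vsq v.
Proof. by rewrite addr_ge0 ?sqr_ge0. Qed.

Lemma vnorm_ge0 v : 0 <= vnorm v. Proof. exact: sqrtr_ge0. Qed.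

Lemma vnorm_sqr v : vnorm v ^+ 2 = vsq v.
Proof. by rewrite sqr_sqrtr ?vsq_ge0. Qed.

Lemma ncD (z w : R[i]) : nc (z + w) <= nc z + nc w.
Proof. exact: le_normcD. Qed.

Lemma ncJ (z : R[i]) : nc z^* = nc z.
Proof. by case: z => a b; rewrite /= sqrrN. Qed.

(** Lagrange's identity: the squares of the two sides differ by [(a * d - b * c) ^+ 2]. *)
Lemma CS2 (a b c d : R) : 0 <= a -> 0 <= b -> 0 <= c -> 0 <= d ->
  a * c + b * d <= Num.sqrt (a ^+ 2 + b ^+ 2) * Num.sqrt (c ^+ 2 + d ^+ 2).
Proof.
move=> a0 b0 c0 d0; rewrite -sqrtrM ?addr_ge0 ?sqr_ge0 //.
rewrite -[leLHS]ger0_norm ?addr_ge0 ?mulr_ge0 // -sqrtr_sqr ler_sqrt.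
  rewrite -subr_ge0 (_ : _ - _ = (a * d - b * c) ^+ 2) ?sqr_ge0 //; ring.
by rewrite mulr_ge0 ?addr_ge0 ?sqr_ge0.
Qed.

Lemma inner_le v w : nc (inner v w) <= vnorm v * vnorm w.
Proof.
apply: le_trans (ncD _ _) _; rewrite !ComplexField.Normc.normcM !ncJ.
by apply: CS2; apply: normc_ge0.
Qed.

Lemma nc_sqr (z : R[i]) : (nc z ^+ 2)%:C%C = z^* * z.
Proof.
case: z => a b; rewrite /= sqr_sqrtr ?addr_ge0 ?sqr_ge0 //.
by apply/eqP; rewrite eq_complex /=; apply/andP; split; apply/eqP; ring.
Qed.

Lemma inner_self v : inner v v = (vsq v)%:C%C.
Proof. by rewrite /inner /vsq rmorphD /= !nc_sqr. Qed.

Lemma vnormD v w : vnorm (v + w) <= vnorm v + vnorm w.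
Proof.
rewrite -(ler_pXn2r (n := 2)) ?nnegrE ?addr_ge0 ?vnorm_ge0 // sqrrD !vnorm_sqr.
have := @CS2 (nc (v 0 0)) (nc (v 1 0)) (nc (w 0 0)) (nc (w 1 0)).
rewrite !normc_ge0 => /(_ isT isT isT isT); rewrite -/(vsq v) -/(vsq w).
rewrite -/(vnorm v) -/(vnorm w) /vsq !mxE => H.
have h (z t : R[i]) : nc (z + t) ^+ 2 <= (nc z + nc t) ^+ 2.
  by rewrite lerXn2r ?nnegrE ?addr_ge0 ?normc_ge0 //; apply: ncD.
have := h (v 0 0) (w 0 0); have := h (v 1 0) (w 1 0); nra.
Qed.

Lemma vnormZ k v : vnorm (k *: v) = nc k * vnorm v.
Proof.
rewrite /vnorm /vsq !mxE !ComplexField.Normc.normcM !exprMn -mulrDr.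
by rewrite sqrtrM ?sqr_ge0 // sqrtr_sqr ger0_norm ?normc_ge0.
Qed.

Lemma vnorm0 : vnorm 0 = 0.
Proof. by rewrite /vnorm /vsq !mxE ComplexField.Normc.normc0 expr0n addr0 sqrtr0. Qed.

Lemma vnorm_coord (v : V) i : nc (v i 0) <= vnorm v.
Proof.
rewrite -[leLHS]ger0_norm ?normc_ge0 // -sqrtr_sqr ler_sqrt ?vsq_ge0 // /vsq.
have [->|->] : i = 0 \/ i = 1.
- by case: i => [[|[|//]] i2]; [left|right]; apply/val_inj.
- by rewrite lerDl sqr_ge0.
- by rewrite lerDr sqr_ge0.
Qed.

Lemma vnorm_le_coords (v : V) : vnorm v <= nc (v 0 0) + nc (v 1 0).
Proof.
have h0 := normc_ge0 (v 0 0); have h1 := normc_ge0 (v 1 0).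
rewrite -(ler_pXn2r (n := 2)) ?nnegrE ?addr_ge0 ?vnorm_ge0 // vnorm_sqr /vsq; nra.
Qed.

Lemma mulmx2E (a : M2) (v : V) i :
  (a *m v : V) i 0 = a i 0 * v 0 0 + a i 1 * v 1 0.
Proof.
rewrite mxE !big_ord_recl big_ord0 addr0; congr (_ + a i _ * v _ _); exact/val_inj.
Qed.

Lemma inner_adjoint (a : M2) (v w : V) : inner (a *m v) w = inner v (adjoint a *m w).
Proof. by rewrite /inner !mulmx2E !mxE !rmorphD !rmorphM /=; ring. Qed.

Definition unit_image (a : M2) (x : R) : Prop :=
  exists v : V, vnorm v <= 1 /\ x = vnorm (a *m v).

Definition opnorm (a : M2) : R := sup (unit_image a).

Lemma unit_image_sup a : classical_sets.has_sup (unit_image a).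
Proof.
split.
  by exists (vnorm (a *m 0)), 0; rewrite vnorm0.
exists ((nc (a 0 0) + nc (a 0 1)) + (nc (a 1 0) + nc (a 1 1))) => _ [v [v1 ->]].
have H i : nc ((a *m v : V) i 0) <= nc (a i 0) + nc (a i 1).
  rewrite mulmx2E; apply: le_trans (ncD _ _) _; rewrite !ComplexField.Normc.normcM.
  by apply: lerD; rewrite ler_piMr ?normc_ge0 // (le_trans (vnorm_coord v _)).
exact: le_trans (vnorm_le_coords _) (lerD (H 0) (H 1)).
Qed.

Lemma opnorm_ub a (v : V) : vnorm v <= 1 -> vnorm (a *m v) <= opnorm a.
Proof. by move=> v1; apply: (ub_le_sup (proj2 (unit_image_sup a))); exists v. Qed.

Lemma opnorm_le a c : (forall v : V, vnorm v <= 1 -> vnorm (a *m v) <= c) ->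
  opnorm a <= c.
Proof.
move=> H; apply: (ge_sup (proj1 (unit_image_sup a))) => _ [v [v1 ->]]; exact: H.
Qed.

Lemma opnorm_ge0 a : 0 <= opnorm a.
Proof.
apply: le_trans (vnorm_ge0 (a *m 0)) _; apply: opnorm_ub.
by rewrite vnorm0.
Qed.

Lemma vnorm_mulmx a (v : V) : vnorm (a *m v) <= opnorm a * vnorm v.
Proof.
have [v0|v0] := eqVneq (vnorm v) 0.
  have -> : v = 0.
    apply/matrixP => i j; rewrite (ord1 j) mxE; apply: ComplexField.Normc.eq0_normc.
    by have := vnorm_coord v i; rewrite v0 => H; apply/le_anti; rewrite H normc_ge0.
  by rewrite mulmx0 vnorm0 mulr0.
have v1 : 0 < vnorm v by rewrite lt_def v0 vnorm_ge0.
have i0 : 0 <= (vnorm v)^-1 by rewrite invr_ge0 ltW.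
have := @opnorm_ub a (((vnorm v)^-1)%:C%C *: v).
rewrite -scalemxAr !vnormZ normc_real ger0_norm // mulVf // => /(_ (lexx _)).
by rewrite mulrC ler_pdivrMr.
Qed.

Fact opnormD a b : opnorm (a + b) <= opnorm a + opnorm b.
Proof.
apply: opnorm_le => v v1; rewrite mulmxDl; apply: le_trans (vnormD _ _) _.
by apply: lerD; apply: opnorm_ub.
Qed.

Fact opnormZ (k : R[i]) a : opnorm (k *: a) = nc k * opnorm a.
Proof.
have H c b : opnorm (c *: b) <= nc c * opnorm b.
  apply: opnorm_le => v v1; rewrite -scalemxAl vnormZ ler_wpM2l ?normc_ge0 //.
  exact: opnorm_ub.
apply/le_anti; rewrite H /=; have [->|k0] := eqVneq k 0.
  by rewrite ComplexField.Normc.normc0 mul0r opnorm_ge0.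
have := H k^-1 (k *: a); rewrite scalerA mulVf // scale1r => /(ler_wpM2l (normc_ge0 k)).
by rewrite mulrA -ComplexField.Normc.normcM mulfV // ComplexField.Normc.normc1 mul1r.
Qed.

Fact opnormM a b : opnorm (a * b) <= opnorm a * opnorm b.
Proof.
apply: opnorm_le => v v1; rewrite -mulmxA; apply: le_trans (vnorm_mulmx _ _) _.
by rewrite ler_wpM2l ?opnorm_ge0 ?opnorm_ub.
Qed.

(** The square of the norm of [b *m v] is the inner product of [v] with [b^s * b] applied to [v],
    which gives one inequality. With submultiplicativity it also yields [opnorm b <= opnorm b^s],
    hence the other. *)
Fact opnorm_star a : opnorm (a^s * a) = opnorm a ^+ 2.
Proof.
have H b : opnorm b ^+ 2 <= opnorm (b^s * b).
  rewrite -[leRHS]sqr_sqrtr ?opnorm_ge0 // lerXn2r ?nnegrE ?sqrtr_ge0 ?opnorm_ge0 //.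
  apply: opnorm_le => v v1.
  rewrite -(ler_pXn2r (n := 2)) ?nnegrE ?sqrtr_ge0 ?vnorm_ge0 //.
  rewrite vnorm_sqr sqr_sqrtr ?opnorm_ge0 // -[leLHS]ger0_norm ?vsq_ge0 //.
  rewrite -normc_real -inner_self inner_adjoint mulmxA.
  apply: le_trans (inner_le _ _) _; rewrite -[leRHS]mul1r.
  by apply: ler_pM; rewrite ?vnorm_ge0 ?opnorm_ub.
have S b : opnorm b <= opnorm b^s.
  have := H b; have := opnormM b^s b; have := opnorm_ge0 b; have := opnorm_ge0 b^s; nra.
apply/le_anti; rewrite H andbT expr2; apply: le_trans (opnormM _ _) _.
by rewrite ler_wpM2r ?opnorm_ge0 // -{2}(starK a) S.
Qed.

Definition opnorm_seminorm := CstarSeminorm opnormD opnormZ opnormM opnorm_star.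

(** The orthogonal projection onto the line spanned by (1, 1), neither equal nor orthogonal to the
    first axis, onto which [corner] projects. *)
Definition half_ones : M2 := const_mx (2^-1).

Definition corner : M2 := \matrix_(i, j) ((i == 0) && (j == 0))%:R.

Lemma mulM2E (a b : M2) i j : (a * b : M2) i j = a i 0 * b 0 j + a i 1 * b 1 j.
Proof.
rewrite mxE !big_ord_recl big_ord0 addr0; congr (_ + a i _ * b _ _); exact/val_inj.
Qed.

Lemma corner_projection : projection corner.
Proof.
split; apply/matrixP => i j; first by rewrite !mxE conjC_nat andbC.
by rewrite mulM2E !mxE /= andbF mul0r addr0 -natrM mulnb andbT andbC.
Qed.

Lemma half_ones_projection : projection half_ones.
Proof.
split; apply/matrixP => i j; first by rewrite !mxE fmorphV /= conjC_nat.
by rewrite mulM2E !mxE; field.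
Qed.

Lemma corner_half_ones : corner * half_ones <> half_ones * corner.
Proof.
move=> /matrixP/(_ 0 1); rewrite !mulM2E !mxE /= !mul0r !mulr0 !addr0 mul1r.
by move=> /eqP; rewrite invr_eq0 pnatr_eq0.
Qed.

Lemma opnorm_entry (a : M2) i j : nc (a i j) <= opnorm a.
Proof.
pose e : V := delta_mx j 0.
have /andP[e1 /eqP ae] : (vnorm e <= 1) && (a *m e == col j a).
  rewrite -colE eqxx andbT /vnorm /vsq !mxE.
  have [->|->] : j = 0 \/ j = 1.
  - by case: j {e} => [[|[|//]] j2]; [left|right]; apply/val_inj.
  - rewrite /= !(expr1n, expr0n) /= !(addr0, add0r, sqrtr0, sqrtr1).
    by rewrite !(expr1n, expr0n) /= !(addr0, add0r) sqrtr1.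
  - rewrite /= !(expr1n, expr0n) /= !(addr0, add0r, sqrtr0, sqrtr1).
    by rewrite !(expr1n, expr0n) /= !(addr0, add0r) sqrtr1.
apply: le_trans (opnorm_ub a e1); rewrite ae.
by have := vnorm_coord (col j a) i; rewrite mxE.
Qed.

Lemma opnorm_eq0 a : opnorm a = 0 -> a = 0.
Proof.
move=> a0; apply/matrixP => i j; rewrite mxE; apply: ComplexField.Normc.eq0_normc.
by have := opnorm_entry a i j; rewrite a0 => H; apply/le_anti; rewrite H normc_ge0.
Qed.

Lemma opnorm1 : opnorm 1 = 1.
Proof.
have := opnorm_star 1; rewrite star1 mulr1 => E.
have n0 : opnorm 1 != 0 by apply/eqP => /opnorm_eq0/eqP; rewrite oner_eq0.
by apply: (mulfI n0); rewrite mulr1 -expr2 -E.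
Qed.

End Matrices.

(** The matrices enter through [cstar_completion], which supplies the complete norm. The commutator
    stays nonzero because [iota] preserves [opnorm], which is definite. *)
Lemma noncommuting_projections (R : realType) : exists (A : cstarAlgType R) (p q : A),
  [/\ projection p, projection q & p * q <> q * p].
Proof.
have [A [iota [iS iN _]]] := cstar_completion (opnorm1 R : opnorm_seminorm R 1 = 1).
have proj p : projection p -> projection (iota p).
  case=> pE pp; split; last by rewrite -rmorphM pp.
  by rewrite -[in RHS]pE; apply/esym/iS.
exists A, (iota (corner R)), (iota (half_ones R)); split.
- exact/proj/corner_projection.
- exact/proj/half_ones_projection.
- move=> /eqP; rewrite -!rmorphM -subr_eq0 -rmorphB => /eqP E.
  have := iN (corner R * half_ones R - half_ones R * corner R); rewrite E cnorm0.
  move=> /esym/opnorm_eq0/eqP; rewrite subr_eq0 => /eqP; exact: corner_half_ones.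
Qed.

(** * Quantum automorphisms of tree-cographs *)

Section Intertwiners.
Variable A : nzRingType.

Lemma intertwines_comp (G H L : sgraph) (u : L -> H -> A) (v : H -> G -> A) :
  intertwines u -> intertwines v ->
  intertwines (fun z x => \sum_(y : H) u z y * v y x).
Proof.
move=> uI vI z x.
transitivity (\sum_(y : H) u z y * (\sum_w v y w * adj_entry A w x)).
  under [RHS]eq_bigr => y _ do rewrite mulr_sumr.
  rewrite [RHS]exchange_big; apply: eq_bigr => w _.
  by rewrite mulr_suml; apply: eq_bigr => y _; rewrite mulrA.
under eq_bigr => y _ do rewrite vI mulr_sumr.
rewrite exchange_big /=.
transitivity (\sum_w (\sum_y u z y * adj_entry A y w) * v w x).
  apply: eq_bigr => w _; rewrite mulr_suml.
  by apply: eq_bigr => y _; rewrite mulrA.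
transitivity (\sum_w \sum_y adj_entry A z y * (u y w * v w x)).
  apply: eq_bigr => w _; rewrite uI mulr_suml.
  by apply: eq_bigr => y _; rewrite mulrA.
rewrite exchange_big; apply: eq_bigr => y _.
by rewrite mulr_sumr.
Qed.

(** Multiply the intertwining relation at [(y, x')] by [u y x] on the left and [u y' x'] on the
    right. Orthogonality leaves the term [x] on one side and [y'] on the other, so the product times
    [adj x x'] equals the product times [adj y y']. *)
Lemma intertwines_adj (G H : sgraph) (u : H -> G -> A) x y x' y' :
  (forall y x, u y x * u y x = u y x) ->
  (forall y x z, x != z -> u y x * u y z = 0) ->
  (forall y z x, y != z -> u y x * u z x = 0) ->
  intertwines u -> adj y y' != adj x x' -> u y x * u y' x' = 0.
Proof.
move=> ui ur uc uI; have := uI y x' => /(congr1 (fun a => u y x * a * u y' x')).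
rewrite !mulr_sumr !mulr_suml (bigD1 x) //= [in LHS]big1 => [|z zx]; last first.
  by rewrite mulrA ur ?mul0r // eq_sym.
rewrite [in RHS](bigD1 y') //= [in RHS]big1 => [|w wy]; last first.
  by rewrite -!mulrA uc // !mulr0.
rewrite !addr0 /adj_entry; case: (adj x x'); case: (adj y y') => //= + _.
  by rewrite mulr1 ui mul0r mulr0 mul0r.
by rewrite mul1r !mulr0 mul0r -mulrA ui => <-.
Qed.

End Intertwiners.

Definition plain (G : sgraph) : G -> seq bool := fun _ => [::].

Section Relations.
Variable R : realType.

Lemma intertwiner_magic (A : starAlgType R) (G H : sgraph) (u : H -> G -> A) :
  (forall y x, u y x * u y x = u y x) ->
  (forall y x z, x != z -> u y x * u y z = 0) ->
  (forall y z x, y != z -> u y x * u z x = 0) ->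
  (forall y, \sum_x u y x = 1) -> (forall x, \sum_y u y x = 1) ->
  intertwines u -> magic (@plain G) [set: G] (@plain H) [set: H] 1 u.
Proof.
move=> ui ur uc us1 us2 uI; split.
- by move=> y x _ _.
- by move=> y x _ _ z _; apply: ur.
- by move=> y x _ _ z _; apply: uc.
- by move=> y _; rewrite -(us1 y); apply: eq_bigl => x; rewrite inE.
- by move=> x _; rewrite -(us2 x); apply: eq_bigl => y; rewrite inE.
- by move=> y x _ _ y' x' _ _; apply: intertwines_adj.
- by move=> y x _ _; rewrite eqxx.
Qed.

Lemma qgen_magic (G : sgraph) :
  magic (@plain G) [set: G] (@plain G) [set: G] 1 (@qgen R G).
Proof.
have [qP qS qO qI] := qgen_relations R G.
apply: intertwiner_magic => //.
- by move=> y x; have [] := qP y x.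
- by move=> y x z /(qO y)[].
- by move=> y z x /(qO x)[].
- by move=> y; have [] := qS y.
- by move=> y; have [] := qS y.
Qed.

(** A magic unitary comes without orthogonality relations; [sum_projections_orth] supplies them,
    after which the algebraic theorem applies with [p = 1]. *)
Lemma quantum_isomorphic_isomorphic (G H : sgraph) : tree_cograph G ->
  quantum_isomorphic R G H -> isomorphic G H.
Proof.
move=> tG [X [U [[_ UP Us1 Us2] UI]]].
have M : magic (@plain G) [set: G] (@plain H) [set: H] 1 U.
  apply: intertwiner_magic => //.
  - by move=> y x; have [] := UP y x.
  - move=> y x z; apply: (sum_projections_orth (p := U y)) => //; exact: UP.
  - move=> y z x; apply: (sum_projections_orth (p := fun y => U y x)) => // i; exact: UP.
have [f fI] := splittable_magic_iso (tree_cograph_splittable _ _ tG) M (oner_neq0 X).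
have [g [_ fK gK]] := iso_inv fI; exists f; split.
  by exists g => x; [apply: fK|apply: gK]; rewrite inE.
by move=> x y; apply: (iso_adj fI); rewrite inE.
Qed.

(** * Classical automorphisms and the representations they give *)

Section Automorphisms.
Variable G : sgraph.
Implicit Types f g : {perm G}.

Lemma graph_autP f : reflect (forall x y, adj (f x) (f y) = adj x y) (f \in graph_aut G).
Proof.
rewrite inE; apply: (iffP forallP) => [H x y|H x].
  by have /forallP/(_ y)/eqP := H x.
by apply/forallP => y; rewrite H.
Qed.

Lemma plain_iso_perm (f : G -> G) :
  colored_iso (@plain G) [set: G] (@plain G) [set: G] f ->
  exists2 s : {perm G}, s \in graph_aut G & s =1 f.
Proof.
move=> fI; have fJ : injective f by move=> x y; apply: (iso_inj fI); rewrite inE.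
exists (perm fJ) => [|x]; last by rewrite permE.
by apply/graph_autP => x y; rewrite !permE (iso_adj fI) ?inE.
Qed.

Lemma asymmetric_plain : asymmetric G -> asymmetric_in (@plain G) [set: G].
Proof.
move=> aG f /plain_iso_perm[s sA sf] x _; rewrite -sf.
by move: sA; rewrite aG inE => /eqP ->; rewrite perm1.
Qed.

Lemma schmidt_plain : schmidt_in (@plain G) [set: G] -> schmidt_criterion G.
Proof.
case=> f [g [/plain_iso_perm[s sA sf] /plain_iso_perm[t tA tg] [x _ fx] [y _ gy] dis]].
exists s, t; split=> //.
- by apply: contra_neq fx => s1; rewrite -sf s1 perm1.
- by apply: contra_neq gy => t1; rewrite -tg t1 perm1.
- rewrite -setI_eq0; apply/eqP/setP => z; rewrite !inE sf tg.
  by case: (dis z); rewrite ?inE // => ->; rewrite eqxx ?andbF.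
Qed.

Variable A : cstarAlgType R.
Implicit Types p q : A.

Lemma cstar_qu_relations (u : G -> G -> A) :
  (forall x y, projection (u x y)) -> (forall x, \sum_y u x y = 1) ->
  (forall y, \sum_x u x y = 1) -> intertwines u -> qu_relations u.
Proof.
move=> uP us1 us2 uI; split=> // x y z yz; split.
  by apply: (sum_projections_orth (p := u x)).
by apply: (sum_projections_orth (p := fun y => u y x)).
Qed.

(* [f] on the range of [p] and the identity on its complement. *)
Definition mix p f (x y : G) : A := p * (f x == y)%:R + (1 - p) * (x == y)%:R.

Lemma sum_delta (x : G) (F : G -> A) : \sum_y (x == y)%:R * F y = F x.
Proof.
rewrite (bigD1 x) //= eqxx mul1r big1 ?addr0 // => y.
by rewrite eq_sym => /negPf ->; rewrite mul0r.
Qed.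

Lemma sum_mix p f x (F : G -> A) :
  \sum_y mix p f x y * F y = p * F (f x) + (1 - p) * F x.
Proof.
rewrite -(sum_delta (f x)) -(sum_delta x F) !mulr_sumr -big_split /=.
by apply: eq_bigr => y _; rewrite mulrDl !mulrA.
Qed.

Lemma mix_projection p f x y : projection p -> projection (mix p f x y).
Proof.
rewrite /mix; case: eqP => _; case: eqP => _; rewrite ?mulr1 ?mulr0 ?addr0 ?add0r //.
- by move=> _; rewrite addrC subrK; split; rewrite ?star1 ?mulr1.
- exact: projectionC.
- by move=> _; split; rewrite ?star0 ?mulr0.
Qed.

Lemma mix_row p f x : \sum_y mix p f x y = 1.
Proof.
by under eq_bigr => y _ do rewrite -[mix _ _ _ _]mulr1; rewrite sum_mix !mulr1 addrC subrK.
Qed.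

Lemma mix_col p f y : \sum_x mix p f x y = 1.
Proof.
rewrite /mix big_split /= -!mulr_sumr.
have H (b : {perm G}) : \sum_x (b x == y)%:R = 1 :> A.
  rewrite (bigD1 (b^-1%g y)) //= permKV eqxx big1 ?addr0 // => x.
  by rewrite -(inj_eq (@perm_inj _ b)) permKV => /negPf ->.
have := H 1%g; under eq_bigr => x _ do rewrite perm1; move=> ->.
by rewrite H !mulr1 addrC subrK.
Qed.

Lemma mix_intertwines p f : f \in graph_aut G -> intertwines (mix p f).
Proof.
move=> /graph_autP fA x y; rewrite (sum_mix p f x (fun z => adj_entry A z y)).
have H (b : {perm G}) : \sum_w adj_entry A x w * (b w == y)%:R = adj_entry A x (b^-1%g y).
  rewrite (bigD1 (b^-1%g y)) //= permKV eqxx mulr1 big1 ?addr0 // => w.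
  by rewrite -(inj_eq (@perm_inj _ b)) permKV => /negPf ->; rewrite mulr0.
have C (a : A) w : adj_entry A x w * a = a * adj_entry A x w.
  by rewrite /adj_entry mulr_natl mulr_natr.
rewrite /mix.
under [RHS]eq_bigr => w _ do rewrite mulrDr !mulrA !C -!mulrA.
rewrite big_split /= -!mulr_sumr H; have := H 1%g.
under eq_bigr => w _ do rewrite perm1; move=> ->.
by rewrite invg1 perm1 /adj_entry -(fA x (f^-1%g y)) permKV.
Qed.

Lemma mix_fix p f x y : f x = x -> mix p f x y = (x == y)%:R.
Proof. by move=> fx; rewrite /mix fx -mulrDl addrC subrK mul1r. Qed.

(** The product of the two mixes intertwines adjacency. Although [p] and [q] need not commute, its
    entries are projections: in each row only one of the two factors differs from the identity. *)
Lemma disjoint_mix_relations p q f g : projection p -> projection q ->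
  f \in graph_aut G -> g \in graph_aut G -> [disjoint supp f & supp g] ->
  exists u : G -> G -> A, [/\ qu_relations u,
    forall x, f x != x -> u x (f x) = p & forall x, g x != x -> u x (g x) = q].
Proof.
move=> pP qP fA gA dis.
have fg x : f x = x \/ g x = x.
  have := disjointFr dis (x := x); rewrite !inE.
  have [->|fx] := eqVneq (f x) x; first by left.
  by move=> /(_ isT)/negbFE/eqP; right.
pose u x y := \sum_z mix p f x z * mix q g z y.
have uE x y : u x y = if f x == x then mix q g x y else mix p f x y.
  rewrite /u sum_mix; case: eqP => [->|/eqP fx].
    by rewrite -mulrDl addrC subrK mul1r.
  (* If [f] moves [x], it also moves [f x]; so [g] fixes both, and the second factor is trivial on
     the terms that remain. *)
  have ffx : f (f x) != f x by rewrite (inj_eq perm_inj).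
  have gx : g x = x by case: (fg x) => // E; rewrite E eqxx in fx.
  have gfx : g (f x) = f x by case: (fg (f x)) => // E; rewrite E eqxx in ffx.
  by rewrite (mix_fix q y gfx) (mix_fix q y gx).
exists u; split.
- apply: cstar_qu_relations.
  + by move=> x y; rewrite uE; case: ifP => _; apply: mix_projection.
  + move=> x; rewrite /u exchange_big /= -[RHS](mix_row p f x).
    by apply: eq_bigr => z _; rewrite -mulr_sumr mix_row mulr1.
  + move=> y; rewrite /u exchange_big /= -[RHS](mix_col q g y).
    by apply: eq_bigr => z _; rewrite -mulr_suml mix_col mul1r.
  + by apply: intertwines_comp; apply: mix_intertwines.
- by move=> x fx; rewrite uE (negPf fx) /mix eqxx eq_sym (negPf fx) mulr1 mulr0 addr0.
- move=> x gx; have fx : f x = x by case: (fg x) => // E; rewrite E eqxx in gx.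
  by rewrite uE fx eqxx /mix eqxx eq_sym (negPf gx) mulr1 mulr0 addr0.
Qed.

End Automorphisms.

(** The generators are Kronecker deltas by [splittable_magic_diag], hence every term evaluates to a
    scalar multiple of 1. *)
Lemma quantum_asymmetric_complete (G : sgraph) : tree_cograph G ->
  asymmetric G -> quantum_asymmetric R G.
Proof.
move=> tG /asymmetric_plain aG.
have uE (x y : G) : qgen R x y = (x == y)%:R.
  have := splittable_magic_diag (tree_cograph_splittable _ _ tG) aG (qgen_magic G).
  move=> /(_ x y); rewrite !inE => /(_ isT isT) ->.
  by case: eqP.
have surj a : exists c : R[i], c%:A = a :> OQu R G.
  elim/ocls_ind: a => t; rewrite ocls_eval.
  elim: t => /= [x y|||a [c <-] b [d <-]|a [c <-] b [d <-]|k a [c <-]|a [c <-]].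
  - by exists (x == y)%:R; rewrite uE scaler_nat.
  - by exists 0; rewrite scale0r.
  - by exists 1; rewrite scale1r.
  - by exists (c + d); rewrite scalerDl.
  - by exists (c * d); rewrite -scalerAl mul1r scalerA.
  - by exists (k * c); rewrite scalerA.
  - by exists c^*; rewrite starZ star1.
have [h hK] := choice surj; exists h => // c.
apply/eqP; rewrite -subr_eq0; have /eqP := hK c%:A.
by rewrite -subr_eq0 -scalerBl scaler_eq0 oner_eq0 orbF.
Qed.

Lemma perm_neq1P (T : finType) (f : {perm T}) : f != 1%g -> exists x, f x != x.
Proof.
move=> f1; apply/existsP; apply: contraNT f1; rewrite negb_exists => /forallP H.
by apply/eqP/permP => x; rewrite perm1; apply/eqP; have := H x; rewrite negbK.
Qed.

(** If all elements are scalars, the value of a generator is the same in every representation. A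
    nontrivial automorphism [f] sends the generator at [x] and [f x] to any prescribed projection,
    in particular to 0 and to 1. *)
Lemma quantum_asymmetric_sound (G : sgraph) : quantum_asymmetric R G -> asymmetric G.
Proof.
case=> h _ hK; apply/setP => f; rewrite [RHS]inE; apply/idP/eqP => [fA|->]; last first.
  by apply/graph_autP => x y; rewrite !perm1.
apply/eqP; apply: contraT => /perm_neq1P[x fx].
have [A _] := noncommuting_projections R.
have A1 : 1%g \in graph_aut G by apply/graph_autP => y z; rewrite !perm1.
have dis : [disjoint supp f & supp (1%g : {perm G})].
  by rewrite -setI_eq0; apply/eqP/setP => z; rewrite !inE perm1 eqxx andbF.
have P0 : projection (0 : A) by split; rewrite ?star0 ?mulr0.
have P1 : projection (1 : A) by split; rewrite ?star1 ?mulr1.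
have val p : projection p -> p = (h (qgen R x (f x)))%:A :> A.
  move=> pP; have [u [uR uf _]] := disjoint_mix_relations pP P0 fA A1 dis.
  have [phi [_ phiE _]] := OQu_universal uR.
  by rewrite -(uf x fx) -phiE -{1}(hK (qgen R x (f x))) linearZ /= rmorph1.
have E : (1 : A) = 0 := etrans (val _ P1) (esym (val _ P0)).
by move/eqP: E; rewrite oner_eq0.
Qed.

(** Makes the supremum of the norms finite: generators go to projections, of norm at most 1, and the
    rest of the bound depends only on the term representing [a]. *)
Lemma OQu_rep_bound (G : sgraph) (a : OQu R G) : exists M,
  forall (B : cstarAlgType R) (f : {lrmorphism OQu R G -> B}), star_preserving f ->
  cnorm (f a) <= M.
Proof.
elim/ocls_ind: a => t; rewrite ocls_eval.
elim: t => [x y|||a [M HM] b [L HL]|a [M HM] b [L HL]|k a [M HM]|a [M HM]] /=.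
- exists 1 => B f fs; apply: cnorm_projection.
  have [qP _ _ _] := qgen_relations R G; have [xE xx] := qP x y.
  by split; rewrite -?fs -?rmorphM ?xE ?xx.
- by exists 0 => B f _; rewrite rmorph0 cnorm0.
- by exists 1 => B f _; rewrite rmorph1 cnorm1.
- exists (M + L) => B f fs; rewrite rmorphD.
  exact: le_trans (cnormD _ _) (lerD (HM _ _ fs) (HL _ _ fs)).
- exists (M * L) => B f fs; rewrite rmorphM.
  by apply: le_trans (cnormM _ _) _; apply: ler_pM; rewrite ?cnorm_ge0 ?HM ?HL.
- exists (ComplexField.Normc.normc k * M) => B f fs.
  by rewrite linearZ cnormZ ler_wpM2l ?normc_ge0 ?HM.
- by exists M => B f fs; rewrite fs cnorm_starE HM.
Qed.

Lemma OQu_rep (G : sgraph) (A : cstarAlgType R) (p q : A) (f g : {perm G}) :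
  projection p -> projection q -> f \in graph_aut G -> g \in graph_aut G ->
  [disjoint supp f & supp g] ->
  exists phi : {lrmorphism OQu R G -> A}, [/\ star_preserving phi,
    forall x, f x != x -> phi (qgen R x (f x)) = p
  & forall x, g x != x -> phi (qgen R x (g x)) = q].
Proof.
move=> pP qP fA gA dis.
have [u [uR uf ug]] := disjoint_mix_relations pP qP fA gA dis.
have [phi [phiS phiE _]] := OQu_universal uR.
by exists phi; split=> // x; rewrite phiE; [apply: uf|apply: ug].
Qed.

Lemma OQu_enveloping (G : sgraph) :
  exists (A : cstarAlgType R) (iota : {lrmorphism OQu R G -> A}),
  is_enveloping_cstar iota /\
  (commutative (@GRing.mul (OQu R G)) -> commutative (@GRing.mul A)).
Proof.
apply: enveloping_exists; last exact: OQu_rep_bound.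
have [A [p [q [pP qP _]]]] := noncommuting_projections R.
have A1 : 1%g \in graph_aut G by apply/graph_autP => y z; rewrite !perm1.
have dis : [disjoint supp (1%g : {perm G}) & supp (1%g : {perm G})].
  by rewrite -setI_eq0; apply/eqP/setP => z; rewrite !inE perm1 eqxx.
by have [phi [phiS _ _]] := OQu_rep pP qP A1 A1 dis; exists A, phi.
Qed.

(** The representation with noncommuting values [p] and [q] factors through the enveloping algebra,
    which therefore cannot be commutative. *)
Lemma schmidt_quantum_symmetry (G : sgraph) :
  schmidt_criterion G -> has_quantum_symmetry R G.
Proof.
case=> f [g [fA gA /perm_neq1P[x fx] /perm_neq1P[y gy] dis]].
have [B [p [q [pP qP npq]]]] := noncommuting_projections R.
have [phi [phiS phip phiq]] := OQu_rep pP qP fA gA dis.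
have [A [iota [iE _]]] := OQu_enveloping G; exists A, iota; split=> // cA.
have [_ /(_ B phi phiS)[h [_ hE _]]] := iE.
apply: npq; rewrite -(phip x fx) -(phiq y gy) -!hE.
by rewrite -[LHS](rmorphM h) -[RHS](rmorphM h) cA.
Qed.

(** Induction on terms, first in one argument and then in the other. The star is harmless:
    generators are self-adjoint, and in the second induction the hypothesis is applied to [b^s]. *)
Lemma OQu_commutative (G : sgraph) :
  (forall x y z t : G, qgen R x y * qgen R z t = qgen R z t * qgen R x y) ->
  commutative (@GRing.mul (OQu R G)).
Proof.
move=> H.
have gc x y (a : OQu R G) : qgen R x y * a = a * qgen R x y.
  have [qP _ _ _] := qgen_relations R G; have [xE _] := qP x y.
  elim/ocls_ind: a => t; rewrite ocls_eval.
  elim: t => //= [||a Ha b Hb|a Ha b Hb|k a Ha|a Ha].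
  - by rewrite mulr0 mul0r.
  - by rewrite mulr1 mul1r.
  - by rewrite mulrDr mulrDl Ha Hb.
  - by rewrite mulrA Ha -mulrA Hb mulrA.
  - by rewrite -scalerAr -scalerAl Ha.
  - by rewrite -[in LHS]xE -[in RHS]xE -!starM Ha.
move=> a b; elim/ocls_ind: a => t; rewrite ocls_eval.
elim: t b => //= [||a Ha c Hc|a Ha c Hc|k a Ha|a Ha] b.
- by rewrite mulr0 mul0r.
- by rewrite mulr1 mul1r.
- by rewrite mulrDr mulrDl Ha Hc.
- by rewrite -mulrA Hc mulrA Ha mulrA.
- by rewrite -scalerAr -scalerAl Ha.
- by rewrite -[b]starK -!starM Ha.
Qed.

(** Quantum symmetry speaks of an arbitrary enveloping algebra, whereas commutativity is known for
    the constructed one. The universal properties give maps both ways, and uniqueness makes [h] a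
    left inverse of [g]. *)
Lemma enveloping_commutative (O : starAlgType R) (A A' : cstarAlgType R)
    (iota : {lrmorphism O -> A}) (iota' : {lrmorphism O -> A'}) :
  is_enveloping_cstar iota -> is_enveloping_cstar iota' ->
  commutative (@GRing.mul A') -> commutative (@GRing.mul A).
Proof.
case=> iS iU [iS' iU'] cA' a b.
have [g [gS gE _]] := iU _ iota' iS'; have [h [hS hE _]] := iU' _ iota iS.
have [k [_ _ kU]] := iU _ iota iS.
have hg c : h (g c) = c.
  have -> : h (g c) = k c.
    apply: (kU (h \o g : {lrmorphism A -> A})) => [d|d] /=; last by rewrite gE hE.
    by rewrite gS hS.
  by apply/esym/(kU (idfun : {lrmorphism A -> A})).
have gab : g (a * b) = g (b * a) by rewrite [LHS](rmorphM g) [RHS](rmorphM g) cA'.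
by rewrite -(hg (a * b)) gab hg.
Qed.

Lemma quantum_symmetry_schmidt (G : sgraph) : tree_cograph G ->
  has_quantum_symmetry R G -> schmidt_criterion G.
Proof.
move=> tG [A [iota [iE nA]]]; apply: contrapT => nS; apply: nA.
have [A' [iota' [iE' cO]]] := OQu_enveloping G.
apply: (enveloping_commutative iE iE'); apply: cO; apply: OQu_commutative => x y z t.
have nS' : ~ schmidt_in (@plain G) [set: G] by move/schmidt_plain.
by apply: (splittable_magic_comm (tree_cograph_splittable _ _ tG) nS' (qgen_magic G));
  rewrite inE.
Qed.

End Relations.

Theorem theorem6p33 (R : realType) :
  (forall G : sgraph, tree_cograph G ->
     (asymmetric G <-> quantum_asymmetric R G)) /\
  (forall G H : sgraph, tree_cograph G -> tree_cograph H ->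
     quantum_isomorphic R G H -> isomorphic G H) /\
  (forall G : sgraph, tree_cograph G ->
     (has_quantum_symmetry R G <-> schmidt_criterion G)).
Proof.
split; [|split] => [G tG|G H tG _|G tG].
- split; [exact: quantum_asymmetric_complete|exact: quantum_asymmetric_sound].
- exact: quantum_isomorphic_isomorphic.
- split; [exact: quantum_symmetry_schmidt|exact: schmidt_quantum_symmetry].
Qed.
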